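(* Let $(u,\pi,v,\theta)$ be a smooth solution on $\mathbb{R}^3$ of the stationary tropical climate model. Suppose that one of the following decay conditions holds as $|x|\to+\infty$: (C1)' $u(x)=o(|x|^{-2/3})$, $v(x)=O(|x|^{-2/3})$, $\nabla\theta(x)=o(|x|^{-7/3})$; (C2)' $u(x)=o(|x|^{-2/3})$, $v(x)=o(|x|^{-2/3})$, $\nabla\theta(x)=O(|x|^{-7/3})$; (C3)' $u(x)=o(|x|^{-2/3})$, $v(x)=O(|x|^{-4/3})$, $\nabla\theta(x)=o(|x|^{-5/3})$; (C4)' $u(x)=o(|x|^{-2/3})$, $v(x)=o(|x|^{-4/3})$, $\nabla\theta(x)=O(|x|^{-5/3})$. Then $u=v=0$ and $\theta$ is a constant.
   Context: A smooth solution of the stationary tropical climate model is a quadruple $(u,\pi,v,\theta)$ of $C^\infty$ functions on $\mathbb{R}^3$, with $u,v:\mathbb{R}^3\to\mathbb{R}^3$ and $\pi,\theta:\mathbb{R}^3\to\mathbb{R}$, satisfying on $\mathbb{R}^3$ $$-\Delta u+(u\cdot\nabla)u+\nabla\pi+\operatorname{div}(v\otimes v)=0,\quad -\Delta v+(u\cdot\nabla)v+\nabla\theta+(v\cdot\nabla)u=0,$$ $$-\Delta\theta+u\cdot\nabla\theta+\operatorname{div}v=0,\quad \operatorname{div}u=0.$$ *)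

(* Defs.v *)
From mathcomp Require Import all_boot all_order all_algebra.
From mathcomp Require Import all_classical all_reals all_analysis.

Set Implicit Arguments.
Unset Strict Implicit.
Unset Printing Implicit Defensive.

Import Order.TTheory GRing.Theory Num.Theory.
Import numFieldNormedType.Exports.

Local Open Scope classical_set_scope.
Local Open Scope ring_scope.

Section VectorCalculus.
Context {R : realType}.
Local Notation E := 'rV[R]_3.

(* The library norm of ['rV[R]_3] is the sup norm, hence [enorm]. *)
Definition enorm (x : E) : R := Num.sqrt (\sum_(i < 3) x 0 i ^+ 2).

Definition at_infinity : set_system E :=
  filter_from [set: R] (fun r => [set x | r < enorm x]).

#[global] Instance at_infinity_filter : Filter at_infinity.
Proof.
apply: filter_from_filter; first by exists 0.
move=> r s _ _; exists (Num.max r s) => // x /=.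
by rewrite gt_max => /andP[].
Qed.

Canonical at_infinity_filterType := FilterType at_infinity at_infinity_filter.

Section Operators.
Context {V : normedModType R}.

Definition partial (i : 'I_3) (f : E -> V) : E -> V := 'D_(delta_mx 0 i) f.

Definition smooth (f : E -> V) : Prop :=
  forall s : seq 'I_3,
    continuous (foldr partial f s) /\
    forall (i : 'I_3) (x : E), derivable (foldr partial f s) x (delta_mx 0 i).

Definition laplacian (f : E -> V) (x : E) : V :=
  \sum_(i < 3) partial i (partial i f) x.

(* [advection w f] is (w . nabla) f. *)
Definition advection (w : E -> E) (f : E -> V) (x : E) : V :=
  \sum_(i < 3) w x 0 i *: partial i f x.

End Operators.

Definition grad (f : E -> R) (x : E) : E := \row_(i < 3) partial i f x.

Definition div (w : E -> E) (x : E) : R :=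
  \sum_(i < 3) partial i (fun y => w y 0 i) x.

Definition tensor (v w : E -> E) (x : E) : 'M[R]_3 := (v x)^T *m w x.

(* Row-wise divergence: component i is the sum over j of d_j T_ij. *)
Definition tdiv (T : E -> 'M[R]_3) (x : E) : E :=
  \row_(i < 3) div (fun y => row i (T y)) x.

Definition smooth_tropical_climate_solution (u : E -> E) (p : E -> R) (v : E -> E)
    (theta : E -> R) : Prop :=
  [/\ [/\ smooth u, smooth p, smooth v & smooth theta] &
   forall x : E,
   [/\ - laplacian u x + advection u u x + grad p x + tdiv (tensor v v) x = 0,
       - laplacian v x + advection u v x + grad theta x + advection v u x = 0,
       - laplacian theta x + advection u theta x + div v x = 0 &
       div u x = 0]].

Definition littleo_at_infinity (f : E -> E) (a : R) : Prop :=
  (fun x => enorm (f x)) =o_at_infinity (fun x => enorm x `^ a).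

Definition bigO_at_infinity (f : E -> E) (a : R) : Prop :=
  (fun x => enorm (f x)) =O_at_infinity (fun x => enorm x `^ a).

End VectorCalculus.

(* Main.v *)
Require Import Defs.
From mathcomp Require Import all_boot all_order all_algebra.
From mathcomp Require Import all_classical all_reals all_analysis.
From mathcomp Require Import ring lra.

(** The proof is a local energy estimate on large shells, made scale invariant
by rescaling.

For r > 0 the functions u(r x), v(r x), p(r x), theta(r x) solve the same system
with viscosity 1 / r ([tropical_dilate]). Testing the equations with phi u,
phi v and phi (theta - c), where phi is a cutoff equal to 1 on the unit ball,
the coupling terms cancel in pairs up to terms that carry a derivative of phi
([energy_identity]). Those live in the shell 1 / 2 <= |x| <= 2 and are bounded
by the size there of u, v and of the oscillation of theta; the latter is bounded
by grad theta since any two points of the shell are joined by a short path in it.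
The outcome is [energy_bound]: the dissipation, times the viscosity, is at most
a constant times
   (1 / r) (mU^2 + mV^2 + mT^2) + mU (mU^2 + mV^2 + mT^2) + mV mT,
where mU, mV and mT bound u, v and r grad theta at distance about r from 0.

The delicate term is the pressure, on which nothing is assumed. It occurs as the
integral of P f with f = u . grad phi, and f is a divergence. [pressure_bound]
estimates this integral by M sup |f|, where M is the size of |u|^2 + |v|^2 + |u| / r
in the shell. Up to a small error f is a discrete convolution with an
approximate identity, and the latter is minus the Laplacian of a truncated Newton
potential up to a regular remainder ([kernel_exists]). This writes f as the sum
of a small function, of - lap B, and of a regular part Z. On the one hand, the
integral of P lap B is that of the Hessian of B against the tensor whose
divergence drives the pressure, and the L^2 norm of this Hessian is that of
lap B ([hessian_sq]), so that no singular integral is needed. On the other hand,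
the integral of P Z is a weighted sum of values of the convolution of P with a
regular kernel; the gradient of that convolution is controlled by M, and its
additive constant does not matter because f has mean zero.

Under each decay assumption the exponents of v and grad theta add up to -3 and
one of the two bounds is a little-o, as is the bound on u. With q = r^(-1/3), the
right-hand side of the energy estimate is then o(q^6), so that the dissipation is
o(1 / r). If some first derivative were nonzero at some point, the dissipation
would be at least c / r ([dissipation_lower]). Hence u, v and theta are constant
([gradients_vanish]), and the decay of u and v makes these two zero.

All integrals are over the cube [-4, 4]^3. Only linearity, positivity, the vanishing of the integral of a derivative
and a lower bound on small cubes are required of them, so [I] is a limit of
Riemann sums. The norm of the space is the sup norm: its balls are cubes. *)

Import Order.TTheory GRing.Theory Num.Theory.
Import numFieldNormedType.Exports.

Local Open Scope classical_set_scope.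
Local Open Scope ring_scope.

Set Implicit Arguments.
Unset Strict Implicit.
Unset Printing Implicit Defensive.

(** * Calculus along the axes *)

Section Calculus.
Context {R : realType}.
Local Notation E := 'rV[R]_3.
Implicit Types (f g : E -> R) (x y : E) (i j : 'I_3) (k : nat).

Definition axis i : E := delta_mx 0 i.

Lemma axisE i j : axis i 0 j = (i == j)%:R.
Proof. by rewrite mxE eqxx eq_sym. Qed.

(** An abbreviation of [partial] on scalar functions that is made opaque at the
end of the section, so that unification never unfolds it to a limit. *)
Definition pd i f : E -> R := partial i f.

Definition lap f x : R := \sum_i pd i (pd i f) x.

(** The class C^k, through iterated axis derivatives. The order stays finite
because the cutoffs below are truncated powers. *)
Fixpoint Ck k f : Prop := continuous f /\
  if k is k'.+1 then
    forall i, (forall x, derivable f x (axis i)) /\ Ck k' (pd i f)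
  else True.

Lemma Ck0 f : continuous f -> Ck 0 f.
Proof. by []. Qed.

Lemma Ck_continuous k f : Ck k f -> continuous f.
Proof. by case: k => [|k] []. Qed.

Lemma Ck_derivable k f : Ck k.+1 f -> forall i x, derivable f x (axis i).
Proof. by move=> [_ /= h] i x; case: (h i). Qed.

Lemma Ck_partial k f : Ck k.+1 f -> forall i, Ck k (pd i f).
Proof. by move=> [_ /= h] i; case: (h i). Qed.

Lemma CkS k f : continuous f -> (forall i x, derivable f x (axis i)) ->
  (forall i, Ck k (pd i f)) -> Ck k.+1 f.
Proof. by move=> cf df pf; split=> // i; split. Qed.

Lemma CkW k f : Ck k.+1 f -> Ck k f.
Proof.
elim: k f => [|k ih] f; first by case.
move=> [cf h]; split=> // i; have [dfi /ih] := h i; by split.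
Qed.

Lemma Ck_le k l f : (k <= l)%N -> Ck l f -> Ck k f.
Proof.
move=> /subnK <-; elim: (l - k)%N => [|n ih] //.
by rewrite addSn => /CkW.
Qed.

Lemma smooth_Ck k f : smooth f -> Ck k f.
Proof.
elim: k f => [|k ih] f sf; first by split=> //; exact: (sf [::]).1.
apply: CkS; [exact: (sf [::]).1 | by move=> i x; exact: (sf [::]).2|].
by move=> i; apply: ih => s; have := sf (rcons s i); rewrite foldr_rcons.
Qed.

Lemma derive_partial k f i x : Ck k.+1 f -> is_derive x (axis i) f (pd i f x).
Proof. by move=> /Ck_derivable h; exact: derivableP. Qed.

Lemma partialE f i x d : is_derive x (axis i) f d -> pd i f x = d.
Proof. by move=> [_ <-]. Qed.

(** Reduces directional derivatives to those of functions of one variable, where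
the chain rule and the mean value theorem apply. *)
Lemma is_derive_line f x (v : E) (d : R) :
  is_derive (0 : R) 1 (fun h : R => f (h *: v + x)) d <-> is_derive x v f d.
Proof.
have E1 : (fun h : R => h^-1 *: (((fun h : R => f (h *: v + x)) \o shift 0) (h *: 1)
      - f (0 *: v + x))) = (fun h : R => h^-1 *: ((f \o shift x) (h *: v) - f x)).
  apply/funext => h /=; by rewrite addr0 scale0r add0r -[h%:A]/(h * 1) mulr1.
split=> -[df <-].
  by apply: DeriveDef; [exact/derivable1P|rewrite /derive E1].
by apply: DeriveDef; [exact: (derivable1P f x v).1|rewrite /derive E1].
Qed.

Lemma is_derive_along f x (v : E) (t d : R) : is_derive (t *: v + x) v f d ->
  is_derive t 1 (fun h : R => f (h *: v + x)) d.
Proof.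
move=> /is_derive_line df.
have E1 : (fun h : R => h^-1 *: (((fun h : R => f (h *: v + x)) \o shift t) (h *: 1)
      - f (t *: v + x))) = (fun h : R => h^-1 *: (((fun h : R => f (h *: v + (t *: v + x))) \o shift 0) (h *: 1)
      - f (0 *: v + (t *: v + x)))).
  by apply/funext => h /=; rewrite -[h%:A]/(h * 1) mulr1 addr0 scale0r add0r scalerDl addrA.
case: df => df <-; apply: DeriveDef; last by rewrite /derive E1.
by move: df; rewrite /derivable E1.
Qed.

Lemma Ck_cst k (c : R) : Ck k (fun=> c).
Proof.
elim: k c => [|k ih] c; first by split=> // x; exact: cst_continuous.
apply: CkS => [x|i x|i]; [exact: cst_continuous | exact: derivable_cst|].
rewrite (_ : pd i _ = fun=> 0) //; apply/funext => x.
exact: derive_cst.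
Qed.

Lemma partial_cst i (c : R) x : pd i (fun=> c) x = 0.
Proof. exact: derive_cst. Qed.

Lemma partialD k f g i x : Ck k.+1 f -> Ck k.+1 g ->
  pd i (fun x => f x + g x) x = pd i f x + pd i g x.
Proof. by move=> /Ck_derivable df /Ck_derivable dg; exact: deriveD. Qed.

Lemma partialM k f g i x : Ck k.+1 f -> Ck k.+1 g ->
  pd i (fun x => f x * g x) x = pd i f x * g x + f x * pd i g x.
Proof.
move=> /Ck_derivable df /Ck_derivable dg.
have := deriveM (df i x) (dg i x); rewrite /pd /partial => ->.
by rewrite addrC; congr (_ + _); exact: mulrC.
Qed.

Lemma CkD k f g : Ck k f -> Ck k g -> Ck k (fun x => f x + g x).
Proof.
elim: k f g => [|k ih] f g Cf Cg.
  by split=> // x; apply: continuousD; [exact: (Ck_continuous Cf)|exact: (Ck_continuous Cg)].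
apply: CkS => [x|i x|i].
- by apply: continuousD; [exact: (Ck_continuous Cf)|exact: (Ck_continuous Cg)].
- by apply: derivableD; [exact: (Ck_derivable Cf)|exact: (Ck_derivable Cg)].
rewrite (_ : pd i _ = fun x => pd i f x + pd i g x).
  by apply: ih; exact: Ck_partial.
by apply/funext => x; exact: (partialD _ _ Cf Cg).
Qed.

Lemma CkM k f g : Ck k f -> Ck k g -> Ck k (fun x => f x * g x).
Proof.
elim: k f g => [|k ih] f g Cf Cg.
  by split=> // x; apply: continuousM; [exact: (Ck_continuous Cf)|exact: (Ck_continuous Cg)].
apply: CkS => [x|i x|i].
- by apply: continuousM; [exact: (Ck_continuous Cf)|exact: (Ck_continuous Cg)].
- by apply: derivableM; [exact: (Ck_derivable Cf)|exact: (Ck_derivable Cg)].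
rewrite (_ : pd i _ = fun x => pd i f x * g x + f x * pd i g x).
  by apply: CkD; apply: ih; by [exact: Ck_partial|exact: CkW].
by apply/funext => x; exact: (partialM _ _ Cf Cg).
Qed.

Lemma CkZ k (c : R) f : Ck k f -> Ck k (fun x => c * f x).
Proof. by move=> ?; apply: CkM => //; exact: Ck_cst. Qed.

Lemma partialZ k (c : R) f i x : Ck k.+1 f ->
  pd i (fun x => c * f x) x = c * pd i f x.
Proof.
move=> Cf; rewrite (@partialM k) ?partial_cst ?mul0r ?add0r//; exact: Ck_cst.
Qed.

Lemma CkN k f : Ck k f -> Ck k (fun x => - f x).
Proof.
by move=> /(@CkZ _ (-1)); congr Ck; apply/funext => x; rewrite mulN1r.
Qed.

Lemma partialN k f i x : Ck k.+1 f -> pd i (fun x => - f x) x = - pd i f x.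
Proof.
move=> /(@partialZ k (-1) f i x); rewrite mulN1r => <-; congr pd.
by apply/funext => y; rewrite mulN1r.
Qed.

Lemma CkB k f g : Ck k f -> Ck k g -> Ck k (fun x => f x - g x).
Proof. by move=> Cf /CkN; exact: CkD. Qed.

Lemma Ck_sum k (I : Type) (r : seq I) (P : pred I) (F : I -> E -> R) :
  (forall a, P a -> Ck k (F a)) -> Ck k (fun x => \sum_(a <- r | P a) F a x).
Proof.
move=> CF; elim: r => [|a r ih].
  by under eq_fun do rewrite big_nil; exact: Ck_cst.
rewrite (_ : (fun _ => _) = (fun x => if P a then F a x + \sum_(b <- r | P b) F b x else \sum_(b <- r | P b) F b x)); last by apply/funext => y; rewrite big_cons.
by case: (boolP (P a)) => // Pa; apply: CkD => //; exact: CF.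
Qed.

Lemma partial_sum k (I : Type) (r : seq I) (P : pred I) (F : I -> E -> R) i x :
  (forall a, P a -> Ck k.+1 (F a)) ->
  pd i (fun x => \sum_(a <- r | P a) F a x) x =
    \sum_(a <- r | P a) pd i (F a) x.
Proof.
move=> CF; elim: r => [|a r ih].
  by rewrite big_nil; under eq_fun do rewrite big_nil; exact: partial_cst.
rewrite big_cons; rewrite (_ : (fun _ => _) = (fun x => if P a then F a x + \sum_(b <- r | P b) F b x else \sum_(b <- r | P b) F b x)); last by apply/funext => y; rewrite big_cons.
case: ifP => // Pa; rewrite (@partialD k) ?ih//; first exact: CF.
exact: Ck_sum.
Qed.

Lemma is_derive_coord i j x : is_derive x (axis i) (fun y : E => y 0 j) (i == j)%:R.
Proof.
apply/is_derive_line.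
have d1 : is_derive (0 : R) 1 (fun h : R => (h *: axis i + x) 0 j) (1 *: (i == j)%:R + 0).
  have -> : (fun h : R => (h *: axis i + x) 0 j) =
     (fun h : R => h *: ((i == j)%:R : R)) + cst (x 0 j).
    by apply/funext => h; rewrite !mxE !eqxx /= eq_sym.
  apply: is_deriveD.
  have -> : (fun h : R => h *: ((i == j)%:R : R)) = (i == j)%:R \*: (id : R -> R).
    by apply/funext => h /=; rewrite -![_ *: _]/(_ * _) mulrC.
  apply: is_derive_eq.
  by rewrite -![_ *: _]/(_ * _) mulrC.
by move: d1; rewrite addr0 scale1r.
Qed.

Lemma partial_coord i j x : pd i (fun y : E => y 0 j) x = (i == j)%:R.
Proof. exact/partialE/is_derive_coord. Qed.

Lemma Ck_coord k j : Ck k (fun x => x 0 j).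
Proof.
case: k => [|k]; first by split=> //; exact: coord_continuous.
apply: CkS => [|i x|i]; first exact: coord_continuous.
  by have [] := is_derive_coord i j x.
rewrite (_ : pd i _ = fun=> ((i == j)%:R : R)); first exact: Ck_cst.
by apply/funext => x; exact: partial_coord.
Qed.

Lemma is_derive_dilate f (a : R) y i x d :
  is_derive (a *: x + y) (axis i) f d ->
  is_derive x (axis i) (fun x => f (a *: x + y)) (a * d).
Proof.
move=> /is_derive_line df; apply/is_derive_line.
have -> : (fun h : R => f (a *: (h *: axis i + x) + y)) =
    (fun h : R => f (h *: axis i + (a *: x + y))) \o (fun h => a * h).
  by apply/funext => h /=; rewrite scalerDr scalerA addrA.
rewrite mulrC; apply: is_derive1_comp; first by rewrite mulr0.
have -> : (fun h : R => a * h) = a \*: (id : R -> R) by apply/funext.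
by apply: is_derive_eq; rewrite -[_ *: _]/(_ * _) mulr1.
Qed.

Lemma partial_dilate k f (a : R) y i x : Ck k.+1 f ->
  pd i (fun x => f (a *: x + y)) x = a * pd i f (a *: x + y).
Proof.
by move=> Cf; exact/partialE/is_derive_dilate/(derive_partial _ _ Cf).
Qed.

Lemma Ck_dilate k f (a : R) y : Ck k f -> Ck k (fun x => f (a *: x + y)).
Proof.
have cc g : continuous g -> continuous (fun x => g (a *: x + y)).
  move=> cg x; apply: (@continuous_comp _ _ _ (fun x => a *: x + y) g); last exact: cg.
  apply: (@continuousD _ _ _ (fun x => a *: x) (fun=> y)).
  - exact: scaler_continuous.
  - exact: cst_continuous.
elim: k f => [|k ih] f Cf; first by split=> //; apply: cc; case: Cf.
apply: CkS => [|i x|i]; first by apply: cc; case: Cf.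
  by have [] := is_derive_dilate (derive_partial i (a *: x + y) Cf).
rewrite (_ : pd i _ = fun x => a * pd i f (a *: x + y)).
  apply: CkZ; apply: ih; exact: Ck_partial.
by apply/funext => x; exact: (partial_dilate _ _ _ _ Cf).
Qed.

(** A truncated power; with exponent m + 2 it has m + 1 continuous derivatives,
and composing two of them yields cutoffs of any prescribed order. *)
Definition ramp (m : nat) (t : R) : R := Num.max t 0 ^+ m.+2.

Lemma ramp_ge0 m t : 0 <= ramp m t.
Proof. by apply: exprn_ge0; rewrite le_max lexx orbT. Qed.

Lemma ramp_eq0 m t : t <= 0 -> ramp m t = 0.
Proof. by move=> t0; rewrite /ramp max_r// expr0n. Qed.

Lemma ramp_ge1 m t : 1 <= t -> 1 <= ramp m t.
Proof.
by move=> t1; rewrite /ramp max_l ?(le_trans _ t1)// exprn_ege1.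
Qed.

Lemma ramp_le1 m t : t <= 1 -> ramp m t <= 1.
Proof.
move=> t1; apply: exprn_ile1; first by rewrite le_max lexx orbT.
by rewrite ge_max t1 ler01.
Qed.

Lemma continuous_ramp m : continuous (ramp m).
Proof.
move=> t; apply: (@continuous_comp _ _ _ (fun t : R => Num.max t 0) (fun t => t ^+ m.+2)).
  by apply: (@continuous_max R R id (cst 0)) => //; exact: cst_continuous.
exact: exprn_continuous.
Qed.

(** A quadratic remainder is what one gets for functions without a differentiable
formula: truncated squares at 0, and convolutions. *)
Lemma is_derive_quad (g : R -> R) (t d C : R) :
  (forall h, `|h| <= 1 -> `|g (h + t) - g t - h * d| <= C * h ^+ 2) -> is_derive t 1 g d.
Proof.
move=> gC.
have lim : (fun h : R => h^-1 *: ((g \o shift t) (h *: (1 : R)) - g t)) @ 0^' --> d.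
  apply/cvgrPdist_le => /= e e0; near=> h.
  have h0 : h != 0 by near: h; exact: nbhs_dnbhs_neq.
  have hn : 0 < `|h| by rewrite normr_gt0.
  have h1 : `|h| <= 1 by near: h; apply: dnbhs0_le.
  have hC : `|h| <= e / (`|C| + 1).
    by near: h; apply: dnbhs0_le; rewrite divr_gt0// ltr_wpDl.
  rewrite -[h *: (1 : R)]/(h * 1) mulr1 -[_ *: _]/(_ * _) distrC.
  have -> : h^-1 * (g (h + t) - g t) - d = h^-1 * (g (h + t) - g t - h * d).
    by field.
  rewrite normrM normfV ler_pdivrMl//; apply: le_trans (gC h h1) _.
  have -> : h ^+ 2 = `|h| ^+ 2 by rewrite real_normK ?num_real.
  apply: (@le_trans _ _ ((`|C| + 1) * `|h| ^+ 2)).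
    apply: ler_wpM2r; first exact: exprn_ge0.
    by rewrite (le_trans (ler_norm _))// lerDl.
  rewrite expr2 mulrCA; apply: ler_wpM2l => //.
  by move: hC; rewrite ler_pdivlMr ?ltr_wpDl// mulrC.
apply: DeriveDef; first by apply/cvg_ex; exists d.
exact: cvg_lim.
Unshelve. all: by end_near. Qed.

(** Only the truncated square needs a discussion of signs; the other powers are
obtained from it by multiplication by the variable. *)
Lemma is_derive_ramp m (t : R) :
  is_derive t 1 (ramp m) (m.+2%:R * Num.max t 0 ^+ m.+1).
Proof.
elim: m t => [|m ih] t.
  apply: (@is_derive_quad _ _ _ 1) => h _; rewrite /ramp mul1r expr1.
  rewrite ler_norml; apply/andP; split;
  by case: (ltP (h + t) 0) => h0; case: (ltP t 0) => t0; rewrite ?(max_l h0) ?(max_r (ltW h0)) ?(max_l t0) ?(max_r (ltW t0)); nra.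
have rM s n : Num.max s 0 ^+ n.+2 = s * Num.max s 0 ^+ n.+1 :> R.
  case: (ltP s 0) => s0; first by rewrite !expr0n /= mulr0.
  by rewrite exprS.
have -> : ramp m.+1 = (id : R -> R) * ramp m.
  by apply/funext => s; rewrite /ramp rM.
apply: is_derive_eq.
rewrite -![_ *: _]/(_ * _) mulr1 /ramp /= !rM -!natr1.
ring.
Qed.

Lemma is_derive_comp (h : R -> R) f x i (a d : R) :
  is_derive (f x) 1 h a -> is_derive x (axis i) f d ->
  is_derive x (axis i) (fun y => h (f y)) (a * d).
Proof.
move=> dh /is_derive_line df; apply/is_derive_line.
have := @is_derive1_comp R h (fun t => f (t *: axis i + x)) 0 a d.
by apply; rewrite ?scale0r ?add0r.
Qed.

Lemma Ck_ramp k f : Ck k f -> Ck k (fun x => ramp k (f x)).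
Proof.
have cc n g : continuous g -> continuous (fun x => ramp n (g x)).
  by move=> cg x; apply: (@continuous_comp _ _ _ g (ramp n)); [exact: cg|exact: continuous_ramp].
elim: k => [|k ih] Cf; first by split=> //; apply/cc/(Ck_continuous Cf).
apply: CkS => [|i x|i]; first exact/cc/(Ck_continuous Cf).
  by have [] := is_derive_comp (is_derive_ramp k.+1 (f x)) (derive_partial i x Cf).
rewrite (_ : pd i _ = fun x => k.+3%:R * ramp k (f x) * pd i f x).
  by apply: CkM; [exact/CkZ/ih/CkW|exact: Ck_partial].
apply/funext => x.
exact: (partialE (is_derive_comp (is_derive_ramp k.+1 (f x)) (derive_partial i x Cf))).
Qed.

(** The two conditions on s say that it lies between 0 and t, whatever the sign
of t. *)
Lemma partial_MVT f i x (t : R) : (forall y, derivable f y (axis i)) ->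
  exists2 s : R, `|s| <= `|t| /\ 0 <= s * t &
    f (t *: axis i + x) - f x = t * pd i f (s *: axis i + x).
Proof.
move=> df.
pose g (s : R) := f (s *: axis i + x).
have dg (s : R) : is_derive s 1 g (pd i f (s *: axis i + x)).
  exact/is_derive_along/derivableP/df.
have cg A : {within A, continuous g}.
  apply: continuous_subspaceT => s.
  by apply: differentiable_continuous; apply/derivable1_diffP; have [] := dg s.
have [t0|t0|->] := ltgtP t 0.
- have [c] := @MVT R g _ t 0 t0 (fun s _ => dg s) (cg _).
  rewrite in_itv /= => /andP[c1 c2] e; exists c.
    split; first by rewrite !ltr0_norm//; lra.
    by apply: mulr_le0; exact: ltW.
  move: e; rewrite /g scale0r add0r => e; lra.
- have [c] := @MVT R g _ 0 t t0 (fun s _ => dg s) (cg _).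
  rewrite in_itv /= => /andP[c1 c2] e; exists c.
    split; first by rewrite !gtr0_norm//; lra.
    by apply: mulr_ge0; exact: ltW.
  move: e; rewrite /g scale0r add0r => e; lra.
- by exists 0; [split; rewrite ?mulr0|rewrite !scale0r add0r subrr mul0r].
Qed.

End Calculus.

#[global] Opaque pd Ck.

(** * Integrals as limits of Riemann sums *)

Section Integral.
Context {R : realType}.
Local Notation E := 'rV[R]_3.
Implicit Types (f g : E -> R) (x y : E) (i j : 'I_3) (k : nat).

Definition mesh (n : nat) : R := n.+1%:R^-1.

Lemma mesh_gt0 n : 0 < mesh n. Proof. by rewrite invr_gt0. Qed.

Lemma mesh_small (e : R) : 0 < e -> \forall n \near \oo, mesh n <= e.
Proof.
move=> e0; have := near_infty_natSinv_lt (PosNum e0).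
by apply: filter_app; near=> n => /ltW.
Unshelve. all: by end_near. Qed.

(** [(cells n).+1] is 8 (n + 1), the number of points of step 1 / (n + 1) in
[-4, 4); the successor form makes the type of indices visibly nonempty. *)
Definition cells n := (8 * n.+1).-1.

Lemma cellsE n : (cells n).+1%:R * mesh n = 8 :> R.
Proof.
rewrite /cells prednK ?muln_gt0// natrM /mesh mulfK//.
Qed.

Definition node n (a : {ffun 'I_3 -> 'I_(cells n).+1}) : E :=
  \row_i ((a i)%:R * mesh n - 4).

Definition riemann n f : R := mesh n ^+ 3 * \sum_(a : {ffun 'I_3 -> 'I_(cells n).+1}) f (node a).

Lemma riemannE n f : riemann n f =
  mesh n ^+ 3 * \sum_(a : {ffun 'I_3 -> 'I_(cells n).+1}) f (node a).
Proof. by []. Qed.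

Lemma node_le n (a : {ffun 'I_3 -> 'I_(cells n).+1}) : `|node a| <= 4.
Proof.
rewrite /Num.Def.normr/= mx_normrE bigmax_le// => -[i0 i] _ /=.
rewrite mxE ler_norml; apply/andP; split.
  by rewrite lerBrDr addNr mulr_ge0// ltW// mesh_gt0.
have : (a i)%:R * mesh n <= (cells n).+1%:R * mesh n.
  by rewrite ler_pM2r ?mesh_gt0// ler_nat ltnW.
rewrite cellsE; lra.
Qed.

Lemma riemannD n f g : riemann n (fun x => f x + g x) = riemann n f + riemann n g.
Proof. by rewrite /riemann big_split mulrDr. Qed.

Lemma riemannZ n (c : R) f : riemann n (fun x => c * f x) = c * riemann n f.
Proof. by rewrite /riemann -mulr_sumr mulrCA. Qed.

Lemma riemann_le n f g : (forall x, `|x| <= 4 -> f x <= g x) -> riemann n f <= riemann n g.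
Proof.
move=> fg; apply: ler_wpM2l; first by rewrite exprn_ge0 ?ltW ?mesh_gt0.
by apply: ler_sum => a _; apply: fg; exact: node_le.
Qed.

Lemma riemann_cst n (c : R) : riemann n (fun=> c) = 8 ^+ 3 * c.
Proof.
rewrite /riemann sumr_const card_ffun !card_ord -[c *+ _]mulr_natr mulrC -mulrA natrX -exprMn cellsE.
ring.
Qed.

Lemma riemann_norm n f : `|riemann n f| <= riemann n (fun x => `|f x|).
Proof.
rewrite /riemann normrM (ger0_norm (exprn_ge0 _ (ltW (mesh_gt0 n)))).
by apply: ler_wpM2l; [rewrite exprn_ge0 ?ltW ?mesh_gt0|exact: ler_norm_sum].
Qed.

Lemma riemann_bound n f (C : R) : (forall x, `|x| <= 4 -> `|f x| <= C) -> `|riemann n f| <= 8 ^+ 3 * C.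
Proof.
by move=> fC; apply: le_trans (riemann_norm _ _) _; rewrite -(riemann_cst n); exact: riemann_le.
Qed.

(** The shift by one step along axis i wraps around, so that it permutes the grid.
For a function that vanishes near the boundary of the cube the wrap-around is
harmless: see [vanish_next]. *)
Definition next n i (a : {ffun 'I_3 -> 'I_(cells n).+1}) : {ffun 'I_3 -> 'I_(cells n).+1} :=
  [ffun j => if j == i then ordS (a j) else a j].

Lemma next_inj n i : injective (@next n i).
Proof.
move=> a b /ffunP ab; apply/ffunP => j; have := ab j; rewrite !ffunE.
by case: ifP => // _ /ordS_inj.
Qed.

Definition vanish (r : R) f := forall x, r < `|x| -> f x = 0.

Lemma coord_le x i : `|x 0 i| <= `|x|.
Proof.
rewrite [leRHS]/Num.Def.normr/= mx_normrE.
by apply: (le_trans _ (le_bigmax _ _ (0, i))).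
Qed.

Lemma vanish_next n i (a : {ffun 'I_3 -> 'I_(cells n).+1}) f : vanish 3 f ->
  f (mesh n *: axis i + node a) = f (node (next i a)).
Proof.
move=> f0; have [ai|ai] := ltnP (a i).+1 (cells n).+1.
  congr f; apply/rowP => j; rewrite !mxE ffunE eqxx /=; case: (eqVneq j i) => [->|ji].
    by rewrite /= modn_small// -natr1; ring.
  by rewrite mulr0 add0r.
have {}ai : (a i).+1 = (cells n).+1 by apply/eqP; rewrite eqn_leq ai ltn_ord.
rewrite !f0//.
- apply: lt_le_trans (coord_le _ i); rewrite !mxE ffunE eqxx /= ai modnn mul0r sub0r.
  rewrite normrN ger0_norm//; lra.
- apply: lt_le_trans (coord_le _ i); rewrite !mxE !eqxx /= mulr1.
  have -> : mesh n + ((a i)%:R * mesh n - 4) = (a i).+1%:R * mesh n - 4 by rewrite -natr1; ring.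
  by rewrite ai cellsE ger0_norm; lra.
Qed.

(** The difference quotient of f along axis i has Riemann sum exactly 0, since the
shift permutes the grid; it differs from the derivative by at most C times the
step. *)
Lemma riemann_partial n f i (C : R) : Ck 2 f -> vanish 3 f ->
  (forall x, `|pd i (pd i f) x| <= C) ->
  `|riemann n (pd i f)| <= 8 ^+ 3 * C * mesh n.
Proof.
move=> Cf f0 fC.
have h0 := mesh_gt0 n.
have -> : riemann n (pd i f) = riemann n (fun x => pd i f x -
    (mesh n)^-1 * (f (mesh n *: axis i + x) - f x)).
  have e0 : riemann n (fun x => (mesh n)^-1 * (f (mesh n *: axis i + x) - f x)) = 0.
    rewrite riemannZ /riemann sumrB.
    under eq_bigr do rewrite vanish_next//.
    by rewrite [X in _ - X](reindex_inj (@next_inj n i)) subrr !mulr0.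
  rewrite -[LHS]subr0 -[in LHS]e0 -mulN1r -riemannZ -riemannD.
  by congr riemann; apply/funext => x; rewrite mulN1r.
rewrite -mulrA; apply: riemann_bound => x _.
have [s [s1 _] ->] := partial_MVT x (mesh n) (@Ck_derivable _ _ _ Cf i).
rewrite mulKf ?gt_eqF//.
have [s' [_ _]] := partial_MVT x s (@Ck_derivable _ _ _ (Ck_partial Cf i) i).
rewrite distrC => ->; rewrite normrM mulrC; apply: ler_pM => //.
by rewrite (le_trans s1)// ger0_norm// ltW.
Qed.

Lemma vanish_partial f i r : vanish r f -> vanish r (pd i f).
Proof.
move=> f0 x rx; rewrite -(partial_cst i (0 : R) x).
apply: near_eq_derive; near=> y; apply: f0; near: y.
have : open [set y : E | r < `|y|].
  apply: (@open_comp _ _ (fun y : E => `|y|) [set t | r < t]); last exact: open_gt.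
  by move=> y _; exact: norm_continuous.
by move=> oA; exact: (open_nbhs_nbhs (conj oA rx)).
Unshelve. all: by end_near. Qed.

Lemma continuous_bounded (r : R) f : continuous f ->
  exists C : R, forall x, `|x| <= r -> `|f x| <= C.
Proof.
move=> cf; have [r0|r0] := ltP r 0.
  by exists 0 => x /le_lt_trans/(_ r0); rewrite ltNge normr_ge0.
have [|||c _ cM] := @EVT_max_rV R 3 (fun x => `|f x|) [set x | `|x| <= r].
- by exists 0; rewrite /= normr0.
- apply: bounded_closed_compact.
    by exists r; split; rewrite ?num_real// => M rM x /= xr; exact: le_trans (ltW rM).
  apply: (@closed_comp _ _ (fun y : E => `|y|) [set t | t <= r]); last exact: closed_le.
  by move=> y _; exact: norm_continuous.
- apply: continuous_subspaceT => x.
  by apply: (@continuous_comp _ _ _ f (fun t => `|t|)); [exact: cf|exact: norm_continuous].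
by exists `|f c| => x xr; apply: cM; rewrite inE.
Qed.

Lemma vanish_bounded f r : continuous f -> vanish r f -> exists2 C : R, 0 < C & forall x, `|f x| <= C.
Proof.
move=> /(@continuous_bounded r)[C fC] f0; exists (`|C| + 1); first by rewrite ltr_wpDl.
move=> x; have [/fC fx|/f0 ->] := leP `|x| r; last by rewrite normr0 addr_ge0.
by rewrite (le_trans fx)// (le_trans (ler_norm _))// lerDl.
Qed.

Lemma limU_exists : {U : set_system nat | UltraFilter U /\ \oo `<=` U}.
Proof. exact: cid (ultraFilterLemma _). Qed.

(** An ultrafilter finer than the neighbourhoods of infinity: every bounded
sequence converges along it. *)
Definition limU : set_system nat := sval limU_exists.

#[local] Instance limU_ultra : UltraFilter limU.
Proof. by rewrite /limU; case: limU_exists => U []. Qed.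

Lemma limU_ge : \oo `<=` limU.
Proof. by rewrite /limU; case: limU_exists => U []. Qed.

(** Taking the limit along an ultrafilter makes the integral linear and monotone
on all functions bounded on the cube, without any criterion of integrability. *)
Definition I f : R := lim (riemann n f @[n --> limU]).

Definition bdd f := exists C : R, forall x, `|x| <= 4 -> `|f x| <= C.

Lemma I_cvg f : bdd f -> riemann n f @[n --> limU] --> I f.
Proof.
move=> [C fC].
have := @segment_compact R (- (8 ^+ 3 * C)) (8 ^+ 3 * C); rewrite compact_ultra.
move=> /(_ (riemann n f @[n --> limU]) _)[||p [_ /= Fp]].
- apply: Build_UltraFilter => G PG sG; apply/seteqP; split=> // A GA.
  have [//|nA] := in_ultra_setVsetC ((fun n => riemann n f) @^-1` A) limU_ultra.
  exfalso; apply: (@filter_not_empty _ G).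
  rewrite -(setICr A); apply: filterI => //; exact: sG.
- apply: (@filterS _ limU _ setT) => [n _|]; last exact: filterT.
  by rewrite /= in_itv /= -ler_norml; exact: riemann_bound.
by apply/cvg_ex; exists p.
Qed.

Lemma bdd_Ck k f : Ck k f -> bdd f.
Proof. by move/Ck_continuous/(@continuous_bounded 4). Qed.

Lemma ID f g : bdd f -> bdd g -> I (fun x => f x + g x) = I f + I g.
Proof.
move=> /I_cvg cf /I_cvg cg; apply: cvg_lim => //.
by under eq_fun do rewrite riemannD; exact: cvgD.
Qed.

Lemma IZ (c : R) f : bdd f -> I (fun x => c * f x) = c * I f.
Proof.
move=> /I_cvg cf; apply: cvg_lim => //.
by under eq_fun do rewrite riemannZ; apply: cvgMr.
Qed.

Lemma IN f : bdd f -> I (fun x => - f x) = - I f.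
Proof. by move=> /(IZ (-1)); rewrite mulN1r => <-; congr I; apply/funext => x; rewrite mulN1r. Qed.

Lemma I_near_le f (c : R) : bdd f -> (\forall n \near \oo, riemann n f <= c) -> I f <= c.
Proof. by move=> /I_cvg cf fc; apply: (cvgr_to_le cf); exact: limU_ge. Qed.

Lemma I_near_ge f (c : R) : bdd f -> (\forall n \near \oo, c <= riemann n f) -> c <= I f.
Proof. by move=> /I_cvg cf fc; apply: (cvgr_to_ge cf); exact: limU_ge. Qed.

Lemma I_le f g : bdd f -> bdd g -> (forall x, `|x| <= 4 -> f x <= g x) -> I f <= I g.
Proof.
move=> /I_cvg cf /I_cvg cg fg; apply: (ler_cvg_to cf cg).
apply: (@filterS _ limU _ setT) => [n _|]; last exact: filterT.
exact: riemann_le.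
Qed.

Lemma I_bound f (C : R) : (forall x, `|x| <= 4 -> `|f x| <= C) -> `|I f| <= 8 ^+ 3 * C.
Proof.
move=> fC; have bf : bdd f by exists C.
have fn n := riemann_bound n fC.
rewrite ler_norml; apply/andP; split.
  by apply: I_near_ge => //; near=> n; have := fn n; rewrite ler_norml => /andP[].
by apply: I_near_le => //; near=> n; have := fn n; rewrite ler_norml => /andP[].
Unshelve. all: by end_near. Qed.

Lemma I_norm f : bdd f -> `|I f| <= I (fun x => `|f x|).
Proof.
move=> bf; have bn : bdd (fun x => `|f x|).
  by case: bf => C fC; exists C => x /fC; rewrite normr_id.
rewrite ler_norml -IN//; apply/andP; split; apply: I_le => //.
- by case: bn => C fC; exists C => x /fC; rewrite normrN.
- by move=> x _; rewrite lerNl -normrN ler_norm.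
- by move=> x _; exact: ler_norm.
Qed.

Lemma I_cst (c : R) : I (fun=> c) = 8 ^+ 3 * c.
Proof. by apply: cvg_lim => //; under eq_fun do rewrite riemann_cst; exact: cvg_cst. Qed.

Lemma I0 : I (fun=> 0) = 0.
Proof.
apply/eqP; rewrite -normr_le0 -{2}(mulr0 (8 ^+ 3)); apply: I_bound => x _.
by rewrite normr0.
Qed.

Lemma eq_I f g : f =1 g -> I f = I g.
Proof. by move/funext ->. Qed.

Lemma I_sum (T : Type) (r : seq T) (P : pred T) (F : T -> E -> R) k :
  (forall a, P a -> Ck k (F a)) ->
  I (fun x => \sum_(a <- r | P a) F a x) = \sum_(a <- r | P a) I (F a).
Proof.
move=> CF; elim: r => [|a r ih].
  by rewrite [RHS]big_nil -[RHS]I0; apply: eq_I => x; rewrite big_nil.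
rewrite big_cons; case: (boolP (P a)) => Pa; last first.
  by rewrite -ih; apply: eq_I => x; rewrite big_cons (negbTE Pa).
rewrite -ih -ID; [|exact: bdd_Ck (CF _ Pa)|exact: bdd_Ck (Ck_sum _ CF)].
by apply: eq_I => x; rewrite big_cons Pa.
Qed.

(** The divergence theorem for functions supported inside the cube: the error in
[riemann_partial] tends to 0 with the step. *)
Lemma I_partial f i : Ck 2 f -> vanish 3 f -> I (pd i f) = 0.
Proof.
move=> Cf f0; have bp : bdd (pd i f) := bdd_Ck (Ck_partial Cf i).
have [C C0 fC] : exists2 C : R, 0 < C & forall x, `|pd i (pd i f) x| <= C.
  apply: (@vanish_bounded _ 3); last by do 2 apply: vanish_partial.
  exact: (Ck_continuous (Ck_partial (Ck_partial Cf i) i)).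
have small e : 0 < e -> \forall n \near \oo, `|riemann n (pd i f)| <= e.
  move=> e0; near=> n.
  apply: le_trans (riemann_partial n Cf f0 fC) _.
  rewrite -ler_pdivlMl ?mulr_gt0//; near: n; apply: mesh_small.
  by rewrite mulr_gt0// invr_gt0 mulr_gt0.
apply/eqP; rewrite eq_le; apply/andP; split; apply/ler_addgt0Pr => e e0.
  rewrite add0r; apply: I_near_le => //; have := small e e0.
  by apply: filterS => n; rewrite ler_norml => /andP[].
rewrite -lerBlDr sub0r; apply: I_near_ge => //; have := small e e0.
by apply: filterS => n; rewrite ler_norml => /andP[].
Unshelve. all: by end_near. Qed.

Lemma vanishMl r f g : vanish r f -> vanish r (fun x => f x * g x).
Proof. by move=> f0 x /f0 ->; rewrite mul0r. Qed.

Lemma vanishMr r f g : vanish r g -> vanish r (fun x => f x * g x).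
Proof. by move=> f0 x /f0 ->; rewrite mulr0. Qed.

Lemma ibp f g i : Ck 2 f -> Ck 2 g -> vanish 3 (fun x => f x * g x) ->
  I (fun x => f x * pd i g x) = - I (fun x => pd i f x * g x).
Proof.
move=> Cf Cg fg0; apply/eqP; rewrite -addr_eq0 addrC -ID.
- rewrite -(I_partial i (CkM Cf Cg) fg0); apply/eqP/eq_I => x.
  by rewrite (partialM _ _ Cf Cg).
- apply: (@bdd_Ck 1); apply: CkM; [exact: Ck_partial|exact: CkW].
- apply: (@bdd_Ck 1); apply: CkM; [exact: CkW|exact: Ck_partial].
Qed.

Lemma card_interval (M s q : nat) : (s + q <= M)%N ->
  \sum_(a < M) (s <= a < s + q)%N%:R = q%:R :> R.
Proof.
move=> sqM; rewrite -(big_mkord xpredT (fun a => (s <= a < s + q)%N%:R)).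
rewrite (@big_cat_nat _ _ _ s)//=; last exact: leq_trans (leq_addr _ _) sqM.
rewrite (@big_cat_nat _ _ _ (s + q) s)//= ?leq_addr//.
rewrite big_nat big1 => [|a /andP[_ a1]]; last by rewrite leqNgt a1.
rewrite add0r [X in _ + X]big_nat [X in _ + X]big1 => [|a /andP[a1 _]]; last first.
  by rewrite [(a < _)%N]ltnNge a1 andbF.
rewrite addr0 big_nat (eq_bigr (fun=> 1)) => [|a ->//].
by rewrite -big_nat sumr_const_nat addnC addnK.
Qed.

(** The cube of radius d around x0 contains a product of three index intervals of
length q, where q is the integer part of d / mesh, hence q^3 nodes; and
q mesh >= d / 2 as soon as 2 mesh <= d. *)
Lemma riemann_lower n f x0 (c d : R) : 0 <= c -> (forall x, 0 <= f x) ->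
  `|x0| + d <= 3 -> 2 * mesh n <= d -> (forall x, `|x - x0| <= d -> c <= f x) ->
  c * (d / 2) ^+ 3 <= riemann n f.
Proof.
move=> c0 f0 x0d nd fc.
have h0 := mesh_gt0 n.
pose N : R := n.+1%:R; have N0 : 0 < N by rewrite ltr0n.
have hN : mesh n * N = 1 by rewrite /mesh mulVf// gt_eqF.
have d0 : 0 < d by apply: lt_le_trans nd; rewrite mulr_gt0.
pose q := Num.truncn (d * N).
have /andP[q1 q2] : q%:R <= d * N < q.+1%:R by rewrite truncn_itv// mulr_ge0// ltW.
(* The first index whose node lies strictly beyond x0 along axis i; adding 4 moves the
   cube to nonnegative coordinates. *)
pose s i := (Num.truncn ((x0 0 i + 4) * N)).+1.
have xi i : `|x0 0 i| + d <= 3 by apply: le_trans x0d; rewrite lerD2r coord_le.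
have xi' i : -3 + d <= x0 0 i /\ x0 0 i + d <= 3.
  have := xi i; have := ler_norm (x0 0 i); have := ler_norm (- x0 0 i).
  by rewrite normrN => *; split; lra.
have s1 i : (x0 0 i + 4) * N <= (s i)%:R <= (x0 0 i + 4) * N + 1.
  have /andP[a1 a2] : (Num.truncn ((x0 0 i + 4) * N))%:R <= (x0 0 i + 4) * N < (s i)%:R.
    by apply: truncn_itv; apply: mulr_ge0; [have [] := xi' i; lra|exact: ltW].
  by rewrite (ltW a2) /s -natr1 lerD2r a1.
have sM i : (s i + q <= (cells n).+1)%N.
  rewrite -(ler_nat R) natrD.
  have -> : (cells n).+1%:R = 8 * N :> R.
    by rewrite -(cellsE n) -mulrA hN mulr1.
  have /andP[_ s2] := s1 i; have [_ x2] := xi' i.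
  have : (x0 0 i + d) * N <= 3 * N by rewrite ler_pM2r.
  have : 1 <= N by rewrite ler1n.
  lra.
have hit (a : {ffun 'I_3 -> 'I_(cells n).+1}) :
    c * \prod_i (s i <= a i < s i + q)%N%:R <= f (node a).
  case: (boolP [forall i, (s i <= a i < s i + q)%N]) => [/forallP sa|/forallPn[i sa]].
    rewrite big1 => [|i _]; last by rewrite sa.
    rewrite mulr1; apply: fc.
    rewrite /Num.Def.normr/= mx_normrE bigmax_le ?ltW// => -[i0 i] _ /=.
    rewrite (ord1 i0) !mxE ger0_norm.
      have /andP[_ as2] := sa i; have /andP[_ s2] := s1 i.
      have : (a i).+1%:R <= (s i + q)%:R :> R by rewrite ler_nat.
      rewrite natrD -natr1 => as3.
      have : (a i)%:R <= (x0 0 i + 4 + d) * N by lra.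
      by rewrite -(ler_pM2r h0) -[_ * N * _]mulrA [N * _]mulrC hN => h; lra.
    have /andP[as1 _] := sa i; have /andP[s2 _] := s1 i.
    have : (s i)%:R <= (a i)%:R :> R by rewrite ler_nat.
    move=> as3; have : (x0 0 i + 4) * N <= (a i)%:R by lra.
    by rewrite -(ler_pM2r h0) -[_ * N * _]mulrA [N * _]mulrC hN => h; lra.
  by rewrite (bigD1 i)//= (negbTE sa) mul0r mulr0 f0.
apply: (@le_trans _ _ (mesh n ^+ 3 * (c * q%:R ^+ 3))).
  have -> : mesh n ^+ 3 * (c * q%:R ^+ 3) = c * (mesh n * q%:R) ^+ 3.
    by rewrite mulrCA exprMn.
  apply: ler_wpM2l => //.
  apply: lerXn2r; rewrite ?nnegrE; [lra|by rewrite mulr_ge0 ?ler0n ?ltW|].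
  rewrite -natr1 in q2; have : d * N * mesh n < (q%:R + 1) * mesh n by rewrite ltr_pM2r.
  rewrite -mulrA [N * _]mulrC hN; lra.
apply: ler_wpM2l; first by rewrite exprn_ge0// ltW.
have -> : c * q%:R ^+ 3 = \sum_(a : {ffun 'I_3 -> 'I_(cells n).+1})
     c * \prod_i (s i <= a i < s i + q)%N%:R.
  rewrite -mulr_sumr -(bigA_distr_bigA (fun i (a : 'I_(cells n).+1) => (s i <= a < s i + q)%N%:R)).
  under eq_bigr do rewrite card_interval//.
  by rewrite prodr_const card_ord.
by apply: ler_sum => a _; exact: hit.
Qed.

Lemma I_lower f x0 (c d : R) : bdd f -> 0 < d -> 0 <= c -> (forall x, 0 <= f x) ->
  `|x0| + d <= 3 -> (forall x, `|x - x0| <= d -> c <= f x) ->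
  c * (d / 2) ^+ 3 <= I f.
Proof.
move=> bf d0 c0 f0 xd fc; apply: I_near_ge => //; near=> n.
apply: (@riemann_lower _ _ x0) => //.
rewrite mulrC -ler_pdivlMr//; near: n; apply: mesh_small.
by rewrite divr_gt0.
Unshelve. all: by end_near. Qed.

End Integral.

#[global] Opaque riemann I.

(** * Mixed derivatives and mean value inequalities *)

Lemma Ck_laplacian {R : realType} k (f : 'rV[R]_3 -> R) : Ck k.+2 f -> Ck k (lap f).
Proof. by move=> Cf; apply: Ck_sum => i _; do 2 apply: Ck_partial. Qed.

Lemma CkX {R : realType} k n (f : 'rV[R]_3 -> R) : Ck k f -> Ck k (fun x => f x ^+ n).
Proof.
move=> Cf; elim: n => [|n ih]; first exact: Ck_cst.
by under eq_fun do rewrite exprS; exact: CkM.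
Qed.

Ltac ck_leaf :=
  match goal with
  | H : Ck ?l ?f |- Ck ?k ?f => exact: (@Ck_le _ k l f isT H)
  | H : forall i, Ck ?l (?f i) |- Ck ?k (?f ?i) => exact: (@Ck_le _ k l _ isT (H i))
  | H : forall i j, Ck ?l (?f i j) |- Ck ?k (?f ?i ?j) => exact: (@Ck_le _ k l _ isT (H i j))
  end.

(** Regularity of an expression, by structural descent to atoms whose regularity
is known from the context at an order at least as large. *)
Ltac ck :=
  lazymatch goal with
  | |- Ck _ (fun _ => ?c) => exact: Ck_cst
  | |- Ck _ (fun x => @?f x + - @?g x) => apply: (@CkB _ _ f g); ck
  | |- Ck _ (fun x => @?f x + @?g x) => apply: (@CkD _ _ f g); ck
  | |- Ck _ (fun x => @?f x * @?g x) => apply: (@CkM _ _ f g); ck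
  | |- Ck _ (fun x => - @?f x) => apply: (@CkN _ _ f); ck
  | |- Ck _ (fun x => @?f x ^+ ?n) => apply: (@CkX _ _ n f); ck
  | |- Ck _ (fun x => bigop _ _ _) => apply: Ck_sum => ? _ /=; ck
  | |- Ck ?k (fun x => pd ?i ?f x) => apply: (@Ck_partial _ k f _ i); ck
  | |- Ck ?k (fun x => lap ?f x) => apply: (@Ck_laplacian _ k f); ck
  | |- Ck ?k (pd ?i ?f) => apply: (@Ck_partial _ k f _ i); ck
  | |- Ck ?k (lap ?f) => apply: (@Ck_laplacian _ k f); ck
  | |- Ck _ (fun x : _ => x 0 ?i) => exact: Ck_coord
  | |- Ck ?k (fun x => ?f x) => change (Ck k f); ck_leaf
  | |- _ => ck_leaf
  end.

Section Symmetry.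
Context {R : realType}.
Local Notation E := 'rV[R]_3.
Implicit Types (f g : E -> R) (x y : E) (i j : 'I_3) (k : nat).

(** The second difference over a small rectangle is symmetric in the two axes and
is t^2 times a mixed derivative at a nearby point. *)
Lemma double_difference f x i j (t : R) : Ck 2 f -> exists s s' : R,
  [/\ `|s| <= `|t|, `|s'| <= `|t| &
  f (t *: axis j + (t *: axis i + x)) - f (t *: axis i + x) - (f (t *: axis j + x) - f x) =
  t ^+ 2 * pd j (pd i f) (s' *: axis j + (s *: axis i + x))].
Proof.
move=> Cf; pose g y := f (1 *: y + t *: axis j) - f y.
have Cg : Ck 1 g by apply: CkB; [exact/Ck_dilate/CkW|exact: CkW].
have [s [s1 _]] := partial_MVT x t (@Ck_derivable _ _ _ Cg i).
have -> : pd i g (s *: axis i + x) =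
    pd i f (t *: axis j + (s *: axis i + x)) - pd i f (s *: axis i + x).
  rewrite /g (@partialD _ 0)//; [|exact/Ck_dilate/CkW|exact/CkN/CkW].
  rewrite (@partialN _ 0) ?(@partial_dilate _ 0) ?mul1r ?scale1r//; try exact: CkW.
  by rewrite [t *: _ + _]addrC.
rewrite /g !scale1r ![_ + t *: axis j]addrC => ->.
have [s' [s'1 _] ->] := partial_MVT (s *: axis i + x) t (@Ck_derivable _ _ _ (Ck_partial Cf i) j).
by exists s, s'; split=> //; rewrite mulrA expr2.
Qed.

Lemma axis_norm i : `|axis i : E| = 1.
Proof.
apply/eqP; rewrite eq_le; apply/andP; split.
  rewrite /Num.Def.normr/= mx_normrE bigmax_le// => -[i0 j] _ /=.
  by rewrite (ord1 i0) axisE; case: (i == j); rewrite ?normr1 ?normr0.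
by apply: le_trans (coord_le _ i); rewrite axisE eqxx normr1.
Qed.

Lemma dist_split (a b c e : R) : `|a - c| <= e / 2 -> `|b - c| <= e / 2 -> `|b - a| <= e.
Proof.
move=> ac bc; have -> : b - a = (b - c) - (a - c) by ring.
apply: le_trans (ler_normB _ _) _; lra.
Qed.

(** Schwarz's theorem. By [double_difference], both mixed derivatives take a common
value, the second difference divided by t^2, at points within 2 t of x. *)
Lemma partialC f x i j : Ck 2 f -> pd i (pd j f) x = pd j (pd i f) x.
Proof.
move=> Cf; apply/eqP; rewrite -subr_eq0 -normr_le0; apply/ler_addgt0Pr => e e0; rewrite add0r.
have e2 : 0 < e / 2 by rewrite divr_gt0.
have /(_ x)/cvgrPdist_le/(_ _ e2) := Ck_continuous (Ck_partial (Ck_partial Cf i) j).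
have /(_ x)/cvgrPdist_le/(_ _ e2) := Ck_continuous (Ck_partial (Ck_partial Cf j) i).
move=> /nbhs_ballP[r /= r0]; rewrite -ball_normE => Br.
move=> /nbhs_ballP[r' /= r'0]; rewrite -ball_normE => Br'.
pose t := Num.min r r' / 3.
have t0 : 0 < t by rewrite divr_gt0// lt_min r0.
have tr : 2 * t < r /\ 2 * t < r'.
  have : 0 < Num.min r r' by rewrite lt_min r0.
  have : Num.min r r' <= r by rewrite ge_min lexx.
  have : Num.min r r' <= r' by rewrite ge_min lexx orbT.
  by rewrite /t => *; split; lra.
have near_x s s' a b : `|s| <= `|t| -> `|s'| <= `|t| ->
    `|x - (s' *: axis a + (s *: axis b + x))| <= 2 * t.
  rewrite (gtr0_norm t0) => s1 s2.
  rewrite addrA opprD addrCA subrr addr0 normrN (le_trans (ler_normD _ _))// !normrZ !axis_norm; lra.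
have [s [s' [s1 s2 e1]]] := double_difference x i j t Cf.
have [r1 [r2 [r1t r2t e1']]] := double_difference x j i t Cf.
have : pd j (pd i f) (s' *: axis j + (s *: axis i + x)) =
       pd i (pd j f) (r2 *: axis i + (r1 *: axis j + x)).
  have t2 : t ^+ 2 != 0 by rewrite expf_eq0 gt_eqF.
  apply: (mulfI t2); apply: etrans (etrans (esym e1) _) e1'.
  rewrite [t *: axis j + (t *: axis i + x)]addrCA.
  ring.
move=> AB; have := Br' _ (le_lt_trans (near_x _ _ j i s1 s2) tr.2).
rewrite /= AB => h1.
exact: dist_split h1 (Br _ (le_lt_trans (near_x _ _ i j r1t r2t) tr.1)).
Qed.

Lemma norm_leP x (r : R) : 0 <= r -> (forall i, `|x 0 i| <= r) -> `|x| <= r.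
Proof.
move=> r0 xr; rewrite /Num.Def.normr/= mx_normrE bigmax_le// => -[i0 i] _ /=.
by rewrite (ord1 i0).
Qed.

Lemma norm_coord x : exists i, `|x| = `|x 0 i|.
Proof.
have [x0|x0] := eqVneq `|x| 0.
  by exists 0; rewrite x0; apply/esym/eqP; rewrite -normr_le0 normr_id -x0 coord_le.
case: (pselect (exists i, `|x| <= `|x 0 i|)) => [[i xi]|nx].
  by exists i; apply/eqP; rewrite eq_le xi coord_le.
exfalso; have : `|x| < `|x|; last by rewrite ltxx.
rewrite {1}/Num.Def.normr/= mx_normrE; apply: bigmax_lt => [|[i0 i] _ /=].
  by rewrite lt_def x0 normr_ge0.
by rewrite (ord1 i0) ltNge; apply/negP => xi; apply: nx; exists i.
Qed.

Definition upd x i (t : R) : E := (t - x 0 i) *: axis i + x.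

Lemma updE x i t j : upd x i t 0 j = if j == i then t else x 0 j.
Proof.
rewrite !mxE eqxx /=; case: eqVneq => [->|_]; first by rewrite mulr1 subrK.
by rewrite mulr0 add0r.
Qed.

Lemma axis_step g x i (t A : R) : (forall y, derivable g y (axis i)) ->
  (forall s, Num.min (x 0 i) t <= s <= Num.max (x 0 i) t -> `|pd i g (upd x i s)| <= A) ->
  `|g (upd x i t) - g x| <= `|t - x 0 i| * A.
Proof.
move=> dg gA; have [s [s1 s2]] := partial_MVT x (t - x 0 i) dg.
rewrite /upd => ->; rewrite normrM; apply: ler_wpM2l => //.
have := gA (s + x 0 i); rewrite /upd addrK; apply.
move: s1 s2; have [tx|tx|tx] := ltgtP t (x 0 i).
- rewrite [`|t - _|]ltr0_norm ?subr_lt0// => s1 s2.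
  have : s <= 0.
    rewrite leNgt; apply/negP => s0; move: s2; rewrite pmulr_rge0//; lra.
  move: s1; rewrite ler_norml => /andP[s1 _] s0; apply/andP; split; lra.
- rewrite [`|t - _|]gtr0_norm ?subr_gt0// => s1 s2.
  have : 0 <= s by move: s2; rewrite pmulr_lge0// subr_gt0.
  move: s1; rewrite ler_norml => /andP[_ s1] s0; apply/andP; split; lra.
- rewrite tx subrr normr0 normr_le0 => /eqP -> _; rewrite add0r lexx//.
Qed.

Lemma minmax_norm (a b s r : R) : `|a| <= r -> `|b| <= r ->
  Num.min a b <= s <= Num.max a b -> `|s| <= r.
Proof.
rewrite !ler_norml => /andP[a1 a2] /andP[b1 b2] /andP[s1 s2]; apply/andP; split.
  by apply: le_trans s1; rewrite le_min a1.
by apply: (le_trans s2); rewrite ge_max a2.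
Qed.

Lemma upd3 x y : upd (upd (upd x 0 (y 0 0)) 1 (y 0 1)) 2 (y 0 2) = y.
Proof.
apply/rowP => j; rewrite !updE.
by case: j => -[|[|[|//]]] j3 /=; congr (y 0 _); exact: val_inj.
Qed.

Lemma upd_norm x i t (r : R) : `|x| <= r -> `|t| <= r -> `|upd x i t| <= r.
Proof.
move=> xr tr; apply: norm_leP => [|j]; first exact: le_trans xr.
by rewrite updE; case: ifP => // _; exact: le_trans (coord_le _ _) xr.
Qed.

(** Moving from x to y one coordinate at a time stays inside the cube, so that
bounds on axis derivatives suffice. *)
Lemma cube_lipschitz g (r A : R) x y : (forall i y, derivable g y (axis i)) -> 0 <= A ->
  (forall i (z : E), `|z| <= r -> `|pd i g z| <= A) -> `|x| <= r -> `|y| <= r ->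
  `|g y - g x| <= 3 * A * `|y - x|.
Proof.
move=> dg A0 gA xr yr.
have yi i : `|y 0 i| <= r by exact: le_trans (coord_le _ _) yr.
have step (z : E) i : `|z| <= r -> z 0 i = x 0 i -> `|g (upd z i (y 0 i)) - g z| <= A * `|y - x|.
  move=> zr zx; rewrite mulrC.
  apply: le_trans (axis_step (A := A) (dg _) _) _.
    move=> s hs; apply: gA; apply: upd_norm => //; apply: minmax_norm hs => //.
    exact: le_trans (coord_le _ _) zr.
  apply: ler_wpM2r => //; rewrite zx; have := coord_le (y - x) i; rewrite !mxE; exact.
rewrite -{1}(upd3 x y).
set z1 := upd x 0 _; set z2 := upd z1 1 _; set z3 := upd z2 2 _.
have z1r : `|z1| <= r by exact: upd_norm.
have z2r : `|z2| <= r by exact: upd_norm.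
have h1 : `|g z1 - g x| <= A * `|y - x| by apply: step.
have h2 : `|g z2 - g z1| <= A * `|y - x| by apply: step => //; rewrite updE.
have h3 : `|g z3 - g z2| <= A * `|y - x| by apply: step => //; rewrite !updE.
have -> : g z3 - g x = (g z3 - g z2) + (g z2 - g z1) + (g z1 - g x) by ring.
apply: le_trans (ler_normD _ _) _; apply: le_trans (lerD (ler_normD _ _) (lexx _)) _.
lra.
Qed.

Definition corner : E := const_mx (3 / 2).

(** In the shell one must avoid the inner cube while moving: the coordinate i that
is already large is changed last, after the two others have been set to 3 / 2.
Each of the three moves has length at most 4. *)
Lemma shell_path_step g y (A : R) (i j l : 'I_3) : (forall i y, derivable g y (axis i)) -> 0 <= A ->
  (forall i (z : E), 1 / 2 <= `|z| <= 2 -> `|pd i g z| <= A) ->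
  `|y| <= 2 -> 1 / 2 <= `|y 0 i| -> i != j -> i != l ->
  upd (upd (upd y j (3 / 2)) l (3 / 2)) i (3 / 2) = corner -> j != l ->
  `|g y - g corner| <= 12 * A.
Proof.
move=> dg A0 gA y2 yi ij il <- jl.
have c2 : `|3 / 2 : R| <= 2 by rewrite ger0_norm; lra.
have step (z : E) (k : 'I_3) : `|z| <= 2 -> (exists2 m, m != k & 1 / 2 <= `|z 0 m|) ->
    `|g (upd z k (3 / 2)) - g z| <= 4 * A.
  move=> z2 [m mk zm].
  have zk : `|z 0 k| <= 2 by exact: le_trans (coord_le _ _) z2.
  apply: le_trans (axis_step (A := A) (dg _) _) _.
    move=> s hs; apply: gA; apply/andP; split.
      by apply: le_trans (coord_le _ m); rewrite updE (negbTE mk).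
    by apply: upd_norm => //; apply: minmax_norm hs.
  apply: ler_wpM2r => //; apply: le_trans (ler_normB _ _) _.
  rewrite ger0_norm; lra.
set z1 := upd y j _; set z2 := upd z1 l _; set z3 := upd z2 i _.
have z1r : `|z1| <= 2 by exact: upd_norm.
have z2r : `|z2| <= 2 by exact: upd_norm.
have h1 : `|g z1 - g y| <= 4 * A by apply: step => //; exists i.
have h2 : `|g z2 - g z1| <= 4 * A.
  by apply: step => //; exists i => //; rewrite updE (negbTE ij).
have h3 : `|g z3 - g z2| <= 4 * A.
  apply: step => //; exists l; rewrite 1?eq_sym// updE eqxx ger0_norm; lra.
have -> : g y - g z3 = - ((g z3 - g z2) + (g z2 - g z1) + (g z1 - g y)) by ring.
rewrite normrN; apply: le_trans (ler_normD _ _) _.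
apply: le_trans (lerD (ler_normD _ _) (lexx _)) _; lra.
Qed.

(** The shell is connected by paths along the axes of uniformly bounded length, so
a gradient bound on the shell alone bounds the oscillation there. *)
Lemma shell_path g y (A : R) : (forall i y, derivable g y (axis i)) -> 0 <= A ->
  (forall i (z : E), 1 / 2 <= `|z| <= 2 -> `|pd i g z| <= A) ->
  1 / 2 <= `|y| <= 2 -> `|g y - g corner| <= 12 * A.
Proof.
move=> dg A0 gA /andP[y1 y2]; have [i yi] := norm_coord y.
rewrite yi in y1.
have corner_upd a b c : a != b -> a != c -> b != c ->
    upd (upd (upd y a (3 / 2)) b (3 / 2)) c (3 / 2) = corner.
  move=> ab ac bc; apply/rowP => j; rewrite !updE mxE.
  case: eqP => // jc; case: eqP => // jb; case: eqP => // ja; exfalso.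
  move: ab ac bc jc jb ja.
  by case: a => -[|[|[|//]]] ?; case: b => -[|[|[|//]]] ?; case: c => -[|[|[|//]]] ?;
     case: j => -[|[|[|//]]] ? // *;
    match goal with H : ?a <> ?b |- _ => by case: H; apply: val_inj end.
have : (i = 0 \/ i = 1) \/ i = 2.
  by case: i {yi y1} => -[|[|[|//]]] ?; [left; left|left; right|right]; apply: val_inj.
case=> [[i0|i0]|i0]; rewrite i0 in y1.
- by apply: (@shell_path_step _ _ _ 0 1 2) => //; rewrite ?corner_upd.
- by apply: (@shell_path_step _ _ _ 1 0 2) => //; rewrite ?corner_upd.
- by apply: (@shell_path_step _ _ _ 2 0 1) => //; rewrite ?corner_upd.
Qed.

End Symmetry.

(** * Cutoffs and the truncated Newton potential *)

Section Kernel.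
Context {R : realType}.
Local Notation E := 'rV[R]_3.
Implicit Types (f g : E -> R) (x y : E) (i j : 'I_3) (k : nat).

(** The square of the Euclidean norm is smooth, unlike the sup norm. *)
Definition sqnorm x : R := \sum_i x 0 i ^+ 2.

Lemma sqnorm_ge0 x : 0 <= sqnorm x.
Proof. by apply: sumr_ge0 => i _; exact: sqr_ge0. Qed.

Lemma sqnorm_le x : sqnorm x <= 3 * `|x| ^+ 2.
Proof.
apply: (@le_trans _ _ (\sum_(i < 3) `|x| ^+ 2)).
  apply: ler_sum => i _; rewrite -real_normK ?num_real//.
  by apply: lerXn2r; rewrite ?nnegrE// coord_le.
by rewrite sumr_const card_ord mulr_natl.
Qed.

Lemma norm_le_sqnorm x : `|x| ^+ 2 <= sqnorm x.
Proof.
have [i ->] := norm_coord x; rewrite real_normK ?num_real//.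
by rewrite /sqnorm (bigD1 i)//= lerDl; apply: sumr_ge0 => j _; exact: sqr_ge0.
Qed.

Lemma Ck_sqnorm k : Ck k sqnorm.
Proof. by apply: Ck_sum => i _; apply: CkM; exact: Ck_coord. Qed.

Lemma partial_sqnorm i x : pd i sqnorm x = 2 * x 0 i.
Proof.
have C1 j : Ck 1 (fun y : E => y 0 j) by exact: Ck_coord.
rewrite (@partial_sum _ 0) => [|j _]; last by apply: CkM; exact: C1.
rewrite (bigD1 i)//= big1 => [|j ji].
  rewrite addr0 (@partialM _ 0 (fun y : E => y 0 i) (fun y => y 0 i))//.
  by rewrite !partial_coord eqxx mulr1n; ring.
rewrite (@partialM _ 0 (fun y : E => y 0 j) (fun y => y 0 j))//.
by rewrite !partial_coord eq_sym (negbTE ji) mulr0n; ring.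
Qed.

Lemma partial_open_cst (A : set E) f (c : R) i x : open A -> A x ->
  (forall y, A y -> f y = c) -> pd i f x = 0.
Proof.
move=> oA Ax fc; rewrite -(partial_cst i c x).
apply: near_eq_derive; near=> y; apply: fc; near: y.
exact: (open_nbhs_nbhs (conj oA Ax)).
Unshelve. all: by end_near. Qed.

Lemma open_sqnorm_lt (a : R) : open [set x : E | sqnorm x < a].
Proof.
apply: (@open_comp _ _ sqnorm [set t | t < a]); last exact: open_lt.
by move=> y _; exact: (Ck_continuous (Ck_sqnorm 0)).
Qed.

(** The inner truncated power is at least 1 on the smaller ball, which makes the
argument of the outer one nonpositive there; outside the larger ball it is the
inner one that vanishes. *)
Lemma cutoff_exists k (a b : R) : 0 <= a -> a < b -> exists chi : E -> R,
  [/\ Ck k chi, forall x, 0 <= chi x <= 1, forall x, sqnorm x <= a -> chi x = 1 &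
      forall x, b <= sqnorm x -> chi x = 0].
Proof.
move=> a0 ab; have ba : 0 < b - a by rewrite subr_gt0.
exists (fun x => 1 - ramp k (1 - ramp k ((b - a)^-1 * (b - sqnorm x)))); split.
- apply: CkB; first exact: Ck_cst.
  apply: Ck_ramp; apply: CkB; first exact: Ck_cst.
  apply: Ck_ramp; apply: CkZ; apply: CkB; [exact: Ck_cst|exact: Ck_sqnorm].
- move=> x; rewrite subr_ge0 lerBlDr lerDl ramp_ge0 andbT.
  by apply: ramp_le1; rewrite lerBlDr lerDl ramp_ge0.
- move=> x xa; rewrite [ramp k (1 - _)]ramp_eq0 ?subr0// subr_le0.
  by apply: ramp_ge1; rewrite mulrC ler_pdivlMr// mul1r; lra.
- move=> x bx; rewrite [ramp k (_ * _)]ramp_eq0.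
    by rewrite subr0 /ramp max_l// expr1n subrr.
  by rewrite pmulr_rle0 ?invr_gt0// subr_le0.
Qed.

(** The Newton potential regularized at scale e, without its factor 1 / (4 pi): its
Laplacian is minus an approximate identity of width e, of mass 4 pi
([laplacian_newton]). *)
Definition newton (e : R) x : R := (Num.sqrt (sqnorm x + e ^+ 2))^-1.

Section Newton.
Variable e : R.
Hypothesis e0 : 0 < e.

Let s0 x : 0 < sqnorm x + e ^+ 2.
Proof. by rewrite ltr_wpDl ?sqnorm_ge0// exprn_gt0. Qed.

Lemma newton_gt0 x : 0 < newton e x.
Proof. by rewrite invr_gt0 sqrtr_gt0 s0. Qed.

Lemma newtonE x : newton e x ^+ 2 * (sqnorm x + e ^+ 2) = 1.
Proof. by rewrite exprVn sqr_sqrtr ?ltW// mulVf// gt_eqF. Qed.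

Lemma is_derive_newton i x : is_derive x (axis i) (newton e) (- (x 0 i * newton e x ^+ 3)).
Proof.
have ds : is_derive x (axis i) (fun y => sqnorm y + e ^+ 2) (2 * x 0 i + 0).
  apply: (@is_deriveD _ _ _ sqnorm (cst (e ^+ 2))).
  by rewrite -partial_sqnorm; exact: derive_partial (Ck_sqnorm 1).
have dh : is_derive (sqnorm x + e ^+ 2) 1 (fun t => (Num.sqrt t)^-1)
    (- (Num.sqrt (sqnorm x + e ^+ 2)) ^- 2 *: (2 * Num.sqrt (sqnorm x + e ^+ 2))^-1).
  have dq := is_derive1_sqrt (s0 x).
  case: dq => dq dqE; have q0 : Num.sqrt (sqnorm x + e ^+ 2) != 0 by rewrite gt_eqF// sqrtr_gt0.
  by apply: DeriveDef; [exact: derivableV|rewrite deriveV// dqE].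
apply: (is_derive_eq (is_derive_comp dh ds)).
rewrite addr0 /newton; set q := Num.sqrt _.
have q0 : 0 < q by rewrite sqrtr_gt0.
rewrite -![_ *: _]/(_ * _); field; rewrite gt_eqF//.
Qed.

Lemma partial_newton i x : pd i (newton e) x = - (x 0 i * newton e x ^+ 3).
Proof. exact/partialE/is_derive_newton. Qed.

Lemma continuous_newton : continuous (newton e).
Proof.
move=> x; apply: (@continuousV _ _ (fun x => Num.sqrt (sqnorm x + e ^+ 2))).
  by rewrite gt_eqF// sqrtr_gt0.
apply: (@continuous_comp _ _ _ (fun x => sqnorm x + e ^+ 2) Num.sqrt).
  apply: continuousD; [exact: (Ck_continuous (Ck_sqnorm 0))|exact: cst_continuous].
exact: sqrt_continuous.
Qed.

Lemma Ck_newton k : Ck k (newton e).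
Proof.
elim: k => [|k ih]; first exact/Ck0/continuous_newton.
apply: CkS => [|i x|i]; first exact: continuous_newton.
  by have [] := is_derive_newton i x.
rewrite (_ : pd i _ = fun x => - (x 0 i * (newton e x * (newton e x * newton e x)))).
  apply/CkN/CkM; first exact: Ck_coord.
  by do ?apply: CkM.
by apply/funext => x; rewrite partial_newton !exprS expr0 mulr1.
Qed.

Lemma partialX k f n i x : Ck k.+1 f ->
  pd i (fun x => f x ^+ n) x = n%:R * f x ^+ n.-1 * pd i f x.
Proof.
move=> Cf; elim: n => [|n ih].
  by rewrite mul0r mul0r; under eq_fun do rewrite expr0; exact: partial_cst.
under eq_fun do rewrite exprS.
rewrite (partialM _ _ Cf (CkX n Cf)) ih.
case: n {ih} => [|n]; first by rewrite /= !expr0; ring.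
by rewrite /= -!natr1 !exprS; ring.
Qed.

Lemma partial_newtonX n i x :
  pd i (fun x => newton e x ^+ n) x = - (n%:R * x 0 i * newton e x ^+ n.+2).
Proof.
rewrite (partialX _ _ _ (Ck_newton 1)) partial_newton.
case: n => [|n]; first by rewrite !mul0r oppr0.
rewrite /= !exprS; ring.
Qed.

Lemma partial2_newton i x : pd i (pd i (newton e)) x =
  - newton e x ^+ 3 + 3 * x 0 i ^+ 2 * newton e x ^+ 5.
Proof.
have -> : pd i (newton e) = fun y => - (y 0 i * newton e y ^+ 3).
  by apply/funext => y; exact: partial_newton.
have C1 : Ck 1 (fun y : E => y 0 i) by exact: Ck_coord.
have C2 : Ck 1 (fun y => newton e y ^+ 3) by apply: CkX; exact: Ck_newton.
rewrite (@partialN _ 0 (fun y => y 0 i * newton e y ^+ 3)); last exact: CkM.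
rewrite (partialM _ _ C1 C2) partial_coord eqxx mulr1n partial_newtonX; ring.
Qed.

Lemma laplacian_newton x : lap (newton e) x = - (3 * e ^+ 2 * newton e x ^+ 5).
Proof.
rewrite /lap; under eq_bigr do rewrite partial2_newton.
rewrite big_split /= sumr_const card_ord -mulr_suml -mulr_sumr -/(sqnorm x).
have := newtonE x; set N := newton e x; set s := sqnorm x => Ns.
have -> : 3 * s * N ^+ 5 = 3 * N ^+ 3 * (N ^+ 2 * (s + e ^+ 2)) - 3 * e ^+ 2 * N ^+ 5 by ring.
by rewrite Ns; ring.
Qed.

Lemma newton_le x (t : R) : 0 < t -> t ^+ 2 <= sqnorm x -> newton e x <= t^-1.
Proof.
move=> t0 tx; rewrite /newton lef_pV2 ?posrE ?sqrtr_gt0//.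
rewrite -(ger0_norm (ltW t0)) -sqrtr_sqr ler_wsqrtr//.
by rewrite (le_trans tx)// lerDl ltW// exprn_gt0.
Qed.

Lemma newton_ge x : sqnorm x <= 3 * e ^+ 2 -> (2 * e)^-1 <= newton e x.
Proof.
move=> xe; rewrite /newton lef_pV2 ?posrE ?sqrtr_gt0 ?mulr_gt0//.
have -> : 2 * e = Num.sqrt ((2 * e) ^+ 2) by rewrite sqrtr_sqr gtr0_norm// mulr_gt0.
by apply: ler_wsqrtr; rewrite exprMn; lra.
Qed.

End Newton.

Lemma laplacianM k f g x : Ck k.+2 f -> Ck k.+2 g ->
  lap (fun x => f x * g x) x = lap f x * g x +
   2 * (\sum_i pd i f x * pd i g x) + f x * lap g x.
Proof.
move=> Cf Cg; rewrite /lap mulr_suml !mulr_sumr -!big_split /=.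
apply: eq_bigr => i _.
have -> : pd i (fun x => f x * g x) = fun x => pd i f x * g x + f x * pd i g x.
  by apply/funext => y; exact: (partialM _ _ Cf Cg).
have C1 := Ck_partial Cf i; have C2 := Ck_partial Cg i.
rewrite (@partialD _ k (fun x => pd i f x * g x) (fun x => f x * pd i g x)).
- have e1 := partialM i x C1 (CkW Cg); have e2 := partialM i x (CkW Cf) C2.
  rewrite e1 e2.
  move: (pd i (pd i f) x) (pd i (pd i g) x) => a b.
  by move: (pd i f x) (pd i g x) => c d; ring.
- by apply: CkM => //; exact: CkW.
- by apply: CkM => //; exact: CkW.
Qed.

(** Families indexed by the regularization scale that are bounded together with
their derivatives, uniformly in the scale. *)
Fixpoint tame k (F : R -> E -> R) : Prop :=
  [/\ forall e, 0 < e -> Ck k (F e), exists C : R, forall e x, 0 < e -> `|F e x| <= C &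
  if k is k'.+1 then forall i, tame k' (fun e => pd i (F e)) else True].

Lemma tameW k F : tame k.+1 F -> tame k F.
Proof.
elim: k F => [|k ih] F [CF bF tF]; first by split=> // e /CF /CkW.
by split=> // [e /CF /CkW //|i]; exact/ih/tF.
Qed.

Lemma eq_tame k F G : (forall e, 0 < e -> F e = G e) -> tame k F -> tame k G.
Proof.
elim: k F G => [|k ih] F G FG [CF [C bF] tF].
  by split=> //; [move=> e e0; rewrite -FG//; exact: CF|exists C => e x e0; rewrite -FG//; exact: bF].
split; [by move=> e e0; rewrite -FG//; exact: CF|by exists C => e x e0; rewrite -FG//; exact: bF|].
by move=> i; apply: ih (tF i) => e e0; rewrite FG.
Qed.

Lemma tameD k F G : tame k F -> tame k G -> tame k (fun e x => F e x + G e x).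
Proof.
elim: k F G => [|k ih] F G [CF [C bF] tF] [CG [D bG] tG].
  split=> //; first by move=> e e0; apply: CkD; [exact: CF|exact: CG].
  by exists (C + D) => e x e0; rewrite (le_trans (ler_normD _ _))// lerD ?bF ?bG.
split; first by move=> e e0; apply: CkD; [exact: CF|exact: CG].
  by exists (C + D) => e x e0; rewrite (le_trans (ler_normD _ _))// lerD ?bF ?bG.
move=> i; apply: eq_tame (ih _ _ (tF i) (tG i)) => e e0.
by apply/funext => x; rewrite (partialD _ _ (CF e e0) (CG e e0)).
Qed.

(** Where g does not vanish, the potential is at most 1 / a whatever e is, and
differentiating a power of the potential gives a product of the same kind with a
larger power. *)
Lemma tame_newton (a r : R) k g n : 0 < a -> Ck k g ->
  (forall x, sqnorm x < a ^+ 2 -> g x = 0) -> vanish r g ->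
  tame k (fun e x => g x * newton e x ^+ n).
Proof.
move=> a0; elim: k g n => [|k ih] g n Cg g0 gr.
  - split=> //; first by move=> e e0; apply: CkM => //; exact/CkX/Ck_newton.
    have [C C0 gC] := vanish_bounded (Ck_continuous Cg) gr.
    exists (C * a^-1 ^+ n) => e x e0.
    have [/g0 ->|ax] := ltP (sqnorm x) (a ^+ 2).
      rewrite mul0r normr0; apply: mulr_ge0; first exact: ltW.
      by apply: exprn_ge0; rewrite invr_ge0 ltW.
    rewrite normrM; apply: ler_pM => //; rewrite normrX (ger0_norm (ltW (newton_gt0 e0 x))).
    apply: lerXn2r; [rewrite nnegrE; exact/ltW/newton_gt0|by rewrite nnegrE invr_ge0 ltW|exact: newton_le].
  - have t0 := ih g n (CkW Cg) g0 gr; split.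
    + by move=> e e0; apply: CkM => //; exact/CkX/Ck_newton.
    + by case: k {ih Cg} t0 => [|k] [].
    move=> i; pose h y := - n%:R * y 0 i * g y.
    have dg0 y : sqnorm y < a ^+ 2 -> pd i g y = 0.
      move=> ya; apply: (@partial_open_cst [set y | sqnorm y < a ^+ 2] _ 0) => //.
      exact: open_sqnorm_lt.
    have Ch : Ck k h.
      by apply: CkM; [exact/CkZ/Ck_coord|exact: CkW].
    have h0 y : sqnorm y < a ^+ 2 -> h y = 0 by move/g0; rewrite /h => ->; rewrite mulr0.
    have hr : vanish r h by exact: vanishMr.
    apply: eq_tame (tameD (ih _ n (Ck_partial Cg i) dg0 (vanish_partial i gr)) (ih _ n.+2 Ch h0 hr)).
    move=> e e0; apply/funext => x.
    rewrite (partialM i x Cg (CkX n (Ck_newton e0 k.+1))) partial_newtonX// /h; ring.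
Qed.

(** K is the regularized potential multiplied by a cutoff supported in |x| <= 1/4.
In its Laplacian, delta is the part where the potential is differentiated twice,
an approximate identity, and zeta collects the terms where the cutoff is
differentiated; these live away from the singularity and hence are tame. The
properties of delta are the ones needed for mollification: decay off the
diagonal, and a lower bound at scale e that gives it a definite mass. The radius
1 / 4 is the room between the shells 1/2 <= |x| <= 2 and 1/4 <= |x| <= 9/4. *)
Lemma kernel_exists : exists (K delta zeta : R -> E -> R) (C : R),
  [/\ 0 < C, tame 3 zeta,
   forall e, 0 < e -> [/\ Ck 5 (K e), Ck 3 (delta e), vanish (1 / 4) (K e),
      vanish (1 / 4) (delta e) & vanish (1 / 4) (zeta e)],
   forall e x, 0 < e -> lap (K e) x = zeta e x - delta e x &
   forall e, 0 < e -> [/\ forall x, 0 <= delta e x,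
     forall x t, 0 < t -> t <= `|x| -> delta e x <= C * e ^+ 2 * t^-1 ^+ 5 &
     forall x, e <= 1 / 16 -> `|x| <= e -> (11 * e ^+ 3)^-1 <= delta e x]].
Proof.
have q0 : (0 : R) <= 1 / 8 by lra.
have [||chi [Cchi chi01 chi1 chi0]] := @cutoff_exists 5 ((1 / 8) ^+ 2) ((1 / 4) ^+ 2).
- by rewrite exprn_ge0.
- by apply: ltrXn2r; rewrite ?nnegrE; lra.
have chir : vanish (1 / 4) chi.
  move=> x x4; apply: chi0; apply: le_trans (norm_le_sqnorm x).
  by apply: lerXn2r; rewrite ?nnegrE//; lra.
have d0 i x : sqnorm x < (1 / 8) ^+ 2 -> pd i chi x = 0.
  move=> xa; apply: (@partial_open_cst [set y | sqnorm y < (1 / 8) ^+ 2] _ 1) => // [|y /ltW].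
    exact: open_sqnorm_lt.
  exact: chi1.
pose g3 x := \sum_i - 2 * x 0 i * pd i chi x.
pose zeta e x := g3 x * newton e x ^+ 3 + lap chi x * newton e x ^+ 1.
pose delta e x := 3 * e ^+ 2 * chi x * newton e x ^+ 5.
have Cnu e k : 0 < e -> Ck k (newton e) by move=> e0; exact: Ck_newton.
have Cg3 : Ck 3 g3.
  apply: Ck_sum => i _; apply: CkM; first exact/CkZ/Ck_coord.
  exact/Ck_partial/(Ck_le _ Cchi).
have Cl : Ck 3 (lap chi).
  by apply: Ck_sum => i _; do 2 apply: Ck_partial; exact: (Ck_le _ Cchi).
exists (fun e x => chi x * newton e x), delta, zeta, 3; split; first by rewrite ltr0n.
- apply: tameD.
  + apply: (@tame_newton (1 / 8) (1 / 4) 3 g3); [lra|exact: Cg3| |].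
      by move=> x xa; rewrite /g3 big1// => i _; rewrite d0// mulr0.
    by move=> x xr; rewrite /g3 big1// => i _; rewrite (vanish_partial i chir)// mulr0.
  + apply: (@tame_newton (1 / 8) (1 / 4) 3 (lap chi)); [lra|exact: Cl| |].
      move=> x xa; rewrite /lap big1// => i _.
      apply: (@partial_open_cst [set y | sqnorm y < (1 / 8) ^+ 2] _ 0) => // [|y]; last exact: d0.
      exact: open_sqnorm_lt.
    move=> x xr; rewrite /lap big1// => i _.
    by apply: (vanish_partial i (vanish_partial i chir)).
- move=> e e0; split.
  + by apply: CkM; [exact: Cchi|exact: Cnu].
  + by apply: CkM; [exact/CkZ/(Ck_le _ Cchi)|exact/CkX/Cnu].
  + exact: vanishMl.
  + by apply: vanishMl; exact: vanishMr.
  + move=> x xr; rewrite /zeta /g3 /lap !big1 ?mul0r ?addr0// => i _.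
      by apply: (vanish_partial i (vanish_partial i chir)).
    by rewrite (vanish_partial i chir)// mulr0.
- move=> e x e0; rewrite (laplacianM x Cchi (Cnu e _ e0)) laplacian_newton// /zeta /delta.
  rewrite /g3 mulr_suml expr1.
  under eq_bigr do rewrite partial_newton//.
  rewrite mulr_sumr (eq_bigr (fun i => - 2 * x 0 i * pd i chi x * newton e x ^+ 3)); last first.
    by move=> i _; move: (pd i chi x) => c; ring.
  by move: (\sum_i _) (lap chi x) => S L; ring.
- move=> e e0; split.
  + move=> x; have /andP[c0 _] := chi01 x.
    have nu0 := ltW (newton_gt0 e0 x).
    have e2 : 0 <= 3 * e ^+ 2 by rewrite mulr_ge0// exprn_ge0// ltW.
    by rewrite /delta mulr_ge0// ?exprn_ge0// mulr_ge0.
  + move=> x t t0 tx; rewrite /delta; have /andP[c0 c1] := chi01 x.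
    have tn : newton e x <= t^-1.
      apply: newton_le => //; apply: le_trans (norm_le_sqnorm x).
      by apply: lerXn2r; rewrite ?nnegrE// ltW.
    have e2 : 0 <= 3 * e ^+ 2 by rewrite mulr_ge0// exprn_ge0// ltW.
    have nu0 := ltW (newton_gt0 e0 x).
    apply: ler_pM; [exact: mulr_ge0|exact: exprn_ge0|by rewrite ler_piMr|].
    by apply: lerXn2r => //; rewrite nnegrE invr_ge0 ltW.
  + move=> x e16 xe; have s3 : sqnorm x <= 3 * e ^+ 2.
      apply: le_trans (sqnorm_le x) _; apply: ler_wpM2l => //.
      by apply: lerXn2r; rewrite ?nnegrE// ltW.
    rewrite /delta chi1 ?mulr1; last first.
      apply: (le_trans s3); have : e ^+ 2 <= (1 / 16) ^+ 2.
        by apply: lerXn2r => //; rewrite nnegrE; lra.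
      lra.
    have n2 : ((2 * e)^-1) ^+ 5 <= newton e x ^+ 5.
      have nu0 := ltW (newton_gt0 e0 x).
      apply: lerXn2r => //; last exact: newton_ge.
      by rewrite nnegrE invr_ge0 mulr_ge0// ltW.
    apply: (@le_trans _ _ (3 * e ^+ 2 * (2 * e)^-1 ^+ 5)); last first.
      by apply: ler_wpM2l => //; rewrite mulr_ge0// exprn_ge0// ltW.
    have -> : 3 * e ^+ 2 * (2 * e)^-1 ^+ 5 = 3 / 32 * (e ^+ 3)^-1.
      by field; rewrite gt_eqF.
    rewrite invfM; apply: ler_wpM2r; first by rewrite invr_ge0 exprn_ge0// ltW.
    lra.
Qed.

End Kernel.

(** * Testing the pressure *)

Section Pressure.
Context {R : realType}.
Local Notation E := 'rV[R]_3.
Implicit Types (f g z B : E -> R) (x y : E) (i j : 'I_3) (k : nat).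

Lemma Ck_shift k f y : Ck k f -> Ck k (fun x => f (x - y)).
Proof.
move=> /(@Ck_dilate _ _ _ 1 (- y)); congr Ck.
by apply/funext => x; rewrite scale1r.
Qed.

Lemma partial_shift k f y i x : Ck k.+1 f ->
  pd i (fun x => f (x - y)) x = pd i f (x - y).
Proof.
move=> Cf; have -> : (fun x => f (x - y)) = (fun x => f (1 *: x + - y)).
  by apply/funext => w; rewrite scale1r.
by have := partial_dilate 1 (- y) i x Cf; rewrite scale1r => ->; exact: mul1r.
Qed.

Lemma Ck_reflect k f y : Ck k f -> Ck k (fun x => f (y - x)).
Proof.
move=> /(@Ck_dilate _ _ _ (- 1) y); congr Ck.
by apply/funext => x; rewrite scaleN1r addrC.
Qed.

Lemma partial_reflect k f y i x : Ck k.+1 f ->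
  pd i (fun x => f (y - x)) x = - pd i f (y - x).
Proof.
move=> Cf; have -> : (fun x => f (y - x)) = (fun x => f (-1 *: x + y)).
  by apply/funext => w; rewrite scaleN1r addrC.
have := partial_dilate (-1) y i x Cf; rewrite scaleN1r => ->.
by rewrite [- x + y]addrC; exact: mulN1r.
Qed.

Lemma vanish_shift (r s t : R) f y : vanish r f -> `|y| <= s -> r + s <= t ->
  vanish t (fun x => f (x - y)).
Proof.
move=> f0 ys rst x tx; apply: f0.
have : `|x| <= `|x - y| + `|y| by rewrite -{1}(subrK y x) ler_normD.
lra.
Qed.

Lemma vanish_reflect (r s t : R) f y : vanish r f -> `|y| <= s -> r + s <= t ->
  vanish t (fun x => f (y - x)).
Proof.
move=> f0 ys rst x tx; apply: f0.
have : `|x| <= `|y - x| + `|y| by rewrite distrC -{1}(subrK y x) ler_normD.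
lra.
Qed.

Lemma vanish_le (r s : R) f : r <= s -> vanish r f -> vanish s f.
Proof. by move=> rs f0 x sx; apply: f0; exact: le_lt_trans sx. Qed.

Lemma partial_funC f i j : Ck 2 f -> pd i (pd j f) = pd j (pd i f).
Proof. by move=> Cf; apply/funext => x; exact: partialC. Qed.

(** Integrating by parts twice and commuting derivatives turns the square of each
mixed derivative into a product of two pure ones. This is the L^2 case of the
Calderon-Zygmund inequality. *)
Lemma hessian_sq B : Ck 4 B -> vanish 3 B ->
  \sum_i \sum_j I (fun x => pd i (pd j B) x ^+ 2) = I (fun x => lap B x ^+ 2).
Proof.
move=> CB B0.
have -> : I (fun x => lap B x ^+ 2) =
    I (fun x => \sum_i \sum_j pd i (pd i B) x * pd j (pd j B) x).
  by apply: eq_I => x; rewrite expr2 /lap mulr_suml; apply: eq_bigr => i _; rewrite mulr_sumr.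
rewrite (@I_sum _ _ _ _ _ 2); last by move=> i _; ck.
apply: eq_bigr => i _; rewrite (@I_sum _ _ _ _ _ 2); last by move=> j _; ck.
apply: eq_bigr => j _.
have vB (k l : 'I_3) : vanish 3 (pd k (pd l B)) by apply/vanish_partial/vanish_partial.
transitivity (I (fun x => pd i (pd j B) x * pd i (pd j B) x)).
  by apply: eq_I => x; rewrite expr2.
have C2 (k l : 'I_3) : Ck 2 (pd k (pd l B)) by ck.
have C1 (k : 'I_3) : Ck 2 (pd k B) by ck.
have v1 (g : E -> R) (k l : 'I_3) : vanish 3 (fun x => pd k (pd l B) x * g x).
  by apply: vanishMl; exact: vB.
apply: etrans (@ibp _ _ _ i (C2 i j) (C1 j) (v1 _ _ _)) _.
have -> : pd i (pd i (pd j B)) = pd j (pd i (pd i B)).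
  by rewrite (@partial_funC B i j) ?(@partial_funC (pd i B) i j)//; ck.
exact: esym (@ibp _ _ _ j (C2 i i) (C1 j) (v1 _ _ _)).
Qed.

(** The pressure satisfies grad P = ka lap U + div G. The bounds on G and ka U hold
only in a shell, so all test functions have to be supported there. *)
Section Data.
Variables (P : E -> R) (U : 'I_3 -> E -> R) (G : 'I_3 -> 'I_3 -> E -> R) (ka M : R).
Hypotheses (CP : Ck 4 P) (CU : forall i, Ck 4 (U i)) (CG : forall i j, Ck 4 (G i j)).
Hypothesis divU : forall x, \sum_i pd i (U i) x = 0.
Hypothesis gradP : forall i x,
  pd i P x = ka * lap (U i) x + \sum_j pd j (G i j) x.
Hypothesis M0 : 0 < M.
Hypothesis GM : forall i j x, 1 / 4 <= `|x| <= 9 / 4 -> `|G i j x| <= M.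
Hypothesis UM : forall i x, 1 / 4 <= `|x| <= 9 / 4 -> `|ka * U i x| <= M.

Lemma I_laplacian_ibp f z : Ck 3 f -> Ck 3 z -> vanish 3 z ->
  I (fun x => lap f x * z x) = I (fun x => f x * lap z x).
Proof.
move=> Cf Cz z0.
transitivity (I (fun x => \sum_i z x * pd i (pd i f) x)).
  by apply: eq_I => x; rewrite mulrC mulr_sumr.
transitivity (I (fun x => \sum_i pd i (pd i z) x * f x)); last first.
  by apply: eq_I => x; rewrite mulrC mulr_suml.
have S1 := @I_sum _ _ (index_enum 'I_3) xpredT (fun i x => z x * pd i (pd i f) x) 1.
rewrite S1 {S1}; last by move=> i _; ck.
have S1 := @I_sum _ _ (index_enum 'I_3) xpredT (fun i x => pd i (pd i z) x * f x) 1.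
rewrite S1 {S1}; last by move=> i _; ck.
apply: eq_bigr => i _.
have C1 : Ck 2 z by ck.
have C2 : Ck 2 (pd i f) by ck.
have C3 : Ck 2 (pd i z) by ck.
have C4 : Ck 2 f by ck.
apply: etrans (@ibp _ _ _ i C1 C2 (vanishMl _ z0)) _.
rewrite -[RHS]opprK; congr (- _).
exact: (@ibp _ _ _ i C3 C4 (vanishMl _ (vanish_partial i z0))).
Qed.

Lemma I_grad z i : Ck 3 z -> vanish 3 z ->
  I (fun x => pd i P x * z x) =
  I (fun x => ka * U i x * lap z x) - \sum_j I (fun x => pd j z x * G i j x).
Proof.
move=> Cz z0.
transitivity (I (fun x => ka * (lap (U i) x * z x) + \sum_j z x * pd j (G i j) x)).
  apply: eq_I => x; rewrite gradP mulrDl mulr_suml mulrA; congr (_ + _).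
  by apply: eq_bigr => j _; rewrite mulrC.
have CU3 : Ck 3 (U i) by ck.
have CLU : Ck 1 (lap (U i)) by ck.
have C2 : Ck 2 z by ck.
rewrite ID; first last.
- by apply: (@bdd_Ck _ 1); ck.
- by apply: (@bdd_Ck _ 1); ck.
rewrite IZ; last by apply: (@bdd_Ck _ 1); ck.
rewrite I_laplacian_ibp// -IZ; last first.
  by apply: (@bdd_Ck _ 1); ck.
rewrite (@I_sum _ _ _ _ _ 1); last by move=> j _; ck.
congr (_ + _); first by apply: eq_I => x; rewrite mulrA.
rewrite -sumrN; apply: eq_bigr => j _.
have C3 : Ck 2 (G i j) by ck.
exact: (@ibp _ _ _ j C2 C3 (vanishMl _ z0)).
Qed.

Definition in_shell f := forall x, ~~ (1 / 4 <= `|x| <= 9 / 4) -> f x = 0.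

Lemma in_shell_partial f i : in_shell f -> in_shell (pd i f).
Proof.
move=> f0 x; rewrite negb_and -!ltNge => /orP[x1|x1].
  apply: (@partial_open_cst _ [set y | `|y| < 1 / 4] _ 0) => // [|y /= y1].
    apply: (@open_comp _ _ (fun y : E => `|y|) [set t | t < 1 / 4]); last exact: open_lt.
    by move=> y _; exact: norm_continuous.
  by apply: f0; rewrite negb_and -!ltNge y1.
apply: (@vanish_partial _ _ i (9 / 4)) => // y y1.
by apply: f0; rewrite negb_and -!ltNge y1 orbT.
Qed.

Lemma in_shell_vanish f : in_shell f -> vanish 3 f.
Proof. by move=> f0 x x3; apply: f0; rewrite negb_and -!ltNge; apply/orP; right; lra. Qed.

Lemma I_grad_bound z i (C : R) : Ck 3 z -> in_shell z ->
  (forall j x, `|pd j z x| <= C) -> (forall j x, `|pd j (pd j z) x| <= C) ->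
  `|I (fun x => pd i P x * z x)| <= 8 ^+ 3 * (6 * (M * C)).
Proof.
move=> Cz sz z1 z2; rewrite I_grad//; last exact: in_shell_vanish.
have C0 : 0 <= C := le_trans (normr_ge0 _) (z1 0 0).
have MC : 0 <= M * C by rewrite mulr_ge0// ltW.
apply: le_trans (ler_normB _ _) _.
have -> : 8 ^+ 3 * (6 * (M * C)) = 8 ^+ 3 * (M * (3 * C)) + 3 * (8 ^+ 3 * (C * M)) by ring.
apply: lerD.
  apply: I_bound => x _; rewrite normrM.
  have [xs|xs] := boolP (1 / 4 <= `|x| <= 9 / 4).
    apply: ler_pM => //; first exact: UM.
    apply: le_trans (ler_norm_sum _ _ _) _.
    apply: le_trans (ler_sum _ (fun j _ => z2 j x)) _.
    by rewrite sumr_const card_ord mulr_natl.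
  rewrite [X in _ * `|X|]big1 ?normr0 ?mulr0 => [|j _]; last first.
    by apply: in_shell_partial xs; exact: in_shell_partial.
  by rewrite mulrCA mulr_ge0.
apply: le_trans (ler_norm_sum _ _ _) _.
have -> : 3 * (8 ^+ 3 * (C * M)) = \sum_(j < 3) 8 ^+ 3 * (C * M).
  by rewrite sumr_const card_ord mulr_natl.
apply: ler_sum => j _; apply: I_bound => x _; rewrite normrM.
have [xs|xs] := boolP (1 / 4 <= `|x| <= 9 / 4).
  by apply: ler_pM => //; exact: GM.
by rewrite (in_shell_partial j sz xs) normr0 mul0r mulrC.
Qed.

Lemma laplacian_partial B i x : Ck 3 B ->
  lap (pd i B) x = pd i (lap B) x.
Proof.
move=> CB; rewrite (@partial_sum _ 0); last by move=> j _; ck.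
apply: eq_bigr => j _.
have C1 : Ck 2 B by ck.
have C2 : Ck 2 (pd j B) by ck.
by rewrite (partial_funC j i C1) (partialC x j i C2).
Qed.

(** Testing grad P with grad B, the viscous term drops out because it becomes the
integral of div U against a function. *)
Lemma I_laplacian_hessian B : Ck 5 B -> vanish 3 B ->
  I (fun x => P x * lap B x) =
  \sum_i \sum_j I (fun x => pd j (pd i B) x * G i j x).
Proof.
move=> CB B0.
have CP2 : Ck 2 P by ck.
have CB1 (i : 'I_3) : Ck 3 (pd i B) by ck.
have CL : Ck 3 (lap B) by ck.
have vL : vanish 3 (lap B).
  by move=> x x3; apply: big1 => i _; apply/vanish_partial/vanish_partial: x3.
transitivity (\sum_i I (fun x => P x * pd i (pd i B) x)).
  rewrite -(@I_sum _ _ _ _ _ 2); last by move=> i _; ck.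
  by apply: eq_I => x; rewrite mulr_sumr.
have H1 i : I (fun x => P x * pd i (pd i B) x) =
    \sum_j I (fun x => pd j (pd i B) x * G i j x)
    - I (fun x => ka * U i x * lap (pd i B) x).
  have C1 : Ck 2 (pd i B) by ck.
  apply: etrans (@ibp _ _ _ i CP2 C1 (vanishMr _ (vanish_partial i B0))) _.
  by rewrite (I_grad i (CB1 i) (vanish_partial i B0)) opprB.
under eq_bigr do rewrite H1.
rewrite sumrB [X in _ - X](_ : _ = 0) ?subr0//.
transitivity (\sum_i - I (fun x => ka * (pd i (U i) x * lap B x))).
  apply: eq_bigr => i _.
  have C1 : Ck 2 (fun x => ka * U i x) by ck.
  have C2 : Ck 2 (lap B) by ck.
  have C3 : Ck 1 (U i) by ck.
  transitivity (I (fun x => ka * U i x * pd i (lap B) x)).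
    have CB3 : Ck 3 B by ck.
    by apply: eq_I => x; rewrite (laplacian_partial i x CB3).
  apply: etrans (@ibp _ _ _ i C1 C2 (vanishMr _ vL)) _; congr (- _).
  by apply: eq_I => x; rewrite (partialZ ka i x C3) mulrA.
rewrite sumrN -(@I_sum _ _ _ _ _ 2); last by move=> i _; ck.
rewrite -[RHS]oppr0; congr (- _); rewrite -[RHS]I0; apply: eq_I => x.
by rewrite -mulr_sumr -mulr_suml divU mul0r mulr0.
Qed.

Lemma amgm (a b c l : R) : 0 < l -> 0 <= c -> `|b| <= c ->
  `|a * b| <= 2^-1 * (l * c ^+ 2) + 2^-1 * l^-1 * a ^+ 2.
Proof.
move=> l0 c0 bc; rewrite normrM; apply: (@le_trans _ _ (`|a| * c)).
  by rewrite ler_wpM2l.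
have -> : a ^+ 2 = `|a| ^+ 2 by rewrite real_normK ?num_real.
move: `|a| => {}a; rewrite -subr_ge0.
have -> : 2^-1 * (l * c ^+ 2) + 2^-1 * l^-1 * a ^+ 2 - a * c = 2^-1 * l^-1 * (l * c - a) ^+ 2.
  by field; rewrite gt_eqF.
by rewrite mulr_ge0 ?sqr_ge0// mulr_ge0// invr_ge0 ltW.
Qed.

(** The Hessian of B is not bounded pointwise by its Laplacian, but it is in L^2 by
[hessian_sq]. The weight D / M in the arithmetic-geometric inequality balances
its two sides, so that the bound is linear in M and in D. *)
Lemma I_laplacian_bound B (D : R) : 0 < D -> Ck 5 B -> in_shell B ->
  (forall x, `|x| <= 4 -> `|lap B x| <= D) ->
  `|I (fun x => P x * lap B x)| <= 8 ^+ 3 * (5 * (M * D)).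
Proof.
move=> D0 CB sB BD.
have B0 := in_shell_vanish sB.
have CB4 : Ck 4 B by ck.
rewrite I_laplacian_hessian//.
pose l := D / M; have l0 : 0 < l by rewrite divr_gt0.
have H i j : `|I (fun x => pd j (pd i B) x * G i j x)| <=
    8 ^+ 3 * (2^-1 * (M * D)) + 2^-1 * l^-1 * I (fun x => pd i (pd j B) x ^+ 2).
  have b1 : bdd (fun x => pd j (pd i B) x * G i j x).
    by apply: (@bdd_Ck _ 2); ck.
  have b2 : bdd (fun x => pd i (pd j B) x ^+ 2).
    by apply: (@bdd_Ck _ 2); ck.
  have b3 : bdd (fun x => 2^-1 * l^-1 * pd i (pd j B) x ^+ 2).
    by apply: (@bdd_Ck _ 2); ck.
  apply: le_trans (I_norm b1) _.
  rewrite -I_cst -IZ// -ID//; last by apply: (@bdd_Ck _ 2); exact: Ck_cst.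
  apply: I_le.
  - by case: b1 => C hC; exists C => x /hC; rewrite normr_id.
  - by apply: (@bdd_Ck _ 2); ck.
  move=> x _.
  have C2 : Ck 2 B by ck.
  rewrite (partialC x i j C2).
  have [xs|xs] := boolP (1 / 4 <= `|x| <= 9 / 4).
    apply: le_trans (amgm _ l0 (ltW M0) (GM i j xs)) _.
    rewrite lerD2r /l [D / M * _](_ : _ = M * D)//.
    by field; rewrite gt_eqF.
  rewrite (in_shell_partial j (in_shell_partial i sB) xs) mul0r normr0 expr0n /= mulr0 addr0.
  by rewrite mulr_ge0 ?invr_ge0// mulr_ge0// ltW.
apply: le_trans (ler_norm_sum _ _ _) _.
apply: le_trans (ler_sum _ (fun i _ => ler_norm_sum _ _ _)) _.
apply: le_trans (ler_sum _ (fun i _ => ler_sum _ (fun j _ => H i j))) _.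
under eq_bigr do rewrite big_split /= sumr_const card_ord -mulr_sumr.
rewrite big_split /= sumr_const card_ord -mulr_sumr hessian_sq//.
have CL : Ck 2 (lap B) by ck.
have bL : bdd (fun x => lap B x ^+ 2) by apply: (@bdd_Ck _ 2); ck.
have : I (fun x => lap B x ^+ 2) <= 8 ^+ 3 * D ^+ 2.
  rewrite -I_cst; apply: I_le => //.
    by apply: (@bdd_Ck _ 2); exact: Ck_cst.
  move=> x x4; rewrite -real_normK ?num_real//.
  by apply: lerXn2r; rewrite ?nnegrE ?BD// ltW.
move=> hL; have l1 : 0 <= 2^-1 * l^-1 by rewrite mulr_ge0// invr_ge0 ltW.
have := ler_wpM2l l1 hL; move: (I _) => IL hIL.
have -> : 8 ^+ 3 * (5 * (M * D)) = 9 * (8 ^+ 3 * (2^-1 * (M * D))) + 2^-1 * l^-1 * (8 ^+ 3 * D ^+ 2).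
  rewrite /l; field; rewrite !gt_eqF//.
apply: lerD => //.
move: (8 ^+ 3 * _) => a; have -> : a *+ 3 *+ 3 = 9 * a by ring.
exact: lexx.
Qed.

(** P itself is only determined up to an additive constant and has no a priori
bound, but its convolution with a regular kernel has a gradient controlled by M:
see [conv_shell]. *)
Definition pconv z y := I (fun x => P x * z (x - y)).

Lemma taylor_axis z (A h : R) j x : Ck 2 z -> (forall x, `|pd j (pd j z) x| <= A) ->
  `|h| <= 1 -> `|z (h *: axis j + x) - z x - h * pd j z x| <= A * h ^+ 2.
Proof.
move=> Cz zA h1; have [s [s1 _] ->] := partial_MVT x h (@Ck_derivable _ _ _ Cz j).
have [s' [_ _] e'] := partial_MVT x s (@Ck_derivable _ _ _ (Ck_partial Cz j) j).
rewrite -mulrBr e' !normrM mulrA [leRHS]mulrC -[h ^+ 2]real_normK ?num_real// expr2.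
apply: ler_pM => //.
by apply: ler_wpM2l.
Qed.

(** Differentiation under the integral sign, where Taylor's formula provides the
uniform quadratic remainder. *)
Lemma conv_derive z j y : Ck 2 z -> vanish (1 / 4) z ->
  is_derive y (axis j) (pconv z) (- I (fun x => P x * pd j z (x - y))).
Proof.
move=> Cz z0.
have [A A0 zA] : exists2 C : R, 0 < C & forall x, `|pd j (pd j z) x| <= C.
  apply: (@vanish_bounded _ _ (1 / 4)); last by apply/vanish_partial/vanish_partial.
  exact: (Ck_continuous (Ck_partial (Ck_partial Cz j) j)).
have [P0 PP] := continuous_bounded 4 (Ck_continuous CP).
apply/is_derive_line; apply: (@is_derive_quad _ _ _ _ (8 ^+ 3 * (P0 * A))) => h h1.
have Czs k w : Ck k z -> Ck k (fun x => z (x - w)) by exact: Ck_shift.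
have b1 w : bdd (fun x => P x * z (x - w)).
  by apply: (@bdd_Ck _ 2); apply: CkM; [ck|exact: Czs].
have b2 : bdd (fun x => P x * pd j z (x - y)).
  by apply: (@bdd_Ck _ 1); apply: CkM; [ck|apply: Ck_shift; ck].
have b1N w : bdd (fun x => - (P x * z (x - w))).
  by apply: (@bdd_Ck _ 2); apply/CkN/CkM; [ck|exact: Czs].
have b2Z : bdd (fun x => h * (P x * pd j z (x - y))).
  by apply: (@bdd_Ck _ 1); apply/CkZ/CkM; [ck|apply: Ck_shift; ck].
rewrite addr0 scale0r add0r /pconv mulrN opprK -IN// -ID// -IZ// -ID//; last first.
  by apply: (@bdd_Ck _ 2); apply: CkB; apply: CkM; [ck|exact: Czs|ck|exact: Czs].
rewrite -mulrA; apply: I_bound => x x4.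
have -> : P x * z (x - (h *: axis j + y)) + - (P x * z (x - y)) + h * (P x * pd j z (x - y)) =
    P x * (z ((- h) *: axis j + (x - y)) - z (x - y) - (- h) * pd j z (x - y)).
  have -> : x - (h *: axis j + y) = - h *: axis j + (x - y).
    by rewrite scaleNr opprD addrCA.
  by move: (pd j z _) => c; ring.
rewrite normrM -mulrA; apply: ler_pM => //; first exact: PP.
rewrite -(sqrrN h); apply: taylor_axis => //.
by rewrite normrN.
Qed.

(** The derivative of the convolution is, after integration by parts, a derivative
of P tested against a translate of z, which is supported in the larger shell when
the center is in the smaller one. *)
Lemma conv_shell z y (C : R) : Ck 3 z -> vanish (1 / 4) z ->
  (forall i x, `|pd i z x| <= C) -> (forall i x, `|pd i (pd i z) x| <= C) ->
  1 / 2 <= `|y| <= 2 -> `|pconv z y - pconv z corner| <= 12 * (8 ^+ 3 * (6 * (M * C))).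
Proof.
move=> Cz z0 z1 z2 yS.
have C0 : 0 <= C := le_trans (normr_ge0 _) (z1 0 0).
have Cz2 : Ck 2 z by ck.
apply: shell_path => //.
- by move=> i w; have [] := conv_derive i w Cz2 z0.
- by rewrite mulr_ge0// mulr_ge0// mulr_ge0// ltW.
move=> i w wS; rewrite (partialE (conv_derive i w Cz2 z0)).
have /andP[w1 w2] := wS.
have Cs : Ck 3 (fun x => z (x - w)) by exact: Ck_shift.
have Cs2 : Ck 2 (fun x => z (x - w)) by exact: Ck_shift.
have CP2 : Ck 2 P by ck.
have vs : vanish 3 (fun x => z (x - w)).
  by apply: (vanish_shift z0 w2); lra.
have ps j : pd j (fun x => z (x - w)) = fun x => pd j z (x - w).
  by apply/funext => x; exact: (partial_shift w j x Cz).
have -> : I (fun x => P x * pd i z (x - w)) = - I (fun x => pd i P x * z (x - w)).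
  by rewrite -(@ibp _ _ _ i CP2 Cs2 (vanishMr _ vs)) ps.
rewrite opprK; apply: (I_grad_bound i Cs).
- move=> x xs; apply: z0.
  move: xs; rewrite negb_and -!ltNge => /orP[x1|x1].
    have : `|w| <= `|x - w| + `|x| by rewrite distrC -{1}(subrK x w) ler_normD.
    lra.
  have : `|x| <= `|x - w| + `|w| by rewrite -{1}(subrK w x) ler_normD.
  lra.
- by move=> j x; rewrite ps.
- move=> j x; rewrite ps; have C1 : Ck 1 (pd j z) by ck.
  by rewrite (partial_shift w j x C1).
Qed.

End Data.

(** A finite stand-in for the convolution of a density with z: its derivatives are
those of a finite sum. *)
Definition lsum n (w : {ffun 'I_3 -> 'I_(cells n).+1} -> R) z x : R :=
  \sum_a w a * z (x - node a).

Lemma Ck_lsum n w k z : Ck k z -> Ck k (@lsum n w z).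
Proof. by move=> Cz; apply: Ck_sum => a _; apply/CkZ/Ck_shift. Qed.

Lemma partial_lsum n w k z i x : Ck k.+1 z -> pd i (@lsum n w z) x = lsum w (pd i z) x.
Proof.
move=> Cz; rewrite (@partial_sum _ k); last by move=> a _; exact/CkZ/Ck_shift.
apply: eq_bigr => a _; have Cs : Ck k.+1 (fun x => z (x - node a)) by exact: Ck_shift.
by rewrite (partialZ (w a) i x Cs) (partial_shift _ i x Cz).
Qed.

Lemma laplacian_lsum n w k z x : Ck k.+2 z -> lap (@lsum n w z) x = lsum w (lap z) x.
Proof.
move=> Cz; have p1 i : pd i (lsum w z) = lsum w (pd i z).
  by apply/funext => y; exact: partial_lsum Cz.
transitivity (\sum_i lsum w (pd i (pd i z)) x).
  by apply: eq_bigr => i _; rewrite p1; exact: partial_lsum (Ck_partial Cz i).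
by rewrite /lsum exchange_big; apply: eq_bigr => a _; rewrite mulr_sumr.
Qed.

Lemma riemann_reflect n g x : riemann n (fun y => g (x - y)) = lsum (fun _ : {ffun 'I_3 -> 'I_(cells n).+1} => mesh n ^+ 3) g x.
Proof. by rewrite riemannE mulr_sumr. Qed.

Lemma uniform_bound (F : 'I_3 -> E -> R) :
  (forall i, exists2 C : R, 0 < C & forall x, `|F i x| <= C) ->
  exists2 C : R, 0 < C & forall i x, `|F i x| <= C.
Proof.
move=> FC; have /choice[c hc] : forall i, exists C : R, 0 < C /\ forall x, `|F i x| <= C.
  by move=> i; have [C C0 hC] := FC i; exists C.
exists (\sum_i c i) => [|i x].
  rewrite (bigD1 0)//= ltr_wpDr//; last by case: (hc 0).
  by apply: sumr_ge0 => i _; apply: ltW; case: (hc i).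
rewrite (bigD1 i)//=; apply: (le_trans ((hc i).2 x)); rewrite lerDl.
by apply: sumr_ge0 => j _; apply: ltW; case: (hc j).
Qed.

(** The derivative of the Riemann sum with respect to the center is the Riemann sum
of a derivative, which is of the order of the step by [riemann_partial]. *)
Lemma mass_variation g : Ck 3 g -> vanish (1 / 4) g -> exists2 A : R, 0 < A &
  forall n x, `|x| <= 9 / 4 ->
  `|riemann n (fun y => g (x - y)) - riemann n (fun y => g (0 - y))| <= A * mesh n.
Proof.
move=> Cg g0.
have [|C C0 gC] := @uniform_bound (fun i => pd i (pd i g)).
  move=> i; apply: (@vanish_bounded _ _ (1 / 4)); last by apply/vanish_partial/vanish_partial.
  exact: (Ck_continuous (Ck_partial (Ck_partial Cg i) i)).
exists (3 * (8 ^+ 3 * C) * (9 / 4)) => [|n x xr].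
  by rewrite !mulr_gt0// ?exprn_gt0// invr_gt0.
pose m x := riemann n (fun y => g (x - y)).
have mE : m = lsum (fun _ : {ffun 'I_3 -> 'I_(cells n).+1} => mesh n ^+ 3) g.
  by apply/funext => y; exact: riemann_reflect.
have dm i w : pd i m w = - riemann n (pd i (fun y => g (w - y))).
  rewrite mE (partial_lsum _ i w (CkW Cg)) -riemann_reflect.
  rewrite -mulN1r -riemannZ; congr riemann; apply/funext => y.
  by rewrite (partial_reflect w i y Cg) mulN1r opprK.
have h0 : 0 < mesh n :> R := mesh_gt0 n.
rewrite -/(m x) -/(m 0).
have r94 : (0 : R) <= 9 / 4 by lra.
have m1 : forall i (z : E), `|z| <= 9 / 4 -> `|pd i m z| <= 8 ^+ 3 * C * mesh n.
  move=> i z zr; rewrite dm normrN; apply: riemann_partial.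
  - by apply: Ck_reflect; ck.
  - by apply: (vanish_reflect g0 zr); lra.
  move=> w; have -> : pd i (fun y => g (z - y)) = fun y => - pd i g (z - y).
    by apply/funext => y; exact: partial_reflect Cg.
  have C1 : Ck 1 (fun y => pd i g (z - y)) by apply: Ck_reflect; ck.
  have C2 : Ck 1 (pd i g) by ck.
  by rewrite (partialN i w C1) (partial_reflect z i w C2) opprK.
have dgm i w : derivable m w (axis i).
  by rewrite mE; apply: (@Ck_derivable _ 2); exact: Ck_lsum.
have A0 : 0 <= 8 ^+ 3 * C * mesh n by rewrite mulr_ge0 ?ltW// mulr_gt0.
have z94 : `|0 : E| <= 9 / 4 by rewrite normr0.
apply: le_trans (cube_lipschitz dgm A0 m1 z94 xr) _.
rewrite subr0; apply: (@le_trans _ _ (3 * (8 ^+ 3 * C * mesh n) * (9 / 4))).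
  by apply: ler_wpM2l => //; rewrite mulr_ge0.
by rewrite le_eqVlt; apply/orP; left; apply/eqP; ring.
Qed.

Lemma tame_bound (F : R -> E -> R) : tame 2 F -> exists2 C : R, 0 < C &
  forall e, 0 < e -> forall i x,
  [/\ `|F e x| <= C, `|pd i (F e) x| <= C & `|pd i (pd i (F e)) x| <= C].
Proof.
move=> [_ [C0 F0] F1].
have /choice[c hc] : forall i, exists C : R, forall e x, 0 < e ->
    `|pd i (F e) x| <= C /\ `|pd i (pd i (F e)) x| <= C.
  move=> i; have [_ [C1 F1'] F2] := F1 i; have [_ [C2 F2'] _] := F2 i.
  exists (Num.max C1 C2) => e x e0; rewrite !le_max F1'// F2'// orbT//.
exists (`|C0| + \sum_i `|c i| + 1) => [|e e0 i x].
  by rewrite ltr_wpDl// addr_ge0// sumr_ge0.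
have le1 : C0 <= `|C0| + \sum_i `|c i| + 1.
  rewrite (le_trans (ler_norm _))// -addrA lerDl addr_ge0// sumr_ge0//.
have le2 : c i <= `|C0| + \sum_i `|c i| + 1.
  rewrite (le_trans (ler_norm _))// (bigD1 i)//= addrAC addrCA -addrA lerDl.
  by rewrite !addr_ge0// sumr_ge0.
have [h1 h2] := hc i e x e0.
split; [exact: le_trans (F0 e x e0) le1|exact: le_trans h1 le2|exact: le_trans h2 le2].
Qed.

Lemma small_param (a b : R) : 0 <= a -> 0 < b -> exists2 e : R, 0 < e <= 1 / 16 & a * e ^+ 2 <= b.
Proof.
move=> a0 b0; have ab : 0 < b / (a + 1) by rewrite divr_gt0// ltr_wpDl.
exists (Num.min (1 / 16) (b / (a + 1))).
  by rewrite lt_min ab ge_min lexx andbT /= andbT; lra.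
set e := Num.min _ _.
have e0 : 0 <= e by rewrite le_min (ltW ab) andbT; lra.
have e1 : e <= 1 by rewrite ge_min; apply/orP; left; lra.
have e2 : e <= b / (a + 1) by rewrite ge_min lexx orbT.
apply: (@le_trans _ _ ((a + 1) * e)).
  apply: ler_pM; rewrite ?exprn_ge0// ?lerDl//.
  by rewrite expr2 ler_piMl.
by move: e2; rewrite ler_pdivlMr ?ltr_wpDl// mulrC.
Qed.

End Pressure.

(** * Mollification and the pressure estimate *)

Section PressureBound.
Context {R : realType}.
Local Notation E := 'rV[R]_3.
Implicit Types (f g z B : E -> R) (x y : E) (i j : 'I_3) (k : nat).

(** Within distance t of x the function f varies little, being Lipschitz, and
farther away delta is of order e^2 / t^5; hence t is chosen first, then e, then n.
The mass m depends on the center x only through an error of the order of the step,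
so that one normalization serves all centers, and the weights of the translates of
delta do not depend on x. *)
Lemma mollify (delta : R -> E -> R) (C : R) f (mu tau : R) :
  0 < C -> 0 < mu -> 0 < tau ->
  (forall e, 0 < e -> [/\ Ck 3 (delta e), vanish (1 / 4) (delta e),
     forall x, 0 <= delta e x,
     forall x t, 0 < t -> t <= `|x| -> delta e x <= C * e ^+ 2 * t^-1 ^+ 5 &
     forall x, e <= 1 / 16 -> `|x| <= e -> (11 * e ^+ 3)^-1 <= delta e x]) ->
  Ck 2 f -> vanish 2 f -> (forall x, `|f x| <= mu) ->
  exists2 e : R, 0 < e & \forall n \near \oo,
    let m x := riemann n (fun y => delta e (x - y)) in
    [/\ 1 / 88 <= m 0, forall x, `|x| <= 9 / 4 -> m x <= 2 * m 0 &
     forall x, `|x| <= 9 / 4 ->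
       `|f x - (m 0)^-1 * riemann n (fun y => f y * delta e (x - y))| <= tau].
Proof.
move=> C0 mu0 tau0 hdelta Cf f0 fmu.
have q94 : (0 : R) <= 9 / 4 by lra.
have q88 : (0 : R) < 1 / 88 by lra.
have [|L L0 fL] := @uniform_bound R (fun i => pd i f).
  move=> i; apply: (@vanish_bounded _ _ 2); last exact: vanish_partial.
  exact: (Ck_continuous (Ck_partial Cf i)).
have Lip x y : `|x| <= 4 -> `|y| <= 4 -> `|f x - f y| <= 3 * L * `|x - y|.
  by move=> x4 y4; apply: (cube_lipschitz (Ck_derivable Cf) (ltW L0)) y4 x4 => i w _; exact: fL.
pose t := tau / (24 * L); have t0 : 0 < t by rewrite divr_gt0// mulr_gt0.
have [||e /andP[e0 e16] ee] := @small_param R (8 ^+ 3 * (3 * L) * C * t^-1 ^+ 5) (tau / (4 * 88)).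
- by rewrite !mulr_ge0// ?exprn_ge0// ?invr_ge0 ltW.
- by rewrite divr_gt0.
exists e => //.
have [Cd d0 dge0 dt de] := hdelta e e0.
have [A A0 mA] := mass_variation Cd d0.
near=> n.
have h0 : 0 < mesh n :> R := mesh_gt0 n.
have hA1 : A * mesh n <= 1 / 88.
  rewrite mulrC -ler_pdivlMr//; near: n; apply: mesh_small; rewrite divr_gt0//.
have hA2 : mu * A * mesh n <= tau / (4 * 88).
  rewrite mulrC -ler_pdivlMr ?mulr_gt0//; near: n; apply: mesh_small.
  by rewrite !divr_gt0// mulr_gt0.
have he : 2 * mesh n <= e.
  by rewrite mulrC -ler_pdivlMr//; near: n; apply: mesh_small; rewrite divr_gt0.
pose m x := riemann n (fun y => delta e (x - y)).
change ([/\ 1 / 88 <= m 0, forall x, `|x| <= 9 / 4 -> m x <= 2 * m 0 &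
  forall x, `|x| <= 9 / 4 ->
  `|f x - (m 0)^-1 * riemann n (fun y => f y * delta e (x - y))| <= tau]).
(* 88 = 11 * 2^3: delta is at least 1 / (11 e^3) on the cube of radius e, and half of
   that radius is lost in counting nodes. *)
have m88 x : `|x| <= 9 / 4 -> 1 / 88 <= m x.
  move=> xr; have -> : 1 / 88 = (11 * e ^+ 3)^-1 * (e / 2) ^+ 3 :> R.
    by field; rewrite gt_eqF.
  apply: (@riemann_lower _ _ _ x) => //.
  - by rewrite invr_ge0 mulr_ge0// exprn_ge0// ltW.
  - by clear -xr e16; lra.
  - by move=> y yx; apply: de => //; rewrite distrC.
have m0 : 1 / 88 <= m 0 by apply: m88; rewrite normr0.
have mx x : `|x| <= 9 / 4 -> m x <= m 0 + A * mesh n.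
  by move=> /(mA n); rewrite -/(m x) -/(m 0) ler_distl => /andP[_].
split=> //; first by move=> x /mx; clear -hA1 m0; lra.
move=> x xr.
have m0p : 0 < m 0 by apply: lt_le_trans m0.
have x4 : `|x| <= 4 by clear -xr; lra.
have -> : f x - (m 0)^-1 * riemann n (fun y => f y * delta e (x - y)) =
  (m 0)^-1 * ((m 0 - m x) * f x + riemann n (fun y => (f x - f y) * delta e (x - y))).
  have -> : riemann n (fun y => (f x - f y) * delta e (x - y)) =
     f x * m x - riemann n (fun y => f y * delta e (x - y)).
    rewrite -riemannZ -[X in _ + X]mulN1r -riemannZ -riemannD; congr riemann.
    by apply/funext => y; ring.
  by field; rewrite gt_eqF.
rewrite normrM gtr0_norm ?invr_gt0// ler_pdivrMl//.
have b1 : `|(m 0 - m x) * f x| <= tau / (4 * 88).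
  apply: le_trans hA2; rewrite normrM mulrC -mulrA; apply: ler_pM => //.
  by rewrite distrC; exact: mA.
have b2 : `|riemann n (fun y => (f x - f y) * delta e (x - y))| <=
    3 * L * t * m x + 8 ^+ 3 * (3 * L * C * e ^+ 2 * t^-1 ^+ 5).
  apply: le_trans (riemann_norm _ _) _.
  rewrite -riemannZ -(riemann_cst n) -riemannD; apply: riemann_le => y y4.
  rewrite normrM (ger0_norm (dge0 _)).
  apply: (@le_trans _ _ (3 * L * `|x - y| * delta e (x - y))).
    by apply: ler_wpM2r => //; exact: Lip.
  have L3 : 0 <= 3 * L by rewrite mulr_ge0// ltW.
  have -> : 3 * L * t * delta e (x - y) + 3 * L * C * e ^+ 2 * t^-1 ^+ 5 =
    3 * L * (t * delta e (x - y) + C * e ^+ 2 * t^-1 ^+ 5) by move: (t^-1) => u; ring.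
  rewrite -mulrA.
  apply: ler_wpM2l => //.
  have [xt|tx] := leP `|x - y| t.
    apply: (@le_trans _ _ (t * delta e (x - y))); first exact: ler_wpM2r.
    rewrite lerDl !mulr_ge0 ?exprn_ge0 ?invr_ge0 ?ltW//.
  have [xq|xq] := leP `|x - y| (1 / 4); last first.
    rewrite d0// !mulr0 add0r !mulr_ge0 ?exprn_ge0 ?invr_ge0 ?ltW//.
  apply: (@le_trans _ _ (1 * delta e (x - y))).
    by apply: ler_wpM2r => //; clear -xq; lra.
  rewrite mul1r; apply: le_trans (dt _ t t0 (ltW tx)) _.
  by rewrite -mulrA lerDr mulr_ge0// ltW.
have e1 : 3 * L * t = tau / 8 by rewrite /t; field; rewrite gt_eqF.
have b3 : 3 * L * t * m x <= tau / 4 * m 0.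
  have -> : tau / 4 * m 0 = tau / 8 * (2 * m 0) by field.
  rewrite e1; apply: ler_wpM2l; first by rewrite divr_ge0// ltW.
  by have := mx x xr; clear -hA1 m0; lra.
have b4 : 8 ^+ 3 * (3 * L * C * e ^+ 2 * t^-1 ^+ 5) <= tau / (4 * 88).
  apply: le_trans ee; rewrite le_eqVlt; apply/orP; left; apply/eqP; ring.
have b5 : tau / (4 * 88) <= tau / 4 * m 0.
  have -> : tau / (4 * 88) = tau / 4 * (1 / 88) by field.
  by apply: ler_wpM2l => //; rewrite divr_ge0// ltW.
apply: le_trans (ler_normD _ _) _.
have -> : m 0 * tau = tau / 4 * m 0 + (tau / 4 * m 0 + tau / 4 * m 0) + tau / 4 * m 0 by field.
have := le_trans b1 b5; have := le_trans b4 b5; have : 0 <= tau / 4 * m 0.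
  by rewrite mulr_ge0 ?ltW// divr_gt0.
by move: b2 b3; clear; lra.
Unshelve. all: by end_near. Qed.

Lemma riemann_div_small f (W : 'I_3 -> E -> R) (s : R) :
  (forall j, Ck 2 (W j)) -> (forall j, vanish 3 (W j)) ->
  (forall x, f x = \sum_j pd j (W j) x) -> 0 < s ->
  \forall n \near \oo, `|riemann n f| <= s.
Proof.
move=> CW W0 fW s0.
have [|C C0 WC] := @uniform_bound R (fun j => pd j (pd j (W j))).
  move=> j; apply: (@vanish_bounded _ _ 3); last by apply/vanish_partial/vanish_partial.
  exact: (Ck_continuous (Ck_partial (Ck_partial (CW j) j) j)).
near=> n.
have -> : riemann n f = \sum_j riemann n (pd j (W j)).
  rewrite riemannE (eq_bigr _ (fun a _ => fW (node a))) exchange_big mulr_sumr.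
  by apply: eq_bigr => j _; rewrite riemannE.
apply: le_trans (ler_norm_sum _ _ _) _.
apply: le_trans (ler_sum _ (fun j _ => riemann_partial n (CW j) (W0 j) (WC j))) _.
rewrite sumr_const card_ord -[_ *+ 3]mulr_natl mulrA mulrC -ler_pdivlMr; last first.
  by rewrite !mulr_gt0// exprn_gt0.
near: n; apply: mesh_small; rewrite divr_gt0// !mulr_gt0// exprn_gt0//.
Unshelve. all: by end_near. Qed.

Lemma lsum_in_shell n (w : {ffun 'I_3 -> 'I_(cells n).+1} -> R) z :
  vanish (1 / 4) z -> (forall a, ~~ (1 / 2 <= `|node a : E| <= 2) -> w a = 0) ->
  in_shell (lsum w z).
Proof.
move=> z0 w0 x xs; apply: big1 => a _.
have [/andP[a1 a2]|/w0 ->] := boolP (1 / 2 <= `|node a : E| <= 2); last by rewrite mul0r.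
rewrite z0 ?mulr0//.
move: xs; rewrite negb_and -!ltNge => /orP[x1|x1].
  have : `|node a| <= `|x - node a| + `|x| by rewrite distrC -{1}(subrK x (node a)) ler_normD.
  lra.
have : `|x| <= `|x - node a| + `|node a| by rewrite -{1}(subrK (node a) x) ler_normD.
lra.
Qed.

Lemma lsum_bound n (w : {ffun 'I_3 -> 'I_(cells n).+1} -> R) z x (A C : R) :
  \sum_a `|w a| <= A -> (forall y, `|z y| <= C) -> `|lsum w z x| <= A * C.
Proof.
move=> wA zC; have C0 : 0 <= C := le_trans (normr_ge0 _) (zC 0).
apply: le_trans (ler_norm_sum _ _ _) _.
apply: (@le_trans _ _ (\sum_a `|w a| * C)); last by rewrite -mulr_suml ler_wpM2r.
by apply: ler_sum => a _; rewrite normrM ler_wpM2l.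
Qed.

Definition solves (P : E -> R) (U : 'I_3 -> E -> R) (G : 'I_3 -> 'I_3 -> E -> R) (ka : R) :=
  [/\ Ck 4 P, forall i, Ck 4 (U i), forall i j, Ck 4 (G i j),
   forall x, \sum_i pd i (U i) x = 0 &
   forall i x, pd i P x = ka * lap (U i) x + \sum_j pd j (G i j) x].

(** The constant depends neither on the solution nor on f, which is what makes the
estimate usable at all scales. The test function f is decomposed as
(f - S) + Z - lap B, where S, Z and B are sums of translates of delta, zeta and K
with weights proportional to the values of f at the nodes. The assumption that f
is a divergence is used through the smallness of the sum of these weights. *)
Lemma pressure_bound : exists2 D : R, 0 < D & forall P U G ka (M mu : R) f W,
  solves P U G ka -> 0 < M -> 0 < mu ->
  (forall i j x, 1 / 4 <= `|x| <= 9 / 4 -> `|G i j x| <= M) ->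
  (forall i x, 1 / 4 <= `|x| <= 9 / 4 -> `|ka * U i x| <= M) ->
  Ck 2 f -> (forall x, ~~ (1 / 2 <= `|x| <= 2) -> f x = 0) ->
  (forall x, `|f x| <= mu) ->
  (forall j, Ck 2 (W j)) -> (forall j, vanish 3 (W j)) ->
  (forall x, f x = \sum_j pd j (W j) x) ->
  `|I (fun x => P x * f x)| <= D * (M * mu).
Proof.
have [K [delta [zeta [C [C0 tz supp lapK hd]]]]] := @kernel_exists R.
have q88 : (0 : R) < 1 / 88 by lra.
have q94 : 9 / 4 <= (3 : R) by lra.
have [C1 C1p zC] := tame_bound (tameW tz).
pose A : R := 8 ^+ 3 * 88.
have A0 : 0 < A by rewrite mulr_gt0// exprn_gt0.
pose D1 := A * (12 * (8 ^+ 3 * (6 * C1))).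
pose D2 := 8 ^+ 3 * (5 * (2 + A * C1)).
have D1p : 0 < D1 by rewrite !mulr_gt0// exprn_gt0.
have D2p : 0 < D2 by rewrite !mulr_gt0// ?exprn_gt0// addr_gt0// mulr_gt0.
exists (D1 + D2); first exact: addr_gt0.
move=> P U G ka M mu f W [CP CU CG divU gradP] M0 mu0 GM UM Cf fS fmu CW W0 fW.
apply/ler_addgt0Pr => tau tau0.
have [P0 hP0] := continuous_bounded 4 (Ck_continuous CP).
pose P1 := `|P0| + 1; have P1p : 0 < P1 by rewrite ltr_wpDl.
have PP x : `|x| <= 4 -> `|P x| <= P1.
  by move=> /hP0 h; rewrite (le_trans h)// (le_trans (ler_norm _))// lerDl.
have f0 : vanish 2 f by move=> x x2; apply: fS; rewrite negb_and -!ltNge x2 orbT.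
pose tau' := tau / (2 * (8 ^+ 3 * P1)).
have tau'0 : 0 < tau' by rewrite divr_gt0// !mulr_gt0// exprn_gt0.
have [|e e0 hn] := @mollify delta C f mu tau' C0 mu0 tau'0 _ Cf f0 fmu.
  move=> e e0; have [_ Cd _ vd _] := supp e e0; have [h1 h2 h3] := hd e e0.
  by split.
have [CK Cd vK vd vz] := supp e e0.
have [Cz _ _] : tame 3 zeta := tz; have {}Cz := Cz e e0.
have z1 i x : `|pd i (zeta e) x| <= C1 by have [] := zC e e0 i x.
have z2 i x : `|pd i (pd i (zeta e)) x| <= C1 by have [] := zC e e0 i x.
have z3 x : `|zeta e x| <= C1 by have [] := zC e e0 0 x.
(* The value taken as the additive constant of the smoothed pressure. *)
pose kap := pconv P (zeta e) corner.
have s0 : 0 < tau / (2 * 88 * (`|kap| + 1)).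
  by rewrite divr_gt0// !mulr_gt0// ltr_wpDl.
near \oo => n.
have small : `|riemann n f| <= tau / (2 * 88 * (`|kap| + 1)).
  by near: n; exact: riemann_div_small fW s0.
have [m0 mx moll] : let m x := riemann n (fun y => delta e (x - y)) in
    [/\ 1 / 88 <= m 0, forall x, `|x| <= 9 / 4 -> m x <= 2 * m 0 &
     forall x, `|x| <= 9 / 4 ->
       `|f x - (m 0)^-1 * riemann n (fun y => f y * delta e (x - y))| <= tau'].
  by near: n; exact: hn.
pose m := riemann n (fun y => delta e (0 - y)).
rewrite -/m in m0 mx moll.
have mp : 0 < m by apply: lt_le_trans m0.
have mi : m^-1 <= 88.
  by rewrite -[leRHS]invrK lef_pV2 ?posrE// ?invr_gt0// -[88^-1]div1r.
have h0 : 0 < mesh n :> R := mesh_gt0 n.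
pose w (a : {ffun 'I_3 -> 'I_(cells n).+1}) : R := m^-1 * (mesh n ^+ 3 * f (node a)).
have w0 a : ~~ (1 / 2 <= `|node a : E| <= 2) -> w a = 0.
  by move=> /fS fa; rewrite /w fa !mulr0.
have wA : \sum_a `|w a| <= A * mu.
  have -> : \sum_a `|w a| = m^-1 * riemann n (fun x => `|f x|).
    rewrite riemannE !mulr_sumr; apply: eq_bigr => a _.
    have hm : 0 <= m^-1 by rewrite invr_ge0 ltW.
    have hh : 0 <= mesh n ^+ 3 :> R by rewrite exprn_ge0// ltW.
    by rewrite /w normrM (ger0_norm hm) normrM (ger0_norm hh).
  rewrite /A mulrAC mulrC; apply: ler_pM => //.
  - by apply: le_trans (normr_ge0 _) (riemann_norm _ _).
  - by rewrite invr_ge0 ltW.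
  by rewrite -(riemann_cst n); apply: riemann_le => x _.
have Amu : 0 <= A * mu by rewrite mulr_ge0 ?ltW.
pose S := lsum w (delta e); pose Z := lsum w (zeta e); pose B := lsum w (K e).
have SE x : S x = m^-1 * riemann n (fun y => f y * delta e (x - y)).
  rewrite riemannE !mulr_sumr; apply: eq_bigr => a _; rewrite /w; ring.
have lapB x : lap B x = Z x - S x.
  rewrite /B (laplacian_lsum w x CK) /Z /S /lsum -sumrB.
  by apply: eq_bigr => a _; rewrite lapK// mulrBr.
have CB : Ck 5 B by exact: Ck_lsum.
have CS : Ck 2 S by apply: Ck_lsum; ck.
have CZ : Ck 2 Z by apply: Ck_lsum; ck.
have sB : in_shell B by exact: lsum_in_shell.
have sS : in_shell S by exact: lsum_in_shell.
have sZ : in_shell Z by exact: lsum_in_shell.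
have Sb x : `|S x| <= 2 * mu.
  have [xs|/sS ->] := boolP (1 / 4 <= `|x| <= 9 / 4); last first.
    by rewrite normr0 mulr_ge0// ltW.
  have /andP[_ x9] := xs.
  rewrite SE normrM (gtr0_norm (_ : 0 < m^-1)) ?invr_gt0// ler_pdivrMl//.
  apply: le_trans (riemann_norm _ _) _.
  apply: (@le_trans _ _ (mu * riemann n (fun y => delta e (x - y)))).
    rewrite -riemannZ; apply: riemann_le => y _; rewrite normrM.
    apply: ler_pM => //; rewrite ger0_norm//.
    by have [dd _ _] := hd e e0; exact: dd.
  have -> : m * (2 * mu) = mu * (2 * m) by ring.
  by apply: ler_wpM2l; [exact: ltW|exact: mx].
have Zb x : `|Z x| <= A * mu * C1 by exact: lsum_bound.
have bPg g : Ck 2 g -> bdd (fun x => P x * g x).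
  by move=> Cg; apply: (@bdd_Ck _ 2); ck.
have split_I : I (fun x => P x * f x) = I (fun x => P x * (f x - S x)) +
    (I (fun x => P x * Z x) - I (fun x => P x * lap B x)).
  have CL : Ck 2 (lap B) by ck.
  have CfS : Ck 2 (fun x => f x - S x) by ck.
  have CN : Ck 2 (fun x => - lap B x) by ck.
  have -> : - I (fun x => P x * lap B x) = I (fun x => P x * - lap B x).
    by rewrite -IN; [apply: eq_I => x; rewrite mulrN|exact: bPg].
  rewrite -ID; [|exact: bPg|exact: bPg].
  rewrite -ID; [|exact: bPg|]; last first.
    by apply: (@bdd_Ck _ 2); ck.
  by apply: eq_I => x; rewrite lapB; ring.
have b1 : `|I (fun x => P x * (f x - S x))| <= tau / 2.
  have -> : tau / 2 = 8 ^+ 3 * (P1 * tau').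
    by rewrite /tau'; field; rewrite gt_eqF.
  apply: I_bound => x x4; rewrite normrM; apply: ler_pM => //; first exact: PP.
  have [xs|xs] := leP `|x| (9 / 4); first by rewrite SE; exact: moll.
  have Sx : S x = 0 by apply: sS; rewrite negb_and -!ltNge xs orbT.
  have fx : f x = 0 by apply: f0; clear -xs; lra.
  by rewrite Sx fx subrr normr0 ltW.
have b2 : `|I (fun x => P x * lap B x)| <= D2 * (M * mu).
  have -> : D2 * (M * mu) = 8 ^+ 3 * (5 * (M * ((2 + A * C1) * mu))) by rewrite /D2; ring.
  apply: (@I_laplacian_bound R P U G ka M) => //.
    by rewrite mulr_gt0// addr_gt0// mulr_gt0.
  move=> x _; rewrite lapB; apply: le_trans (ler_normB _ _) _.
  have -> : (2 + A * C1) * mu = A * mu * C1 + 2 * mu by ring.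
  exact: lerD.
(* The weights sum to nearly 0, so [kap] may be subtracted from each value of the
   convolution. *)
have b3 : `|I (fun x => P x * Z x)| <= D1 * (M * mu) + tau / 2.
  have -> : I (fun x => P x * Z x) =
      \sum_a w a * (pconv P (zeta e) (node a) - kap) + kap * (m^-1 * riemann n f).
    have -> : kap * (m^-1 * riemann n f) = \sum_a w a * kap.
      by rewrite -mulr_suml mulrC riemannE !mulr_sumr.
    rewrite -big_split /=.
    transitivity (I (fun x => \sum_a w a * (P x * zeta e (x - node a)))).
      by apply: eq_I => x; rewrite mulr_sumr; apply: eq_bigr => a _; rewrite mulrCA.
    have CPz a : Ck 2 (fun x => P x * zeta e (x - node a)).
      by apply: CkM; [ck|apply: Ck_shift; ck].
    apply: etrans (@I_sum _ _ _ xpredT (fun a x => w a * (P x * zeta e (x - node a))) 2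
      (fun a _ => CkZ (w a) (CPz n a))) _.
    apply: eq_bigr => a _; rewrite IZ; last exact: bdd_Ck (CPz n a).
    by rewrite -mulrDr subrK.
  apply: le_trans (ler_normD _ _) _; apply: lerD.
    apply: le_trans (ler_norm_sum _ _ _) _.
    apply: (@le_trans _ _ (\sum_a `|w a| * (12 * (8 ^+ 3 * (6 * (M * C1)))))).
      apply: ler_sum => a _; rewrite normrM.
      have [as_|/w0 ->] := boolP (1 / 2 <= `|node a : E| <= 2); last first.
        by rewrite normr0 !mul0r.
      apply: ler_wpM2l => //; apply: (@conv_shell R P U G ka M) => //.
    rewrite -mulr_suml.
    have -> : D1 * (M * mu) = A * mu * (12 * (8 ^+ 3 * (6 * (M * C1)))) by rewrite /D1; ring.
    by apply: ler_wpM2r => //; rewrite !mulr_ge0// ?exprn_ge0// ltW.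
  have im0 : 0 <= m^-1 by rewrite invr_ge0 ltW.
  rewrite [`|kap * _|]normrM [`|m^-1 * _|]normrM (ger0_norm im0).
  apply: (@le_trans _ _ ((`|kap| + 1) * (88 * (tau / (2 * 88 * (`|kap| + 1)))))).
    apply: ler_pM => //; [exact: mulr_ge0|by rewrite lerDl|].
    exact: ler_pM.
  rewrite le_eqVlt; apply/orP; left; apply/eqP; field.
  by rewrite gt_eqF// ltr_wpDl.
rewrite split_I; apply: le_trans (ler_normD _ _) _.
have := ler_normB (I (fun x => P x * Z x)) (I (fun x => P x * lap B x)).
by rewrite [(D1 + D2) * _]mulrDl; move: b1 b2 b3; clear; lra.
Unshelve. all: by end_near. Qed.

End PressureBound.

(** * Local energy estimate *)

#[local] Opaque lap.

Section Energy.
Context {R : realType}.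
Local Notation E := 'rV[R]_3.
Implicit Types (f g phi : E -> R) (x y : E) (i j : 'I_3) (k : nat).

Definition gradsq g x : R := \sum_j pd j g x ^+ 2.

Definition along (W : 'I_3 -> E -> R) f x : R := \sum_j W j x * pd j f x.

Lemma I_div (W : 'I_3 -> E -> R) : (forall j, Ck 2 (W j)) -> (forall j, vanish 3 (W j)) ->
  I (fun x => \sum_j pd j (W j) x) = 0.
Proof.
move=> CW W0; rewrite (@I_sum _ _ _ _ _ 1); last by move=> j _; ck.
by rewrite big1// => j _; exact: I_partial.
Qed.

Section Test.
Variable phi : E -> R.
Hypotheses (Cphi : Ck 5 phi) (phi0 : vanish 3 phi).

Lemma I_dissipation g : Ck 4 g ->
  I (fun x => phi x * g x * lap g x) =
  2^-1 * I (fun x => g x ^+ 2 * lap phi x) - I (fun x => phi x * gradsq g x).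
Proof.
move=> Cg.
have Cg2 : Ck 4 (fun x => g x * g x) by ck.
have lapg x : lap (fun x => g x * g x) x = 2 * (g x * lap g x) + 2 * gradsq g x.
  have CC : Ck 2 g by ck.
  rewrite (laplacianM x CC CC); have -> : \sum_i pd i g x * pd i g x = gradsq g x.
    by apply: eq_bigr => i _; rewrite expr2.
  by move: (lap g x) => L; ring.
have Cs : Ck 3 (gradsq g) by rewrite /gradsq; ck.
have C3 : Ck 3 (fun x => g x * g x) by ck.
have C4 : Ck 3 phi by ck.
have b1 : bdd (fun x => phi x * gradsq g x) by apply: (@bdd_Ck _ 2); ck.
have b2 : bdd (fun x => lap (fun x => g x * g x) x * phi x) by apply: (@bdd_Ck _ 2); ck.
have b3 : bdd (fun x => 2^-1 * (lap (fun x => g x * g x) x * phi x)) by apply: (@bdd_Ck _ 2); ck.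
have b4 : bdd (fun x => - (phi x * gradsq g x)) by apply: (@bdd_Ck _ 2); ck.
have e1 : I (fun x => lap (fun x => g x * g x) x * phi x) = I (fun x => g x ^+ 2 * lap phi x).
  by rewrite (I_laplacian_ibp C3 C4 phi0); apply: eq_I => x; rewrite expr2.
transitivity (2^-1 * I (fun x => lap (fun x => g x * g x) x * phi x) -
  I (fun x => phi x * gradsq g x)); last by congr (_ * _ + _).
rewrite -(IN b1) -(IZ _ b2) -(ID b3 b4); apply: eq_I => x; rewrite lapg.
by move: (lap g x) (gradsq g x) => a b; field.
Qed.

Lemma I_transport (W : 'I_3 -> E -> R) g : (forall j, Ck 4 (W j)) -> Ck 4 g ->
  (forall x, \sum_j pd j (W j) x = 0) ->
  I (fun x => phi x * g x * along W g x) = - (2^-1 * I (fun x => g x ^+ 2 * along W phi x)).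
Proof.
move=> CW Cg W0.
have CX j : Ck 2 (fun x => phi x * (W j x * (g x * g x))) by ck.
have X0 j : vanish 3 (fun x => phi x * (W j x * (g x * g x))) by exact: vanishMl.
have := I_div CX X0.
have -> : I (fun x => \sum_j pd j (fun x => phi x * (W j x * (g x * g x))) x) =
  I (fun x => 2 * (phi x * g x * along W g x) + g x ^+ 2 * along W phi x).
  apply: eq_I => x.
  transitivity (2 * (phi x * g x * along W g x) + g x ^+ 2 * along W phi x +
     phi x * g x ^+ 2 * \sum_j pd j (W j) x); last by rewrite W0 mulr0 addr0.
  rewrite /along !mulr_sumr -!big_split /=; apply: eq_bigr => j _.
  have C1 : Ck 1 phi by ck.
  have C2 : Ck 1 (W j) by ck.
  have C3 : Ck 1 g by ck.
  have C4 : Ck 1 (fun x => g x * g x) by ck.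
  have C5 : Ck 1 (fun x => W j x * (g x * g x)) by ck.
  rewrite (partialM j x C1 C5) (partialM j x C2 C4) (partialM j x C3 C3).
  by move: (pd j phi x) (pd j (W j) x) (pd j g x) => a b c; ring.
have Ca : Ck 2 (along W g) by rewrite /along; ck.
have Cp : Ck 2 (along W phi) by rewrite /along; ck.
rewrite ID; [|by apply: (@bdd_Ck _ 2); ck|by apply: (@bdd_Ck _ 2); ck].
rewrite IZ; last by apply: (@bdd_Ck _ 2); ck.
move: (I _) (I _) => a b; lra.
Qed.

Lemma I_flux (W : 'I_3 -> E -> R) g : (forall j, Ck 4 (W j)) -> Ck 4 g ->
  \sum_j I (fun x => phi x * W j x * pd j g x) + I (fun x => phi x * g x * \sum_j pd j (W j) x)
  = - I (fun x => g x * along W phi x).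
Proof.
move=> CW Cg.
have CX j : Ck 2 (fun x => phi x * (W j x * g x)) by ck.
have X0 j : vanish 3 (fun x => phi x * (W j x * g x)) by exact: vanishMl.
have := I_div CX X0.
have -> : I (fun x => \sum_j pd j (fun x => phi x * (W j x * g x)) x) =
  I (fun x => (\sum_j phi x * W j x * pd j g x + phi x * g x * \sum_j pd j (W j) x)
   + g x * along W phi x).
  apply: eq_I => x.
  rewrite /along !mulr_sumr -!big_split /=; apply: eq_bigr => j _.
  have C1 : Ck 1 phi by ck.
  have C2 : Ck 1 (W j) by ck.
  have C3 : Ck 1 g by ck.
  have C5 : Ck 1 (fun x => W j x * g x) by ck.
  rewrite (partialM j x C1 C5) (partialM j x C2 C3).
  by move: (pd j phi x) (pd j (W j) x) (pd j g x) => a b c; ring.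
have Cp : Ck 2 (along W phi) by rewrite /along; ck.
have Cd : Ck 2 (fun x => \sum_j pd j (W j) x) by ck.
rewrite ID; [|by apply: (@bdd_Ck _ 2); ck|by apply: (@bdd_Ck _ 2); ck].
rewrite ID; [|by apply: (@bdd_Ck _ 2); ck|by apply: (@bdd_Ck _ 2); ck].
have S1 : I (fun x => \sum_j phi x * W j x * pd j g x) = \sum_j I (fun x => phi x * W j x * pd j g x).
  by apply: (@I_sum _ _ _ _ _ 2) => j _; ck.
rewrite S1; move: (\sum_j _) (I _) (I _) => a b c; lra.
Qed.

End Test.

(** The system with viscosity [ka], component by component; rescaling changes the
viscosity only. *)
Definition tropical (ka : R) (U V : 'I_3 -> E -> R) (P T : E -> R) : Prop :=
  [/\ [/\ forall i, Ck 5 (U i), forall i, Ck 5 (V i), Ck 5 P & Ck 5 T],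
   forall i x, - (ka * lap (U i) x) + along U (U i) x + pd i P x +
     \sum_j pd j (fun y => V i y * V j y) x = 0,
   forall i x, - (ka * lap (V i) x) + along U (V i) x + pd i T x + along V (U i) x = 0,
   forall x, - (ka * lap T x) + along U T x + \sum_j pd j (V j) x = 0 &
   forall x, \sum_j pd j (U j) x = 0].

Lemma I_lin4 (ka : R) (a b c d : E -> R) : Ck 1 a -> Ck 1 b -> Ck 1 c -> Ck 1 d ->
  I (fun x => - (ka * a x) + b x + c x + d x) = - (ka * I a) + I b + I c + I d.
Proof.
move=> Ca Cb Cc Cd.
have b1 : bdd (fun x => - (ka * a x) + b x + c x) by apply: (@bdd_Ck _ 1); ck.
have b2 : bdd (fun x => - (ka * a x) + b x) by apply: (@bdd_Ck _ 1); ck.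
have b3 : bdd (fun x => - (ka * a x)) by apply: (@bdd_Ck _ 1); ck.
have b4 : bdd (fun x => ka * a x) by apply: (@bdd_Ck _ 1); ck.
rewrite (ID b1 (bdd_Ck Cd)) (ID b2 (bdd_Ck Cc)) (ID b3 (bdd_Ck Cb)) (IN b4).
by rewrite (IZ _ (bdd_Ck Ca)).
Qed.

Lemma balance_solve (ka A B C D p q r : R) : - (ka * A) + B + C + D = 0 ->
  A = 2^-1 * p - q -> B = - (2^-1 * r) ->
  ka * q = ka * 2^-1 * p + 2^-1 * r - C - D.
Proof. by move=> h hA hB; rewrite hA hB mulrBr in h; lra. Qed.

Lemma balance_sum (ka : R) (C D p q r : 'I_3 -> R) :
  (forall i, ka * q i = ka * 2^-1 * p i + 2^-1 * r i - C i - D i) ->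
  ka * \sum_i q i = ka * 2^-1 * \sum_i p i + 2^-1 * \sum_i r i - \sum_i C i - \sum_i D i.
Proof.
by move=> h; rewrite !mulr_sumr -!sumrN -!big_split; apply: eq_bigr => i _; exact: h.
Qed.

Lemma balance_total (ka qU pU rU qV pV rV qT pT rT FP FX GT GX HT PP TT XX : R) :
  ka * qU = ka * 2^-1 * pU + 2^-1 * rU - FP - FX ->
  ka * qV = ka * 2^-1 * pV + 2^-1 * rV - GT - GX ->
  ka * qT = ka * 2^-1 * pT + 2^-1 * rT - HT - 0 ->
  FP = - PP -> GT + HT = - TT -> FX + GX = - XX ->
  ka * (qU + qV + qT) =
  ka * 2^-1 * (pU + pV + pT) + 2^-1 * (rU + rV + rT) + PP + TT + XX.
Proof. by move=> hU hV hT hP hTT hX; rewrite !mulrDr hU hV hT hP; lra. Qed.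

(** The equations are tested with phi U, phi V and phi (T - c). The pairs
(V . grad T, T div V) and (div (V tensor V) . U, (V . grad) U . V) each add up to a
divergence, so that against phi they only leave terms with a derivative of phi. The constant c may be subtracted because the system involves T through its
derivatives. *)
Lemma energy_identity phi (c ka : R) U V P T : Ck 5 phi -> vanish 3 phi ->
  tropical ka U V P T ->
  ka * (\sum_i I (fun x => phi x * gradsq (U i) x) + \sum_i I (fun x => phi x * gradsq (V i) x)
        + I (fun x => phi x * gradsq T x)) =
  ka * 2^-1 * (\sum_i I (fun x => U i x ^+ 2 * lap phi x) +
     \sum_i I (fun x => V i x ^+ 2 * lap phi x) + I (fun x => (T x - c) ^+ 2 * lap phi x)) +
  2^-1 * (\sum_i I (fun x => U i x ^+ 2 * along U phi x) +
     \sum_i I (fun x => V i x ^+ 2 * along U phi x) + I (fun x => (T x - c) ^+ 2 * along U phi x)) +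
  I (fun x => P x * along U phi x) + I (fun x => (T x - c) * along V phi x) +
  \sum_i I (fun x => U i x * V i x * along V phi x).
Proof.
move=> Cphi phi0 [[CU CV CP CT] e1 e2 e3 e4].
have CU4 i : Ck 4 (U i) by ck.
have CV4 i : Ck 4 (V i) by ck.
have CP4 : Ck 4 P by ck.
pose S x := T x - c.
have CS : Ck 4 S by rewrite /S; ck.
have pdS j : pd j S = pd j T.
  apply/funext => x; have C1 : Ck 1 T by ck.
  have C2 : Ck 1 (fun _ : E => - c) by exact: Ck_cst.
  by rewrite /S (partialD j x C1 C2) partial_cst addr0.
have lapS : lap S = lap T.
  by apply/funext => x; apply: eq_bigr => i _; rewrite pdS.
have alongS W : along W S = along W T.
  by apply/funext => x; apply: eq_bigr => i _; rewrite pdS.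
have gradS : gradsq S = gradsq T.
  by apply/funext => x; apply: eq_bigr => i _; rewrite pdS.
have Calong k W g : (forall j, Ck k (W j)) -> Ck k.+1 g -> Ck k (along W g).
  move=> CW Cg; apply: Ck_sum => j _; apply: CkM; [exact: CW|exact: (Ck_partial Cg)].
have CaU g : Ck 4 g -> Ck 1 (along U g) by move=> Cg; apply: Calong => [j|]; ck.
have CaV g : Ck 4 g -> Ck 1 (along V g) by move=> Cg; apply: Calong => [j|]; ck.
have H1 i : ka * I (fun x => phi x * gradsq (U i) x) =
    ka * 2^-1 * I (fun x => U i x ^+ 2 * lap phi x)
    + 2^-1 * I (fun x => U i x ^+ 2 * along U phi x)
    - I (fun x => phi x * U i x * pd i P x)
    - I (fun x => phi x * U i x * \sum_j pd j (fun y => V i y * V j y) x).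
  have Ca := CaU _ (CU4 i).
  apply: balance_solve (I_dissipation Cphi phi0 (CU4 i)) (I_transport Cphi phi0 CU4 (CU4 i) e4).
  rewrite -[RHS]I0 -I_lin4; [|by ck|by ck|by ck|by ck].
  apply: eq_I => x; rewrite -[RHS](mulr0 (phi x * U i x)) -[X in _ = _ * X](e1 i x).
  by move: (lap _ _) (along _ _ _) (pd _ _ _) (\sum_j _) => p q r s; ring.
have H2 i : ka * I (fun x => phi x * gradsq (V i) x) =
    ka * 2^-1 * I (fun x => V i x ^+ 2 * lap phi x)
    + 2^-1 * I (fun x => V i x ^+ 2 * along U phi x)
    - I (fun x => phi x * V i x * pd i S x)
    - I (fun x => phi x * V i x * along V (U i) x).
  have Ca := CaU _ (CV4 i); have Ca' := CaV _ (CU4 i).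
  apply: balance_solve (I_dissipation Cphi phi0 (CV4 i)) (I_transport Cphi phi0 CU4 (CV4 i) e4).
  rewrite -[RHS]I0 -I_lin4; [|by ck|by ck|by ck|by ck].
  apply: eq_I => x; rewrite -[RHS](mulr0 (phi x * V i x)) -[X in _ = _ * X](e2 i x) pdS.
  by move: (lap _ _) (along _ _ _) (pd _ _ _) (along _ _ _) => p q r s; ring.
have H3 : ka * I (fun x => phi x * gradsq T x) =
    ka * 2^-1 * I (fun x => S x ^+ 2 * lap phi x)
    + 2^-1 * I (fun x => S x ^+ 2 * along U phi x)
    - I (fun x => phi x * S x * \sum_j pd j (V j) x) - 0.
  have Ca := CaU _ CS.
  have dS := I_dissipation Cphi phi0 CS; rewrite gradS in dS.
  apply: balance_solve dS (I_transport Cphi phi0 CU4 CS e4).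
  have := @I_lin4 ka (fun x => phi x * S x * lap S x) (fun x => phi x * S x * along U S x)
    (fun x => phi x * S x * \sum_j pd j (V j) x) (fun=> 0).
  rewrite I0 => <-; [|by ck|by ck|by ck|by ck].
  rewrite -[RHS]I0; apply: eq_I => x; rewrite -[RHS](mulr0 (phi x * S x)) -[X in _ = _ * X](e3 x) lapS alongS.
  by move: (lap _ _) (along _ _ _) (\sum_j _) => p q r; ring.
have F1 : \sum_i I (fun x => phi x * U i x * pd i P x) = - I (fun x => P x * along U phi x).
  rewrite -(I_flux Cphi phi0 CU4 CP4) -[LHS]addr0; congr (_ + _).
  by rewrite -[LHS]I0; apply: eq_I => x; rewrite e4 mulr0.
have F2 := I_flux Cphi phi0 CV4 CS.
have F3 i : I (fun x => phi x * U i x * \sum_j pd j (fun y => V i y * V j y) x) +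
    I (fun x => phi x * V i x * along V (U i) x) = - I (fun x => U i x * V i x * along V phi x).
  have CUV : Ck 4 (fun x => U i x * V i x) by ck.
  rewrite -(I_flux Cphi phi0 CV4 CUV).
  have Ca' := CaV _ (CU4 i).
  have C1 : Ck 1 (fun x => phi x * U i x * \sum_j pd j (fun y => V i y * V j y) x) by ck.
  have C2 : Ck 1 (fun x => phi x * V i x * along V (U i) x) by ck.
  have C3 j : Ck 1 (fun x => phi x * V j x * pd j (fun x => U i x * V i x) x) by ck.
  have C4 : Ck 1 (fun x => phi x * (U i x * V i x) * \sum_j pd j (V j) x) by ck.
  have C5 : Ck 1 (fun x => \sum_j phi x * V j x * pd j (fun x => U i x * V i x) x) by ck.
  have S1 : I (fun x => \sum_j phi x * V j x * pd j (fun x => U i x * V i x) x) =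
      \sum_j I (fun x => phi x * V j x * pd j (fun x => U i x * V i x) x).
    by apply: (@I_sum _ _ _ _ _ 1) => j _; exact: C3.
  rewrite -S1 -(ID (bdd_Ck C1) (bdd_Ck C2)) -(ID (bdd_Ck C5) (bdd_Ck C4)).
  apply: eq_I => x; rewrite /along !mulr_sumr -!big_split /=; apply: eq_bigr => j _.
  have K1 (k : 'I_3) : Ck 1 (U k) by ck.
  have K2 (k : 'I_3) : Ck 1 (V k) by ck.
  rewrite (partialM j x (K2 i) (K2 j)) (partialM j x (K1 i) (K2 i)).
  by move: (pd j (U i) x) (pd j (V i) x) (pd j (V j) x) => p q r; ring.
have F3s : \sum_i I (fun x => phi x * U i x * \sum_j pd j (fun y => V i y * V j y) x) +
   \sum_i I (fun x => phi x * V i x * along V (U i) x) =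
    - \sum_i I (fun x => U i x * V i x * along V phi x).
  by rewrite -big_split -sumrN; apply: eq_bigr => i _; exact: F3.
exact: balance_total (balance_sum H1) (balance_sum H2) H3 F1 F2 F3s.
Qed.

Lemma tropical_solves ka U V P T : tropical ka U V P T ->
  solves P U (fun i j x => - (U i x * U j x + V i x * V j x)) ka.
Proof.
move=> [[CU CV CP CT] e1 _ _ e4]; split=> [|i|i j||i x]; [by ck|by ck|by ck|exact: e4|].
have K1 (k : 'I_3) : Ck 1 (U k) by ck.
have K2 (k : 'I_3) : Ck 1 (V k) by ck.
have -> : \sum_j pd j (fun x => - (U i x * U j x + V i x * V j x)) x =
    - along U (U i) x - \sum_j pd j (fun y => V i y * V j y) x.
  transitivity (- along U (U i) x - U i x * \sum_j pd j (U j) x -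
    \sum_j pd j (fun y => V i y * V j y) x); last by rewrite e4 mulr0 subr0.
  rewrite /along mulr_sumr -!sumrN -!big_split /=; apply: eq_bigr => j _.
  have KU : Ck 1 (fun x => U i x * U j x) by ck.
  have KV : Ck 1 (fun x => V i x * V j x) by ck.
  have KS : Ck 1 (fun x => U i x * U j x + V i x * V j x) by ck.
  rewrite (partialN j x KS) (partialD j x KU KV) (partialM j x (K1 i) (K1 j)).
  by move: (pd j (U i) x) (pd j (U j) x) (pd j _ x) => p q r; ring.
have := e1 i x; move: (lap _ _) (along _ _ _) (pd _ _ _) (\sum_j _) => p q r s h.
by apply/eqP; rewrite -subr_eq0 -h; apply/eqP; ring.
Qed.

Lemma I_shell_bound g h (m c : R) : 0 <= m * c ->
  (forall x, 1 / 2 <= `|x| <= 2 -> `|g x| <= m) ->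
  (forall x, 1 / 2 <= `|x| <= 2 -> `|h x| <= c) ->
  (forall x, ~~ (1 / 2 <= `|x| <= 2) -> h x = 0) ->
  `|I (fun x => g x * h x)| <= 8 ^+ 3 * (m * c).
Proof.
move=> mc gm hc h0; apply: I_bound => x _; rewrite normrM.
have [xs|xs] := boolP (1 / 2 <= `|x| <= 2); last by rewrite h0// normr0 mulr0.
by apply: ler_pM => //; [exact: gm|exact: hc].
Qed.

Lemma sqr_norm_le (a b : R) : `|a| <= b -> `|a ^+ 2| <= b ^+ 2.
Proof.
move=> ab; rewrite normrX; apply: lerXn2r => //.
by rewrite nnegrE (le_trans _ ab).
Qed.

Lemma sum3_le (F : 'I_3 -> R) (b : R) : (forall i, `|F i| <= b) -> \sum_i F i <= 3 * b.
Proof.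
move=> Fb; apply: (@le_trans _ _ (\sum_(i < 3) b)).
  by apply: ler_sum => i _; apply: le_trans (ler_norm _) (Fb i).
by rewrite sumr_const card_ord mulr_natl.
Qed.

Lemma energy_arith (ka a b t c D q s1 s2 s3 s4 s5 s6 s7 s8 s9 : R) :
  0 < ka -> 0 < a -> 0 < b -> 0 < t -> 0 < c -> 0 < D -> 0 < q ->
  s1 <= 3 * (q * c * a ^+ 2) -> s2 <= 3 * (q * c * b ^+ 2) -> s3 <= q * c * (12 * t) ^+ 2 ->
  s4 <= 3 * (q * (a ^+ 2 * (3 * a * c))) -> s5 <= 3 * (q * (b ^+ 2 * (3 * a * c))) ->
  s6 <= q * ((12 * t) ^+ 2 * (3 * a * c)) ->
  s7 <= D * ((a ^+ 2 + b ^+ 2 + ka * a) * (3 * a * c)) ->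
  s8 <= q * (12 * t * (3 * b * c)) -> s9 <= 3 * (q * (a * b * (3 * b * c))) ->
  ka * 2^-1 * (s1 + s2 + s3) + 2^-1 * (s4 + s5 + s6) + s7 + s8 + s9 <=
  (216 * (q * c) + 3 * c * D) *
    (ka * (a ^+ 2 + b ^+ 2 + t ^+ 2) + a * (a ^+ 2 + b ^+ 2 + t ^+ 2) + b * t).
Proof.
move=> ka0 a0 b0 t0 c0 D0 q0 h1 h2 h3 h4 h5 h6 h7 h8 h9.
have h123 : ka * 2^-1 * (s1 + s2 + s3) <=
    ka * 2^-1 * (3 * (q * c * a ^+ 2) + 3 * (q * c * b ^+ 2) + q * c * (12 * t) ^+ 2).
  by apply: ler_wpM2l; [rewrite mulr_ge0// ltW|exact: lerD (lerD h1 h2) h3].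
pose Q := q * c; pose K := c * D.
have Q0 : 0 <= Q by rewrite mulr_ge0// ltW.
have K0 : 0 <= K by rewrite mulr_ge0// ltW.
have pos X : 0 <= X -> 0 <= Q * X /\ 0 <= K * X by move=> X0; split; exact: mulr_ge0.
have [x1 y1] : 0 <= Q * (ka * a ^+ 2) /\ 0 <= K * (ka * a ^+ 2).
  by apply: pos; rewrite mulr_ge0 ?sqr_ge0// ltW.
have [x2 y2] : 0 <= Q * (ka * b ^+ 2) /\ 0 <= K * (ka * b ^+ 2).
  by apply: pos; rewrite mulr_ge0 ?sqr_ge0// ltW.
have [x3 y3] : 0 <= Q * (ka * t ^+ 2) /\ 0 <= K * (ka * t ^+ 2).
  by apply: pos; rewrite mulr_ge0 ?sqr_ge0// ltW.
have [x4 y4] : 0 <= Q * (a * a ^+ 2) /\ 0 <= K * (a * a ^+ 2).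
  by apply: pos; rewrite mulr_ge0 ?sqr_ge0// ltW.
have [x5 y5] : 0 <= Q * (a * b ^+ 2) /\ 0 <= K * (a * b ^+ 2).
  by apply: pos; rewrite mulr_ge0 ?sqr_ge0// ltW.
have [x6 y6] : 0 <= Q * (a * t ^+ 2) /\ 0 <= K * (a * t ^+ 2).
  by apply: pos; rewrite mulr_ge0 ?sqr_ge0// ltW.
have [x7 y7] : 0 <= Q * (b * t) /\ 0 <= K * (b * t).
  by apply: pos; rewrite mulr_ge0// ltW.
move: x1 x2 x3 x4 x5 x6 x7 y1 y2 y3 y4 y5 y6 y7 h123 h4 h5 h6 h7 h8 h9.
rewrite /Q /K; clear; lra.
Qed.

(** In [energy_identity] all terms on the right carry a derivative of phi and live
in the shell. With c the value of T at [corner], the oscillation of T there is at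
most 12 mT by [shell_path]. For the pressure term, U . grad phi is the divergence
of phi U, as [pressure_bound] requires. *)
Lemma energy_bound : exists (phi : E -> R) (C : R),
  [/\ 0 < C, Ck 5 phi, forall x, 0 <= phi x, forall x, sqnorm x <= 1 -> phi x = 1 &
  forall ka U V P T (mU mV mT : R), tropical ka U V P T ->
   0 < ka -> 0 < mU -> 0 < mV -> 0 < mT ->
   (forall i x, 1 / 4 <= `|x| <= 9 / 4 -> `|U i x| <= mU) ->
   (forall i x, 1 / 4 <= `|x| <= 9 / 4 -> `|V i x| <= mV) ->
   (forall i x, 1 / 2 <= `|x| <= 2 -> `|pd i T x| <= mT) ->
   ka * (\sum_i I (fun x => phi x * gradsq (U i) x) + \sum_i I (fun x => phi x * gradsq (V i) x)
        + I (fun x => phi x * gradsq T x)) <=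
   C * (ka * (mU ^+ 2 + mV ^+ 2 + mT ^+ 2) + mU * (mU ^+ 2 + mV ^+ 2 + mT ^+ 2) + mV * mT)].
Proof.
have [||phi [Cphi phi01 phi1 phi4]] := @cutoff_exists R 5 1 4; [by []|by rewrite ltr1n|].
have [D D0 press] := @pressure_bound R.
have phi2 : vanish 2 phi.
  move=> x x2; apply: phi4; apply: le_trans (norm_le_sqnorm x).
  have -> : 4 = 2 ^+ 2 :> R by ring.
  by apply: lerXn2r; rewrite ?nnegrE// ltW.
have phi3 : vanish 3 phi by apply: vanish_le phi2; rewrite ler_nat.
have ball1 (x : E) : `|x| < 1 / 2 -> sqnorm x <= 1.
  move=> x2; apply: le_trans (sqnorm_le x) _.
  have : `|x| ^+ 2 <= (1 / 2) ^+ 2 :> R.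
    by apply: lerXn2r; [rewrite nnegrE|rewrite nnegrE; clear; lra|exact: ltW].
  by clear; lra.
have open_ball : open [set y : E | `|y| < 1 / 2].
  apply: (@open_comp _ _ (fun y : E => `|y|) [set t | t < 1 / 2]); last exact: open_lt.
  by move=> y _; exact: norm_continuous.
have dphi j x : ~~ (1 / 2 <= `|x| <= 2) -> pd j phi x = 0.
  rewrite negb_and -!ltNge => /orP[x2|x2]; last exact: vanish_partial x2.
  by apply: (@partial_open_cst _ [set y | `|y| < 1 / 2] _ 1) => // y /= /ball1; exact: phi1.
have ddphi j x : ~~ (1 / 2 <= `|x| <= 2) -> pd j (pd j phi) x = 0.
  rewrite negb_and -!ltNge => /orP[x2|x2]; last by apply/vanish_partial/vanish_partial: x2.
  apply: (@partial_open_cst _ [set y | `|y| < 1 / 2] _ 0) => // y /= y2.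
  by apply: dphi; rewrite negb_and -!ltNge y2.
have lphi x : ~~ (1 / 2 <= `|x| <= 2) -> lap phi x = 0.
  by move=> xs; apply: big1 => j _; exact: ddphi.
have [|c1 c10 hc1] := @uniform_bound R (fun j => pd j phi).
  move=> j; apply: (@vanish_bounded _ _ 2); last exact: vanish_partial.
  exact: (Ck_continuous (Ck_partial Cphi j)).
have v2 : vanish 2 (lap phi).
  by move=> x x2; apply: lphi; rewrite negb_and -!ltNge x2 orbT.
have Cl : Ck 3 (lap phi) by ck.
have [c2 c20 hc2] := vanish_bounded (Ck_continuous Cl) v2.
pose c := c1 + c2; have c0 : 0 < c by exact: addr_gt0.
have b1 j x : `|pd j phi x| <= c by rewrite (le_trans (hc1 j x))// lerDl ltW.
have b2 x : `|lap phi x| <= c by rewrite (le_trans (hc2 x))// lerDr ltW.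
pose Q : R := 8 ^+ 3 * c; have Q0 : 0 < Q by rewrite mulr_gt0// exprn_gt0.
exists phi, (216 * Q + 3 * c * D); split.
- apply: addr_gt0; last by apply: mulr_gt0 => //; exact: mulr_gt0.
  by apply: mulr_gt0 => //; rewrite ltr0n.
- exact: Cphi.
- by move=> x; have /andP[] := phi01 x.
- exact: phi1.
move=> ka U V P T mU mV mT trop ka0 mU0 mV0 mT0 hU hV hT.
have [[CU CV CP CT] _ _ _ e4] := trop.
have wide (x : E) : 1 / 2 <= `|x| <= 2 -> 1 / 4 <= `|x| <= 9 / 4.
  by move=> /andP[x1 x2]; apply/andP; split; clear -x1 x2; lra.
have hU' i x : 1 / 2 <= `|x| <= 2 -> `|U i x| <= mU by move/wide; exact: hU.
have hV' i x : 1 / 2 <= `|x| <= 2 -> `|V i x| <= mV by move/wide; exact: hV.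
have hS x : 1 / 2 <= `|x| <= 2 -> `|T x - T corner| <= 12 * mT.
  by apply: shell_path => //; [move=> i y; apply: (@Ck_derivable _ 4); ck|exact: ltW].
have al0 W x : ~~ (1 / 2 <= `|x| <= 2) -> along W phi x = 0.
  by move=> xs; apply: big1 => j _; rewrite dphi ?mulr0.
have al W (m : R) : 0 < m -> (forall i x, 1 / 2 <= `|x| <= 2 -> `|W i x| <= m) ->
    forall x, 1 / 2 <= `|x| <= 2 -> `|along W phi x| <= 3 * m * c.
  move=> m0 Wm x xs; apply: le_trans (ler_norm_sum _ _ _) _; rewrite -mulrA.
  apply: sum3_le => i; rewrite normr_id normrM; apply: ler_pM => //; exact: Wm.
rewrite (energy_identity (T corner) Cphi phi3 trop).
have T1 i : `|I (fun x => U i x ^+ 2 * lap phi x)| <= Q * mU ^+ 2.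
  rewrite /Q -mulrA [c * _]mulrC; apply: I_shell_bound => //.
  - by rewrite mulr_ge0 ?exprn_ge0 ?ltW.
  - by move=> x /(hU' i) /sqr_norm_le.
have T2 i : `|I (fun x => V i x ^+ 2 * lap phi x)| <= Q * mV ^+ 2.
  rewrite /Q -mulrA [c * _]mulrC; apply: I_shell_bound => //.
  - by rewrite mulr_ge0 ?exprn_ge0 ?ltW.
  - by move=> x /(hV' i) /sqr_norm_le.
have T3 : `|I (fun x => (T x - T corner) ^+ 2 * lap phi x)| <= Q * (12 * mT) ^+ 2.
  rewrite /Q -mulrA [c * _]mulrC; apply: I_shell_bound => //.
  - by rewrite mulr_ge0 ?exprn_ge0 ?mulr_ge0 ?ltW.
  - by move=> x /hS /sqr_norm_le.
have c3 : 0 <= 3 * mU * c by rewrite mulr_ge0 ?mulr_ge0 ?ltW.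
have c3V : 0 <= 3 * mV * c by rewrite mulr_ge0 ?mulr_ge0 ?ltW.
have T4 i : `|I (fun x => U i x ^+ 2 * along U phi x)| <= 8 ^+ 3 * (mU ^+ 2 * (3 * mU * c)).
  apply: I_shell_bound; [exact: mulr_ge0 (sqr_ge0 _) c3| |exact: al|exact: al0].
  by move=> x /(hU' i) /sqr_norm_le.
have T5 i : `|I (fun x => V i x ^+ 2 * along U phi x)| <= 8 ^+ 3 * (mV ^+ 2 * (3 * mU * c)).
  apply: I_shell_bound; [exact: mulr_ge0 (sqr_ge0 _) c3| |exact: al|exact: al0].
  by move=> x /(hV' i) /sqr_norm_le.
have T6 : `|I (fun x => (T x - T corner) ^+ 2 * along U phi x)| <=
    8 ^+ 3 * ((12 * mT) ^+ 2 * (3 * mU * c)).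
  apply: I_shell_bound; [exact: mulr_ge0 (sqr_ge0 _) c3| |exact: al|exact: al0].
  by move=> x /hS /sqr_norm_le.
have T7 : `|I (fun x => (T x - T corner) * along V phi x)| <= 8 ^+ 3 * (12 * mT * (3 * mV * c)).
  have t12 : 0 <= 12 * mT by rewrite mulr_ge0// ltW.
  by apply: I_shell_bound; [exact: mulr_ge0 t12 c3V|exact: hS|exact: al|exact: al0].
have T8 i : `|I (fun x => U i x * V i x * along V phi x)| <= 8 ^+ 3 * (mU * mV * (3 * mV * c)).
  have ab : 0 <= mU * mV by rewrite mulr_ge0// ltW.
  apply: I_shell_bound; [exact: mulr_ge0 ab c3V| |exact: al|exact: al0].
  by move=> x xs; rewrite normrM; apply: ler_pM => //; [exact: hU'|exact: hV'].
pose M := mU ^+ 2 + mV ^+ 2 + ka * mU.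
have M0 : 0 < M by rewrite !addr_gt0 ?exprn_gt0// mulr_gt0.
have T9 : `|I (fun x => P x * along U phi x)| <= D * (M * (3 * mU * c)).
  have CX j : Ck 2 (fun x => phi x * U j x) by ck.
  have mu0 : 0 < 3 * mU * c by apply: mulr_gt0 => //; exact: mulr_gt0.
  apply: (press P U (fun i j x => - (U i x * U j x + V i x * V j x)) ka M _ _
    (fun j x => phi x * U j x) (tropical_solves trop) M0 mu0).
  - move=> i j x xs; rewrite normrN; apply: le_trans (ler_normD _ _) _.
    rewrite !normrM /M -[leLHS]addr0; apply: lerD; last by rewrite mulr_ge0 ?ltW.
    by apply: lerD; rewrite expr2; apply: ler_pM => //; do ?[exact: hU|exact: hV].
  - move=> i x xs; rewrite normrM (gtr0_norm ka0) /M -[leLHS]add0r.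
    apply: lerD; first by rewrite addr_ge0 ?exprn_ge0 ?ltW.
    by apply: ler_wpM2l; [exact: ltW|exact: hU].
  - by rewrite /along; ck.
  - exact: al0.
  - move=> x; have [xs|xs] := boolP (1 / 2 <= `|x| <= 2); first exact: al.
    by rewrite al0// normr0.
  - exact: CX.
  - by move=> j; apply: vanishMl.
  - move=> x; transitivity (along U phi x + phi x * \sum_j pd j (U j) x).
      by rewrite e4 mulr0 addr0.
    rewrite /along mulr_sumr -big_split /=.
    apply: eq_bigr => j _; have K1 : Ck 1 phi by ck.
    have K2 : Ck 1 (U j) by ck.
    by rewrite (partialM j x K1 K2); move: (pd j phi x) (pd j (U j) x) => p q; ring.
have S1 := sum3_le T1; have S2 := sum3_le T2; have S4 := sum3_le T4.
have S5 := sum3_le T5; have S8 := sum3_le T8.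
have {}T3 := le_trans (ler_norm _) T3; have {}T6 := le_trans (ler_norm _) T6.
have {}T7 := le_trans (ler_norm _) T7; have {}T9 := le_trans (ler_norm _) T9.
have q0 : 0 < 8 ^+ 3 :> R by rewrite exprn_gt0.
exact: energy_arith ka0 mU0 mV0 mT0 c0 D0 q0 S1 S2 T3 S4 S5 T6 T9 T7 S8.
Qed.

End Energy.

(** * Components of the vector equations *)

#[local] Transparent pd lap.

Section Components.
Context {R : realType}.
Local Notation E := 'rV[R]_3.
Implicit Types (u v w : E -> E) (i j : 'I_3).

Lemma partial_coordinate u i j x : (forall k z, derivable u z (delta_mx 0 k)) ->
  partial j u x 0 i = pd j (fun y => u y 0 i) x.
Proof. by move=> du; rewrite /partial derive_mx// mxE. Qed.

Lemma smooth_partial u j : smooth u -> smooth (partial j u).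
Proof. by move=> su s; have := su (rcons s j); rewrite foldr_rcons. Qed.

Lemma smooth_derivable u : smooth u -> forall k z, derivable u z (delta_mx 0 k).
Proof. by move=> su; exact: (su [::]).2. Qed.

Lemma smooth_coordinate k u i : smooth u -> Ck k (fun x => u x 0 i).
Proof.
elim: k u => [|k ih] u su.
  apply: Ck0 => x; apply: (@continuous_comp _ _ _ u (fun M : E => M 0 i)).
    exact: (su [::]).1.
  exact: coord_continuous.
have cu : Ck 0 (fun x => u x 0 i).
  apply: Ck0 => x; apply: (@continuous_comp _ _ _ u (fun M : E => M 0 i)).
    exact: (su [::]).1.
  exact: coord_continuous.
apply: CkS; first exact: Ck_continuous cu.
  by move=> j x; move: su => /smooth_derivable/(_ j x)/derivable_mxP.
move=> j; have -> : pd j (fun x => u x 0 i) = fun x => partial j u x 0 i.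
  by apply/funext => x; rewrite partial_coordinate//; exact: smooth_derivable.
exact/ih/smooth_partial.
Qed.

Lemma laplacian_coordinate u i x : smooth u ->
  laplacian u x 0 i = lap (fun y => u y 0 i) x.
Proof.
move=> su; rewrite /laplacian /lap summxE; apply: eq_bigr => j _.
rewrite partial_coordinate; last exact/smooth_derivable/smooth_partial.
congr (pd j _ x); apply/funext => y.
by rewrite partial_coordinate//; exact: smooth_derivable.
Qed.

Lemma advection_coordinate w u i x : smooth u ->
  advection w u x 0 i = along (fun j y => w y 0 j) (fun y => u y 0 i) x.
Proof.
move=> su; rewrite /advection /along summxE; apply: eq_bigr => j _.
by rewrite mxE partial_coordinate//; exact: smooth_derivable.
Qed.

Lemma tdiv_coordinate v i x :
  tdiv (tensor v v) x 0 i = \sum_j pd j (fun y => v y 0 i * v y 0 j) x.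
Proof.
rewrite mxE /div; apply: eq_bigr => j _; congr (partial j _ x).
by apply/funext => y; rewrite !mxE big_ord1 !mxE.
Qed.

Lemma solution_tropical u p v theta : smooth_tropical_climate_solution u p v theta ->
  tropical 1 (fun i x => u x 0 i) (fun i x => v x 0 i) p theta.
Proof.
move=> [[su sp sv st] eqs]; split.
- split; [by move=> i; exact: smooth_coordinate|by move=> i; exact: smooth_coordinate| |].
    exact: smooth_Ck.
  exact: smooth_Ck.
- move=> i x; have [/matrixP/(_ 0 i) + _ _ _] := eqs x.
  rewrite !mxE laplacian_coordinate// advection_coordinate//.
  have := tdiv_coordinate v i x; rewrite mxE => ->.
  by rewrite mul1r.
- move=> i x; have [_ /matrixP/(_ 0 i) + _ _] := eqs x.
  by rewrite !mxE laplacian_coordinate// !advection_coordinate// mul1r.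
- by move=> x; have [_ _ + _] := eqs x; rewrite mul1r.
- by move=> x; have [_ _ _ +] := eqs x.
Qed.

End Components.

(** * Rescaling *)

#[local] Opaque pd.

Section Rescaling.
Context {R : realType}.
Local Notation E := 'rV[R]_3.
Implicit Types (f : E -> R) (x : E) (i j : 'I_3).

Definition dilate (r : R) f x : R := f (r *: x + 0).

Lemma pd_dilate k r f i : Ck k.+1 f -> pd i (dilate r f) = fun x => r * dilate r (pd i f) x.
Proof. by move=> Cf; apply/funext => x; exact: partial_dilate Cf. Qed.

Lemma lap_dilate r f x : Ck 2 f -> lap (dilate r f) x = r ^+ 2 * dilate r (lap f) x.
Proof.
move=> Cf; rewrite /lap /dilate mulr_sumr; apply: eq_bigr => i _.
have Cp : Ck 1 (pd i f) by exact: Ck_partial.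
rewrite -/(dilate r f) (pd_dilate _ _ Cf).
have Cd : Ck 1 (dilate r (pd i f)) by exact: Ck_dilate.
rewrite (partialZ r i x Cd) (pd_dilate _ _ Cp) mulrA -expr2.
by [].
Qed.

#[local] Opaque lap.

(** Every term of first order gains a factor r and the Laplacian a factor r^2, which
the viscosity 1 / r brings back to r. *)
Lemma tropical_dilate r (U V : 'I_3 -> E -> R) P T : 0 < r -> tropical 1 U V P T ->
  tropical r^-1 (fun i => dilate r (U i)) (fun i => dilate r (V i)) (dilate r P) (dilate r T).
Proof.
move=> r0 [[CU CV CP CT] e1 e2 e3 e4].
have al (W : 'I_3 -> E -> R) f x : Ck 5 f ->
    along (fun i => dilate r (W i)) (dilate r f) x = r * dilate r (along W f) x.
  move=> Cf; rewrite /along /dilate mulr_sumr; apply: eq_bigr => j _.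
  by rewrite -/(dilate r f) (pd_dilate _ _ Cf) mulrCA.
have la f x : Ck 5 f -> r^-1 * lap (dilate r f) x = r * (1 * dilate r (lap f) x).
  move=> Cf; have C2 : Ck 2 f by ck.
  by rewrite (lap_dilate _ _ C2) mul1r mulrA expr2 mulKf// gt_eqF.
have pa f i x : Ck 5 f -> pd i (dilate r f) x = r * dilate r (pd i f) x.
  by move=> Cf; rewrite (pd_dilate _ _ Cf).
have sm (F : 'I_3 -> E -> R) x : (forall j, Ck 5 (F j)) ->
    \sum_j pd j (dilate r (F j)) x = r * (\sum_j dilate r (pd j (F j)) x).
  move=> CF; apply: etrans (eq_bigr _ (fun j _ => pa (F j) j x (CF j))) _.
  by rewrite mulr_sumr.
split.
- have Cd f : Ck 5 f -> Ck 5 (dilate r f) by move=> Cf; exact: (Ck_dilate r 0 Cf).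
  by split=> [i|i||]; apply: Cd; [exact: CU|exact: CV|exact: CP|exact: CT].
- move=> i x.
  have CVV j : Ck 5 (fun y => V i y * V j y) by ck.
  rewrite (la _ x (CU i)) (al U _ x (CU i)) (pa _ i x CP).
  rewrite (sm (fun j y => V i y * V j y) x CVV) -mulrN -!mulrDr.
  by apply: etrans (congr1 ( *%R r) (e1 i (r *: x + 0))) _; rewrite mulr0.
- move=> i x.
  rewrite (la _ x (CV i)) (al U _ x (CV i)) (al V _ x (CU i)) (pa _ i x CT) -mulrN -!mulrDr.
  by apply: etrans (congr1 ( *%R r) (e2 i (r *: x + 0))) _; rewrite mulr0.
- move=> x; rewrite (la _ x CT) (al U _ x CT) (sm V x CV) -mulrN -!mulrDr.
  by apply: etrans (congr1 ( *%R r) (e3 (r *: x + 0))) _; rewrite mulr0.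
- move=> x; rewrite (sm U x CU).
  by apply: etrans (congr1 ( *%R r) (e4 (r *: x + 0))) _; rewrite mulr0.
Qed.

End Rescaling.

(** * Decay rates *)

Section Decay.
Context {R : realType}.
Local Notation E := 'rV[R]_3.
Implicit Types (f : E -> E) (x : E) (k : nat).

(** Decay of order |x|^(-k/3). Measuring the distance as q^(-3) leaves only integer
powers of q. *)
Definition rate f k (A : R) := exists2 q0 : R, 0 < q0 &
  forall q, 0 < q < q0 -> forall x, q ^- 3 <= enorm x -> enorm (f x) <= A * q ^+ k.

Lemma powR_rate (q s : R) k : 0 < q -> q ^- 3 <= s -> s `^ (- (k%:R / 3)) <= q ^+ k.
Proof.
move=> q0 qs.
have p0 : 0 < q ^- 3 by rewrite invr_gt0 exprn_gt0.
have s0 : 0 < s := lt_le_trans p0 qs.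
rewrite powRN invf_ple ?posrE ?powR_gt0 ?exprn_gt0//.
have -> : q ^- k = (q ^- 3) `^ (k%:R / 3).
  have i0 : 0 <= q^-1 by rewrite invr_ge0 ltW.
  rewrite -!exprVn -(powR_mulrn 3 i0) -powRrM mulrCA divff ?mulr1 ?powR_mulrn//.
by apply: ge0_ler_powR => //; rewrite ?nnegrE ?ltW// divr_ge0.
Qed.

Lemma enorm_ge0 x : 0 <= enorm x.
Proof. exact: sqrtr_ge0. Qed.

Lemma rate_near f k A : 0 <= A ->
  (\forall x \near at_infinity, `|enorm (f x)| <= A * `|enorm x `^ (- (k%:R / 3))|) ->
  rate f k A.
Proof.
move=> A0 [r _ h].
have r1 : 0 < `|r| + 1 by rewrite ltr_wpDl.
(* For q below this bound, which is at most 1, q^(-3) >= q^(-1) > |r| + 1. *)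
exists (`|r| + 1)^-1; first by rewrite invr_gt0.
move=> q /andP[q0 qr] x qx.
have q1 : q <= 1.
  by apply: ltW (lt_le_trans qr _); rewrite invf_le1// ler_wpDl.
have rx : r < enorm x.
  apply: lt_le_trans qx; apply: le_lt_trans (ler_norm r) _.
  apply: (@lt_le_trans _ _ (`|r| + 1)); first by rewrite ltrDl.
  rewrite -[leLHS]invrK lef_pV2 ?posrE ?invr_gt0 ?exprn_gt0//.
  apply: le_trans _ (ltW qr); rewrite exprS ger_pMr//.
  by rewrite exprn_ile1// ltW.
have := h x rx; rewrite /= ger0_norm ?enorm_ge0// ger0_norm ?powR_ge0// => /le_trans; apply.
by apply: ler_wpM2l => //; exact: powR_rate.
Qed.

Lemma littleo_rate f k A : 0 < A -> littleo_at_infinity f (- (k%:R / 3)) -> rate f k A.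
Proof. by move=> A0 /eqoP/(_ _ A0)/rate_near; apply; exact: ltW. Qed.

Lemma bigO_rate f k : bigO_at_infinity f (- (k%:R / 3)) -> exists2 A, 0 < A & rate f k A.
Proof.
move=> /eqO_exP[A A0] /rate_near h.
by exists A => //; apply: h; exact: ltW.
Qed.

End Decay.

(** * Vanishing of the gradients *)

Section Liouville.
Context {R : realType}.
Local Notation E := 'rV[R]_3.
Implicit Types (f phi : E -> R) (x : E) (i j : 'I_3) (q : R).

Definition cutoff phi := [/\ Ck 5 phi, forall x, 0 <= phi x &
  forall x, sqnorm x <= 1 -> phi x = 1].

Definition dissipation phi (U V : 'I_3 -> E -> R) T : R :=
  \sum_i I (fun x => phi x * gradsq (U i) x) + \sum_i I (fun x => phi x * gradsq (V i) x) +
  I (fun x => phi x * gradsq T x).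

Lemma Ck_gradsq k f : Ck k.+1 f -> Ck k (gradsq f).
Proof. by move=> Cf; apply: Ck_sum => j _; apply: CkX; exact: Ck_partial. Qed.

Lemma gradsq_ge0 f x : 0 <= gradsq f x.
Proof. by apply: sumr_ge0 => j _; exact: sqr_ge0. Qed.

Lemma bdd_cutoff_gradsq phi f : cutoff phi -> Ck 3 f -> bdd (fun x => phi x * gradsq f x).
Proof.
move=> [Cp _ _] Cf; have Cg := Ck_gradsq Cf.
by apply: (@bdd_Ck _ 2); ck.
Qed.

Lemma cutoff_gradsq_ge0 phi f : cutoff phi -> Ck 3 f -> 0 <= I (fun x => phi x * gradsq f x).
Proof.
move=> cp Cf; rewrite -(@I0 R); apply: I_le.
- by apply: (@bdd_Ck _ 0); apply: Ck_cst.
- exact: bdd_cutoff_gradsq.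
- by move=> x _; case: cp => _ p0 _; rewrite mulr_ge0// gradsq_ge0.
Qed.

Lemma gradsq_dilate r f x : Ck 1 f -> gradsq (dilate r f) x = r ^+ 2 * dilate r (gradsq f) x.
Proof.
move=> Cf; rewrite /gradsq {2}/dilate mulr_sumr; apply: eq_bigr => j _.
by rewrite (pd_dilate _ _ Cf) exprMn.
Qed.

(** Near a point where a derivative is nonzero, [gradsq f] is at least some constant
on a ball. Rescaling multiplies it by r^2 and the volume of the ball by r^(-3);
for large r the rescaled ball lies where the cutoff is 1. *)
Lemma dissipation_lower phi f x j : cutoff phi -> Ck 3 f -> pd j f x != 0 ->
  exists2 c : R, 0 < c & exists2 r0 : R, 0 < r0 & forall r, r0 <= r ->
    c / r <= I (fun y => phi y * gradsq (dilate r f) y).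
Proof.
move=> cp Cf nz; have Cg := Ck_gradsq Cf.
have g0 : 0 < gradsq f x.
  rewrite /gradsq (bigD1 j)//= ltr_pwDl ?exprn_even_gt0//.
  by apply: sumr_ge0 => i _; exact: sqr_ge0.
pose c := gradsq f x / 2; have c0 : 0 < c by rewrite divr_gt0.
have : \forall y \near x, c < gradsq f y.
  have cg := Ck_continuous Cg; have := cg x; move=> /cvgr_gt; apply.
  by rewrite /c ltr_pdivrMr// ltr_pMr// ltr1n.
move=> /nbhs_ballP[e /= e0 he]; pose d := e / 2.
have d0 : 0 < d by rewrite divr_gt0.
have {}he y : `|y - x| <= d -> c <= gradsq f y.
  move=> yd; apply/ltW/he; rewrite -ball_normE /= distrC; apply: le_lt_trans yd _.
  by rewrite /d ltr_pdivrMr// ltr_pMr// ltr1n.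
exists (c * (d / 2) ^+ 3); first by rewrite mulr_gt0// exprn_gt0// divr_gt0.
exists (2 * (`|x| + d)); first by rewrite mulr_gt0// ltr_wpDl.
move=> r rr; have r0 : 0 < r by apply: lt_le_trans rr; rewrite mulr_gt0// ltr_wpDl.
have near y : `|y - r^-1 *: x| <= d / r -> `|r *: y - x| <= d.
  have -> : r *: y - x = r *: (y - r^-1 *: x).
    by rewrite scalerBr scalerA divff ?scale1r// gt_eqF.
  by rewrite normrZ (gtr0_norm r0) ler_pdivlMr// mulrC.
have half : (`|x| + d) / r <= 1 / 2.
  by rewrite ler_pdivrMr// mulrC mulrA mulr1 ler_pdivlMr// mulrC.
have -> : c * (d / 2) ^+ 3 / r = r ^+ 2 * c * (d / r / 2) ^+ 3.
  by field; rewrite gt_eqF.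
have Cd : Ck 3 (dilate r f) by exact: (Ck_dilate r 0 Cf).
apply: (@I_lower _ _ (r^-1 *: x)).
- exact: bdd_cutoff_gradsq.
- by rewrite divr_gt0.
- by rewrite mulr_ge0 ?exprn_ge0 ?ltW.
- by move=> y; case: cp => _ p0 _; rewrite mulr_ge0// gradsq_ge0.
- rewrite normrZ gtr0_norm ?invr_gt0// [r^-1 * _]mulrC -mulrDl.
  by apply: le_trans half _; lra.
- move=> y yd; case: cp => _ _ ->.
    rewrite mul1r gradsq_dilate; last by ck.
    apply: ler_wpM2l; first by rewrite exprn_ge0// ltW.
    by apply: he; rewrite addr0; exact: near.
  apply: le_trans (sqnorm_le _) _.
  have y2 : `|y| <= 1 / 2.
    rewrite -[y](subrK (r^-1 *: x)); apply: le_trans (ler_normD _ _) _.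
    apply: le_trans half; rewrite mulrDl addrC; apply: lerD => //.
    by rewrite normrZ gtr0_norm ?invr_gt0// mulrC.
  have : `|y| ^+ 2 <= (1 / 2) ^+ 2 by apply: lerXn2r => //; rewrite ?nnegrE.
  by move: (`|y| ^+ 2) => t; lra.
Qed.

(** The scales at which the energy bound is applied are q^(-3). Each of mV and mT is
merely of order q^2, so that all the gain has to come from mU and from the product
mV mT; the first term of the energy bound gains a power of q from the viscosity. *)
Definition decaying (U V : 'I_3 -> E -> R) T := exists2 M : R, 0 < M &
  forall eps : R, 0 < eps -> exists2 q0 : R, 0 < q0 & forall q, 0 < q < q0 ->
  exists m : R * R * R, let: (mU, mV, mT) := m in
  [/\ 0 < mU <= eps * q ^+ 2, 0 < mV <= M * q ^+ 2, 0 < mT <= M * q ^+ 2,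
      mV * mT <= eps * q ^+ 6 &
      forall i x, q ^- 3 <= `|x| ->
      [/\ `|U i x| <= mU, `|V i x| <= mV & q ^- 3 * `|pd i T x| <= mT]].

(** Each of the three terms of the energy bound is at most a constant times
eps q^6: the viscous one because q < eps. *)
Lemma decay_arith (C M eps c q mU mV mT S : R) (K := 1 + M ^+ 2 + (4 * M) ^+ 2) :
  0 < C -> 0 < eps <= 1 -> eps * (32 * C * (K + 4)) <= c -> 0 < q < eps ->
  0 < mU <= eps * q ^+ 2 -> 0 < mV <= M * q ^+ 2 -> 0 < mT <= M * q ^+ 2 ->
  mV * mT <= eps * q ^+ 6 ->
  q ^+ 3 / 4 * S <= C * (q ^+ 3 / 4 * (mU ^+ 2 + mV ^+ 2 + (4 * mT) ^+ 2) +
    mU * (mU ^+ 2 + mV ^+ 2 + (4 * mT) ^+ 2) + mV * (4 * mT)) ->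
  S < c * (q ^+ 3 / 4).
Proof.
move=> C0 /andP[e0 e1] ec /andP[q0 qe] /andP[U0 hU] /andP[V0 hV] /andP[T0 hT] hVT.
have q3 : 0 < q ^+ 3 by rewrite exprn_gt0.
have q6 : 0 < q ^+ 6 by rewrite exprn_gt0.
have K0 : 0 < K by rewrite /K !ltr_wpDr ?sqr_ge0.
set Q := mU ^+ 2 + mV ^+ 2 + (4 * mT) ^+ 2.
have Q0 : 0 <= Q by rewrite /Q !addr_ge0 ?sqr_ge0.
have sq (a b : R) : 0 < a -> a <= b * q ^+ 2 -> a ^+ 2 <= b ^+ 2 * q ^+ 4.
  move=> a0 ab; have -> : b ^+ 2 * q ^+ 4 = (b * q ^+ 2) ^+ 2 by ring.
  by rewrite lerXn2r// nnegrE ltW// (lt_le_trans a0).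
have hQ : Q <= K * q ^+ 4.
  rewrite /K [leRHS]mulrDl [in leRHS]mulrDl; apply: lerD; first apply: lerD.
  - rewrite -(expr1n R 2); apply: sq => //; apply: le_trans hU _.
    by apply: ler_wpM2r => //; exact: sqr_ge0.
  - exact: sq.
  - apply: sq; first by rewrite mulr_gt0.
    by rewrite -mulrA ler_pM2l.
have h1 : q ^+ 3 / 4 * Q <= eps * K * q ^+ 6.
  apply: (@le_trans _ _ (q ^+ 3 / 4 * (K * q ^+ 4))); first by rewrite ler_wpM2l// divr_ge0// ltW.
  have -> : q ^+ 3 / 4 * (K * q ^+ 4) = (q / 4) * (K * q ^+ 6) by ring.
  rewrite -[leRHS]mulrA; apply: ler_wpM2r; first by rewrite mulr_ge0// ltW.
  by clear -q0 qe; lra.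
have h2 : mU * Q <= eps * K * q ^+ 6.
  have -> : eps * K * q ^+ 6 = eps * q ^+ 2 * (K * q ^+ 4) by ring.
  by apply: ler_pM => //; exact: ltW.
have h3 : mV * (4 * mT) <= 4 * eps * q ^+ 6 by rewrite mulrCA -mulrA ler_pM2l.
move=> bd.
have {bd} bd : q ^+ 3 / 4 * S <= C * ((2 * K + 4) * eps * q ^+ 6).
  apply: le_trans bd _; rewrite ler_pM2l//.
  have -> : (2 * K + 4) * eps * q ^+ 6 = eps * K * q ^+ 6 + eps * K * q ^+ 6 + 4 * eps * q ^+ 6.
    by ring.
  by apply: lerD => //; exact: lerD.
rewrite -(ltr_pM2l q3).
have {bd} bd : q ^+ 3 * S <= 4 * C * ((2 * K + 4) * eps * q ^+ 6) by clear -bd; lra.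
apply: le_lt_trans bd _.
have -> : q ^+ 3 * (c * (q ^+ 3 / 4)) = c / 4 * q ^+ 6 by field.
have -> : 4 * C * ((2 * K + 4) * eps * q ^+ 6) = 4 * C * (2 * K + 4) * eps * q ^+ 6 by ring.
rewrite ltr_pM2r//.
apply: (@lt_le_trans _ _ (eps * (32 * C * (K + 4)) / 4)); last by rewrite ler_pM2r// invr_gt0.
have : 0 < C * eps * K by rewrite !mulr_gt0.
have : 0 < C * eps by rewrite mulr_gt0.
by clear; lra.
Qed.

(** The rescaling factor is 4 q^(-3) because the smallest distance at which the
energy bound looks at the solution is 1 / 4. *)
Lemma dissipation_small U V P T : tropical 1 U V P T -> decaying U V T ->
  exists2 phi, cutoff phi & forall c : R, 0 < c -> exists2 q1 : R, 0 < q1 &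
  forall q r, 0 < q < q1 -> r = 4 * q ^- 3 ->
    dissipation phi (fun i => dilate r (U i)) (fun i => dilate r (V i)) (dilate r T) < c / r.
Proof.
move=> trop [M M0 dec].
have [phi [C [C0 Cp p0 p1 bound]]] := @energy_bound R.
exists phi => // c c0.
pose K := 1 + M ^+ 2 + (4 * M) ^+ 2.
have K0 : 0 < K by rewrite /K !ltr_wpDr ?sqr_ge0.
pose eps := Num.min 1 (c / (32 * C * (K + 4))).
have D0 : 0 < 32 * C * (K + 4) by rewrite !mulr_gt0// addr_gt0.
have e0 : 0 < eps by rewrite lt_min ltr01 divr_gt0.
have e1 : eps <= 1 by rewrite ge_min lexx.
have e2 : eps * (32 * C * (K + 4)) <= c by rewrite -ler_pdivlMr// ge_min lexx orbT.
have [q0 q00 {}dec] := dec eps e0.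
exists (Num.min q0 eps); first by rewrite lt_min q00.
move=> q r /andP[qp qm] rq; have /andP[qq qe] : (q < q0) && (q < eps) by rewrite -lt_min.
have [|[[mU mV] mT] [/andP[mU0 hU] /andP[mV0 hV] /andP[mT0 hT] hVT h]] := dec q.
  by rewrite qp.
have q3 : 0 < q ^+ 3 by rewrite exprn_gt0.
have r0 : 0 < r by rewrite rq mulr_gt0// invr_gt0.
have far x : 1 / 4 <= `|x| -> q ^- 3 <= `|r *: x + 0|.
  rewrite addr0 normrZ (gtr0_norm r0) {1}rq -{1}[q ^- 3]mulr1 [4 * _]mulrC -mulrA.
  by rewrite ler_pM2l ?invr_gt0//; move: `|x| => t; lra.
have [[CU CV CP CT] _ _ _ _] := trop.
have := bound r^-1 _ _ _ _ mU mV (4 * mT) (tropical_dilate r0 trop).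
rewrite invr_gt0 r0 mU0 mV0 mulr_gt0// => /(_ isT isT isT isT).
have uU i x : 1 / 4 <= `|x| <= 9 / 4 -> `|dilate r (U i) x| <= mU.
  by case/andP => /far/(h i)[].
have uV i x : 1 / 4 <= `|x| <= 9 / 4 -> `|dilate r (V i) x| <= mV.
  by case/andP => /far/(h i)[].
have uT i x : 1 / 2 <= `|x| <= 2 -> `|pd i (dilate r T) x| <= 4 * mT.
  case/andP => x2 _; have /far/(h i)[_ _ hx] : 1 / 4 <= `|x| by apply: le_trans x2; lra.
  rewrite (pd_dilate _ _ CT) normrM (gtr0_norm r0) {1}rq -mulrA.
  by apply: ler_wpM2l.
move=> /(_ uU uV uT); rewrite -/(dissipation _ _ _ _).
move: (dissipation _ _ _ _) => S bd.
have rE : r^-1 = q ^+ 3 / 4 by rewrite rq invfM invrK mulrC.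
rewrite rE in bd *.
apply: (@decay_arith C M eps c q mU mV mT S) bd; rewrite ?qp ?mU0 ?mV0 ?mT0 ?e0 ?hU//.
Qed.

Lemma dissipation_ge_component phi (U V : 'I_3 -> E -> R) T (i : 'I_3) : cutoff phi ->
  (forall i, Ck 3 (U i)) -> (forall i, Ck 3 (V i)) -> Ck 3 T ->
  forall f, [\/ f = U i, f = V i | f = T] -> I (fun x => phi x * gradsq f x) <= dissipation phi U V T.
Proof.
move=> cp CU CV CT f.
have IU k := cutoff_gradsq_ge0 cp (CU k); have IV k := cutoff_gradsq_ge0 cp (CV k).
have IT := cutoff_gradsq_ge0 cp CT.
rewrite /dissipation; set a := fun k => I (fun x => phi x * gradsq (U k) x) in IU *.
set b := fun k => I (fun x => phi x * gradsq (V k) x) in IV *.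
have sum_ge (h : 'I_3 -> R) : (forall k, 0 <= h k) -> 0 <= \sum_k h k /\ h i <= \sum_k h k.
  by move=> h0; split; [exact: sumr_ge0|rewrite (bigD1 i)//= lerDl sumr_ge0].
have [a0 ai] := sum_ge a IU; have [b0 bi] := sum_ge b IV.
have first3 (A B c d : R) : 0 <= B -> 0 <= c -> d <= A -> d <= A + B + c.
  by clear; lra.
have mid3 (A B c d : R) : 0 <= A -> 0 <= c -> d <= B -> d <= A + B + c.
  by clear; lra.
have last3 (A B c : R) : 0 <= A -> 0 <= B -> c <= A + B + c.
  by clear; lra.
by case=> ->; [exact: first3 b0 IT ai|exact: mid3 a0 IT bi|exact: last3 a0 b0].
Qed.

(** The dissipation at scale r would be at least c / r by [dissipation_lower] and
less than c / r for large r by [dissipation_small]. *)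
Lemma gradients_vanish U V P T : tropical 1 U V P T -> decaying U V T ->
  forall i j x, [/\ pd j (U i) x = 0, pd j (V i) x = 0 & pd j T x = 0].
Proof.
move=> trop dec i j x.
have [phi cp small] := dissipation_small trop dec.
have [[CU CV _ CT] _ _ _ _] := trop.
have CU3 k : Ck 3 (U k) by ck.
have CV3 k : Ck 3 (V k) by ck.
have CT3 : Ck 3 T by ck.
suff main f : [\/ f = U i, f = V i | f = T] -> pd j f x = 0.
  by split; apply: main; [exact: Or31|exact: Or32|exact: Or33].
move=> fi; apply/eqP/negPn/negP => nz.
have Cf : Ck 3 f by case: fi => ->; [exact: CU3|exact: CV3|exact: CT3].
have [c c0 [r0 r00 lower]] := dissipation_lower cp Cf nz.
have [q1 q10 {}small] := small c c0.
pose q := Num.min (Num.min 1 r0^-1) (q1 / 2).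
have q0 : 0 < q by rewrite !lt_min ltr01 invr_gt0 r00 divr_gt0.
have qq1 : q < q1 by rewrite gt_min ltr_pdivrMr// ltr_pMr// ltr1n orbT.
have qr0 : q <= r0^-1 by rewrite !ge_min lexx orbT.
have q1' : q <= 1 by rewrite !ge_min lexx.
pose r := 4 * q ^- 3.
have := small q r; rewrite q0 qq1 => /(_ isT (erefl _)) sm.
have rr0 : r0 <= r.
  apply: (@le_trans _ _ q^-1); first by rewrite -[r0]invrK lef_pV2 ?posrE ?invr_gt0.
  apply: (@le_trans _ _ (q ^- 3)).
    by rewrite lef_pV2 ?posrE ?exprn_gt0// exprS ger_pMr// exprn_ile1// ltW.
  by rewrite /r ler_peMl ?ler1n// invr_ge0 exprn_ge0// ltW.
have := lower r rr0; apply/negP; rewrite -ltNge; apply: le_lt_trans sm.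
have Cd g : Ck 3 g -> Ck 3 (dilate r g) by move=> Cg; exact: (Ck_dilate r 0 Cg).
apply: (@dissipation_ge_component phi (fun i => dilate r (U i)) (fun i => dilate r (V i))
  (dilate r T) i cp).
- by move=> k; exact: Cd (CU3 k).
- by move=> k; exact: Cd (CV3 k).
- exact: Cd CT3.
- by case: fi => ->; [exact: Or31|exact: Or32|exact: Or33].
Qed.

End Liouville.

(** * The Liouville theorem *)

Section Conclusion.
Context {R : realType}.
Local Notation E := 'rV[R]_3.
Implicit Types (u v : E -> E) (theta f : E -> R) (x : E) (i j : 'I_3) (k l : nat) (q : R).

Lemma coord_le_enorm x i : `|x 0 i| <= enorm x.
Proof.
by rewrite -sqrtr_sqr /enorm ler_wsqrtr// (bigD1 i)//= lerDl sumr_ge0// => j _; exact: sqr_ge0.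
Qed.

Lemma norm_le_enorm x : `|x| <= enorm x.
Proof. by rewrite -[leLHS]ger0_norm// -sqrtr_sqr ler_wsqrtr// norm_le_sqnorm. Qed.

(** Rescaling multiplies grad theta by q^(-3), so a rate l + 3 becomes l; with
k + l = 6 the product of the bounds on v and on the rescaled gradient is of order
q^6, with a factor A B that is as small as desired. Both k and l are at least 2,
so that each bound is of order q^2. *)
Lemma rates_decaying u v theta k l : (2 <= k)%N -> (2 <= l)%N -> (k + l = 6)%N ->
  (forall eps, 0 < eps -> rate u 2 eps) ->
  (exists2 M : R, 0 < M & forall eps : R, 0 < eps -> exists A B : R,
     [/\ 0 < A <= M, 0 < B <= M, A * B <= eps, rate v k A & rate (grad theta) (l + 3) B]) ->
  decaying (fun i x => u x 0 i) (fun i x => v x 0 i) theta.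
Proof.
move=> k2 l2 kl ru [M M0 h]; exists M => // eps e0.
have [A [B [/andP[A0 AM] /andP[B0 BM] AB [q2 q20 rv] [q3 q30 rt]]]] := h eps e0.
have [q1 q10 {}ru] := ru eps e0.
exists (Num.min 1 (Num.min q1 (Num.min q2 q3))); first by rewrite !lt_min ltr01 q10 q20.
move=> q /andP[q0]; rewrite !lt_min => /and4P[ql1 qq1 qq2 qq3].
have qn n : 0 < q ^+ n by rewrite exprn_gt0.
have low n : (2 <= n)%N -> q ^+ n <= q ^+ 2.
  by move=> n2; apply: ler_wiXn2l => //; exact: ltW.
exists (eps * q ^+ 2, A * q ^+ k, B * q ^+ l); split.
- by rewrite mulr_gt0//=.
- by rewrite mulr_gt0//=; apply: ler_pM => //; [exact: ltW|exact: ltW|exact: low].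
- by rewrite mulr_gt0//=; apply: ler_pM => //; [exact: ltW|exact: ltW|exact: low].
- by rewrite mulrACA -exprD kl ler_pM2r.
- move=> i x qx; have {}qx := le_trans qx (norm_le_enorm x); split.
  + by apply: le_trans (coord_le_enorm _ _) _; apply: ru => //; rewrite q0.
  + by apply: le_trans (coord_le_enorm _ _) _; apply: rv => //; rewrite q0.
  + have -> : pd i theta x = grad theta x 0 i by rewrite mxE.
    rewrite mulrC ler_pdivrMr// -mulrA -exprD.
    by apply: le_trans (coord_le_enorm _ _) _; apply: rt => //; rewrite q0.
Qed.

Lemma constant_of_gradient f : Ck 1 f -> (forall j x, pd j f x = 0) -> forall x, f x = f 0.
Proof.
move=> Cf df x; apply/eqP; rewrite -subr_eq0 -normr_le0.
have := @cube_lipschitz R f `|x| 0 0 x; rewrite mulr0 mul0r; apply => //.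
- by move=> i y; exact: Ck_derivable Cf i y.
- by move=> i z _; rewrite df normr0.
- by rewrite normr0.
Qed.

(** A constant that decays at a positive rate, however slow, is zero. *)
Lemma constant_rate u k A : 0 < A -> (0 < k)%N -> rate u k A -> (forall x, u x = u 0) ->
  forall x, u x = 0.
Proof.
move=> A0 k0 [q0 q00 r] cu x; rewrite cu; apply/rowP => i; rewrite mxE; apply/eqP.
apply/negPn/negP => nz; have a0 : 0 < `|u 0 0 i| by rewrite normr_gt0.
set a := `|u 0 0 i| in a0.
pose q := Num.min (Num.min 1 (q0 / 2)) (a / (2 * A)).
have qp : 0 < q by rewrite !lt_min ltr01 !divr_gt0// mulr_gt0.
have q1 : q <= 1 by rewrite !ge_min lexx.
have qq0 : q < q0.
  by apply: (@le_lt_trans _ _ (q0 / 2)); rewrite ?ltr_pdivrMr ?ltr_pMr ?ltr1n// !ge_min lexx orbT.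
have qa : q <= a / (2 * A) by rewrite ge_min lexx orbT.
pose x0 : E := q ^- 3 *: axis ord0.
have x0q : q ^- 3 <= enorm x0.
  apply: le_trans (coord_le_enorm x0 ord0).
  by rewrite /x0 mxE axisE eqxx mulr1; exact: ler_norm.
have := r q; rewrite qp qq0 => /(_ isT x0 x0q); rewrite cu.
have := coord_le_enorm (u 0) i; rewrite -/a => h1 h2.
have {h1 h2} := le_trans h1 h2; apply/negP; rewrite -ltNge.
apply: (@le_lt_trans _ _ (A * q)).
  rewrite ler_pM2l//; case: k k0 {r} => // k _.
  by rewrite exprS ger_pMr// exprn_ile1// ltW.
apply: (@le_lt_trans _ _ (A * (a / (2 * A)))); first by rewrite ler_pM2l.
have -> : A * (a / (2 * A)) = a / 2 by field; rewrite gt_eqF.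
by rewrite ltr_pdivrMr// ltr_pMr// ltr1n.
Qed.

Lemma liouville u p v theta k l : smooth_tropical_climate_solution u p v theta ->
  (2 <= k)%N -> (2 <= l)%N -> (k + l = 6)%N ->
  (forall eps, 0 < eps -> rate u 2 eps) ->
  (exists2 M : R, 0 < M & forall eps : R, 0 < eps -> exists A B : R,
     [/\ 0 < A <= M, 0 < B <= M, A * B <= eps, rate v k A & rate (grad theta) (l + 3) B]) ->
  [/\ forall x, u x = 0, forall x, v x = 0 & exists c : R, forall x, theta x = c].
Proof.
move=> sol k2 l2 kl ru h.
have trop := solution_tropical sol.
have grad0 := gradients_vanish trop (rates_decaying k2 l2 kl ru h).
have [[CU CV _ CT] _ _ _ _] := trop.
have [M M0 {}h] := h; have [A [_ [/andP[A0 _] _ _ rv _]]] := h 1 ltr01.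
split.
- apply: (@constant_rate u 2 1) => //; first exact: ru.
  move=> x; apply/rowP => i.
  apply: (@constant_of_gradient (fun y => u y 0 i)); first exact: Ck_le (CU i).
  by move=> j y; have [] := grad0 i j y.
- apply: (@constant_rate v k A) => //; first exact: leq_trans k2.
  move=> x; apply/rowP => i.
  apply: (@constant_of_gradient (fun y => v y 0 i)); first exact: Ck_le (CV i).
  by move=> j y; have [] := grad0 i j y.
- exists (theta 0); apply: constant_of_gradient; first exact: Ck_le CT.
  by move=> j y; have [] := grad0 0 j y.
Qed.

Lemma rates_bigO_littleo u v k l (a b : R) : a = - (k%:R / 3) -> b = - (l%:R / 3) ->
  bigO_at_infinity u a -> littleo_at_infinity v b ->
  exists2 M : R, 0 < M & forall eps : R, 0 < eps -> exists A B : R,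
     [/\ 0 < A <= M, 0 < B <= M, A * B <= eps, rate u k A & rate v l B].
Proof.
move=> -> -> /bigO_rate[A A0 ru] ov; exists (Num.max A 1); first by rewrite lt_max A0.
move=> eps e0; exists A, (Num.min 1 (eps / A)).
have B0 : 0 < Num.min 1 (eps / A) by rewrite lt_min ltr01 divr_gt0.
split => //; first by rewrite A0 le_max lexx.
- by rewrite B0 ge_min le_max lexx orbT.
- by rewrite mulrC -ler_pdivlMr// ge_min lexx orbT.
- exact: littleo_rate.
Qed.

End Conclusion.

Unset Implicit Arguments.

Theorem corollary1p4 (R : realType) (u : 'rV[R]_3 -> 'rV[R]_3)
    (p : 'rV[R]_3 -> R) (v : 'rV[R]_3 -> 'rV[R]_3) (theta : 'rV[R]_3 -> R) :
  smooth_tropical_climate_solution u p v theta ->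
  [\/ [/\ littleo_at_infinity u (- (2 / 3)),
          bigO_at_infinity v (- (2 / 3)) &
          littleo_at_infinity (grad theta) (- (7 / 3))],
      [/\ littleo_at_infinity u (- (2 / 3)),
          littleo_at_infinity v (- (2 / 3)) &
          bigO_at_infinity (grad theta) (- (7 / 3))],
      [/\ littleo_at_infinity u (- (2 / 3)),
          bigO_at_infinity v (- (4 / 3)) &
          littleo_at_infinity (grad theta) (- (5 / 3))] |
      [/\ littleo_at_infinity u (- (2 / 3)),
          littleo_at_infinity v (- (4 / 3)) &
          bigO_at_infinity (grad theta) (- (5 / 3))]] ->
  [/\ forall x, u x = 0, forall x, v x = 0 &
      exists c : R, forall x, theta x = c].
Proof.
move=> sol decay.
have swap k l : (exists2 M : R, 0 < M & forall eps : R, 0 < eps -> exists A B : R,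
     [/\ 0 < A <= M, 0 < B <= M, A * B <= eps, rate (grad theta) k A & rate v l B]) ->
   exists2 M : R, 0 < M & forall eps : R, 0 < eps -> exists A B : R,
     [/\ 0 < A <= M, 0 < B <= M, A * B <= eps, rate v l A & rate (grad theta) k B].
  move=> [M M0 h]; exists M => // eps /h[A [B [hA hB AB rA rB]]].
  by exists B, A; split=> //; rewrite mulrC.
case: decay => -[/(littleo_rate (k := 2)) ou].
all: have ru eps : 0 < eps -> rate u 2 eps by move=> e0; apply: ou.
- move=> Ov ot; apply: (@liouville R u p v theta 2 4 sol) => //.
  exact: rates_bigO_littleo Ov ot.
- move=> ov Ot; apply: (@liouville R u p v theta 2 4 sol) => //; apply: swap.
  exact: rates_bigO_littleo Ot ov.
- move=> Ov ot; apply: (@liouville R u p v theta 4 2 sol) => //.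
  exact: rates_bigO_littleo Ov ot.
- move=> ov Ot; apply: (@liouville R u p v theta 4 2 sol) => //; apply: swap.
  exact: rates_bigO_littleo Ot ov.
Qed.
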